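(* (i) The commutative ring $\mathrm{PQSym}$ (over $\mathbb{Z}$) is generated by the set $$\{q_n(\alpha):\alpha\in \mathrm{eLYN}_{\mathrm{o}},\ n\in\mathbb{N}\}$$ subject to the following complete set of relations: $$\sum_{i=0}^n(-1)^i q_i(\alpha)q_{n-i}(\alpha)=0,\qquad \alpha\in \mathrm{eLYN}_{\mathrm{o}},\ n\in\mathbb{N}.$$ That is, the ring homomorphism $\mathbb{Z}[Y_n(\alpha):\alpha\in \mathrm{eLYN}_{\mathrm{o}},n\in\mathbb{N}]\to \mathrm{PQSym}$, $Y_n(\alpha)\mapsto q_n(\alpha)$, from the polynomial ring in independent commuting variables $Y_n(\alpha)$ is surjective, and its kernel is the ideal generated by the elements $\sum_{i=0}^n(-1)^iY_i(\alpha)Y_{n-i}(\alpha)$, $\alpha\in\mathrm{eLYN}_{\mathrm{o}}$, $n\in\mathbb{N}$, where $Y_0(\alpha):=1$. In particular, the family $$\prod_{\alpha\in \mathrm{eLYN}_{\mathrm{o}}}q_{\lambda_\alpha}(\alpha),$$ indexed by all families $(\lambda_\alpha)_{\alpha\in \mathrm{eLYN}_{\mathrm{o}}}$ of strict partitions of which only finitely many are nonempty, is a $\mathbb{Z}$-basis of $\mathrm{PQSym}$, where $q_\lambda(\alpha):=q_{\lambda_1}(\alpha)q_{\lambda_2}(\alpha)\cdots$ for any partition $\lambda$ (and $q_\emptyset(\alpha)=1$). (ii) The ring $\mathrm{PQSym}_{\mathbb{Q}}=\mathrm{PQSym}\otimes_{\mathbb{Z}}\mathbb{Q}$ has the free commutative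 polynomial basis $$\{q_n(\alpha):\alpha\in \mathrm{eLYN}_{\mathrm{o}},\ n\in\mathbb{N}_{\mathrm{o}}\},$$ i.e. these elements are algebraically independent over $\mathbb{Q}$ and generate $\mathrm{PQSym}_{\mathbb{Q}}$ as a $\mathbb{Q}$-algebra. Among this basis are the symmetric functions $q_n=q_n((1))$, $n\in\mathbb{N}_{\mathrm{o}}$, which form a polynomial basis of $\Gamma_{\mathbb{Q}}=\Gamma\otimes_{\mathbb{Z}}\mathbb{Q}$.
   Context: $\mathbb{N}$ (resp. $\mathbb{N}_{\mathrm{o}}$) is the set of positive (resp. odd positive) integers; $[n]=\{1,\dots,n\}$. A composition $\alpha=(\alpha_1,\dots,\alpha_r)$ of $n\ge 1$, written $\alpha\vDash n$, is an ordered tuple of positive integers with sum $n$; its length is $r$ and its weight is $n$; $D(\alpha)=\{\alpha_1,\alpha_1+\alpha_2,\dots,\alpha_1+\cdots+\alpha_{r-1}\}\subseteq[n-1]$. $\mathscr{C}_{\mathrm{o}}$ is the set of nonempty compositions all of whose parts are odd. For $k\in\mathbb{N}$, $k\cdot\alpha=(k\alpha_1,\dots,k\alpha_r)$. A strict partition is a finite strictly decreasing sequence of positive integers (possibly empty). QSym: in $\mathbb{Z}[[x_1,x_2,\dots]]$ put $M_\alpha=\sum_{i_1<\cdots<i_r}x_{i_1}^{\alpha_1}\cdots x_{i_r}^{\alpha_r}$ and, for $\alpha\vDash n$, $F_\alpha=\sum x_{i_1}\cdots x_{i_n}$ over all $i_1\le\cdots\le i_n$ with $i_k<i_{k+1}$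 whenever $k\in D(\alpha)$. QSym is the subring with $\mathbb{Z}$-basis $1$ and all $M_\alpha$ (equivalently $1$ and all $F_\alpha$). PQSym: a peak subset of $[n-1]$ is a set $P\subseteq\{2,\dots,n-1\}$ such that $i\in P$ implies $i-1\notin P$. For such $P$ put $K_P=2^{|P|+1}\sum F_\alpha$, the sum over all $\alpha\vDash n$ with $P\subseteq D(\alpha)\triangle(D(\alpha)+1)$, where $D+1=\{x+1:x\in D\}$ and $\triangle$ is symmetric difference ($K_P$ depends on $n$ as well). PQSym is the subring of QSym with $\mathbb{Z}$-basis $1$ and all $K_P$ ($n\geq 1$, $P$ a peak subset of $[n-1]$). For $\alpha\vDash n$ let $P(\alpha)=\{i\in D(\alpha)\cap\{2,\dots,n-1\}: i-1\notin D(\alpha)\}$. There is a surjective ring homomorphism $\vartheta:\mathrm{QSym}\to\mathrm{PQSym}$, $F_\alpha\mapsto K_{P(\alpha)}$ (and $1\mapsto 1$). The monomial peak functions are $L_\alpha=\vartheta(M_\alpha)$, $\alpha\in\mathscr{C}_{\mathrm{o}}$; together with $1$ they form a $\mathbb{Z}$-basis of PQSym. $\Gamma$ is the subring of symmetric functions (a subring of PQSym) generated by the $q_n$, $n\ge1$, where $\sum_{n\ge0}q_nz^n=\prod_{i\ge1}\frac{1+x_iz}{1-x_iz}$. Lambda operations on PQSym: PQSym is a $\lambda$-ring whose Adams operations are the ring endomorphisms $\Phi^n$ with $\Phi^n(L_\alpha)=L_{n\cdot\alpha}$ for $n$ odd and $\Phi^n(L_\alpha)=0$ for $n$ even ($\alpha\in\mathscr{C}_{\mathrm{o}}$).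 Its $\lambda$-operations $\tilde\lambda^n:\mathrm{PQSym}\to\mathrm{PQSym}$ are given by $\sum_{n\ge0}\tilde\lambda^n(f)t^n=\exp\big(\sum_{n\ge1}(-1)^{n-1}\Phi^n(f)t^n/n\big)$. For $\alpha\in\mathscr{C}_{\mathrm{o}}$ and $n\ge0$, $q_n(\alpha):=\tilde\lambda^n(L_\alpha)\in\mathrm{PQSym}$, so $q_0(\alpha)=1$ and $\sum_{n\ge0}q_n(\alpha)t^n=\exp\big(\sum_{n\in\mathbb{N}_{\mathrm{o}}}L_{n\cdot\alpha}t^n/n\big)$. In particular $q_n((1))=q_n$. Lyndon words: the lexicographic order on compositions (words over $\mathbb{N}$) is the usual one, with a proper prefix smaller than the word. A nonempty word $(a_1,\dots,a_m)$ is Lyndon if it is lexicographically smaller than each of its proper tails $(a_i,\dots,a_m)$, $2\le i\le m$ (words of length 1 are Lyndon). A composition is elementary if the gcd of its parts is 1. $\mathrm{eLYN}_{\mathrm{o}}$ is the set of elementary Lyndon compositions all of whose parts are odd. *)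

(* Defs.v *)
From HB Require Import structures.
From mathcomp Require Import all_boot all_order all_algebra.
From mathcomp Require Import finmap.
From mathcomp Require Import boolp classical_sets functions cardinality fsbigop.
From mathcomp Require Import monalg.

Set Implicit Arguments.
Unset Strict Implicit.
Unset Printing Implicit Defensive.

Import Order.TTheory GRing.Theory Num.Theory.

Local Open Scope classical_set_scope.
Local Open Scope ring_scope.

(** Formal power series in countably many variables.  A monomial is a finitely
    supported exponent function; the variable index starts at 0, so that [x_i]
    below is the mathematical x_(i+1). *)

Notation mono := {cmonom nat}.

Record fps (R : Type) := FPS { fcoef : mono -> R }.

HB.instance Definition _ (R : Type) := gen_eqMixin (fps R).
HB.instance Definition _ (R : Type) := gen_choiceMixin (fps R).

Lemma fpsP (R : Type) (f g : fps R) : fcoef f =1 fcoef g -> f = g.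
Proof. by case: f g => [f] [g] /= /funext ->. Qed.

(* The index set of the Cauchy product is finite, see [cauchy_coefE]. *)
Definition mono_split (m : mono) : set (mono * mono) :=
  [set p | mmul p.1 p.2 = m].

Section FPSRing.
Variable R : comNzRingType.
Implicit Types (f g h : fps R) (m : mono).

Definition fps_zero := FPS (fun=> 0 : R).
Definition fps_one := FPS (fun m => (m == mone)%:R : R).
Definition fps_opp f := FPS (fun m => - fcoef f m).
Definition fps_add f g := FPS (fun m => fcoef f m + fcoef g m).
Definition fps_scale (c : R) f := FPS (fun m => c * fcoef f m).
Definition cauchy_coef f g m : R :=
  \sum_(p \in mono_split m) fcoef f p.1 * fcoef g p.2.
Arguments cauchy_coef : simpl never.
Definition fps_mul f g := FPS (cauchy_coef f g).

Definition divisors_mono m : {fset mono} :=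
  [fset x | x in codom
    (fun phi : {ffun finsupp m -> 'I_(\max_(i <- finsupp m) m i).+1} =>
       [cmonom (phi i : nat) | i : finsupp m]%M)]%fset.

Lemma divisors_monoP m a b : mmul a b = m -> a \in divisors_mono m.
Proof.
move=> abm; have le_am i : (a i <= m i)%N by rewrite -abm cmM leq_addr.
have bnd (i : finsupp m) :
    (a (val i) < (\max_(j <- finsupp m) m j).+1)%N.
  rewrite ltnS (leq_trans (le_am _))//.
  by rewrite (big_fsetD1 (val i) (valP i)) /= leq_maxl.
rewrite !inE /=; apply/codomP; exists [ffun i : finsupp m => Ordinal (bnd i)].
apply/eqP/cmP => i; rewrite cmE fsfun_ffun; case: insubP => [u im <-|].
  by rewrite /= ffunE.
move=> im; apply/eqP; rewrite -leqn0 (leq_trans (le_am i))//.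
by rewrite leqn0 cmE_eq0.
Qed.

Lemma cauchy_coefE (D : {fset mono}) f g m :
  (forall a b, mmul a b = m -> a \in D) ->
  cauchy_coef f g m =
    \sum_(a <- D) \sum_(b <- D | mmul a b == m) fcoef f a * fcoef g b.
Proof.
move=> DP; have finD : finite_set [set` D] by exact: finite_fset.
under eq_bigr do rewrite big_mkcond fsbig_seq ?fset_uniq//=.
rewrite fsbig_seq ?fset_uniq//= pair_fsbig//=.
transitivity (\sum_(p \in ([set` D] `*` [set` D]) `&` mono_split m)
    fcoef f p.1 * fcoef g p.2).
  rewrite /cauchy_coef /=; apply: eq_fsbigl; apply/seteqP.
  split=> [[a b] /= abm | [a b] []//].
  by split=> //; split=> /=; [exact: DP abm | apply: (DP b a); rewrite mulmC].
rewrite fsbig_mkcondr; apply: eq_fsbigr => -[a b] _ /=.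
rewrite /patch; congr (if _ then _ else _).
by apply/idP/eqP; rewrite inE.
Qed.

Lemma cauchy_coef_prod (D : {fset mono}) f g h m :
  (forall a b, mmul a b = m -> a \in D) ->
  cauchy_coef (fps_mul f g) h m =
    \sum_(a <- D) \sum_(b <- D) \sum_(c <- D | mmul (mmul a b) c == m)
      fcoef f a * fcoef g b * fcoef h c.
Proof.
move=> DP.
transitivity (\sum_(e <- D) \sum_(c <- D) \sum_(a <- D) \sum_(b <- D)
    if (mmul a b == e) && (mmul e c == m)
    then fcoef f a * fcoef g b * fcoef h c else 0).
  rewrite (cauchy_coefE _ _ DP); apply: eq_bigr => e _; rewrite big_mkcond /=.
  apply: eq_bigr => c _; case: eqP => [ecm|_]; last first.
    by rewrite big1// => a _; rewrite big1// => b _; rewrite andbF.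
  rewrite (@cauchy_coefE D); last first.
    by move=> a b abe; apply: (DP a (mmul b c)); rewrite mulmA abe.
  rewrite mulr_suml; apply: eq_bigr => a _; rewrite mulr_suml big_mkcond /=.
  by apply: eq_bigr => b _; rewrite andbT.
under eq_bigr do rewrite exchange_big /=.
rewrite exchange_big /=; apply: eq_bigr => a _.
under eq_bigr do rewrite exchange_big /=.
rewrite exchange_big /=; apply: eq_bigr => b _.
rewrite exchange_big /= [RHS]big_mkcond /=; apply: eq_bigr => c _.
have [abD|abND] := boolP (mmul a b \in D).
  rewrite (big_fsetD1 _ abD) /= eqxx /= big_seq big1 ?addr0// => e.
  rewrite in_fsetD1 => /andP[eab _].
  by rewrite [mmul a b == e]eq_sym (negbTE eab).
rewrite big_seq big1 => [|e eD]; last first.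
  by case: (mmul a b =P e) => // abe; rewrite abe eD in abND.
by case: eqP => // abcm; rewrite (DP _ _ abcm) in abND.
Qed.

Lemma fps_mulC : commutative fps_mul.
Proof.
move=> f g; apply: fpsP => m; rewrite /= /cauchy_coef /=.
rewrite (@reindex_fsbig _ _ _ _ _ (fun p => (p.2, p.1)) (mono_split m)) /=.
  by apply: eq_fsbigr => p _; rewrite mulrC.
split=> [[a b] /=|[a b] [c d] _ _ [-> ->]//|[a b] /= abm].
  by rewrite /mono_split /= mulmC.
by exists (b, a) => //=; rewrite /mono_split /= mulmC.
Qed.

Lemma fps_mulA : associative fps_mul.
Proof.
move=> f g h; apply: fpsP => m.
have DP := @divisors_monoP m.
rewrite [in LHS]fps_mulC /= !(cauchy_coef_prod _ _ _ DP).
under eq_bigr do under eq_bigr do rewrite big_mkcond /=.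
under eq_bigr do rewrite exchange_big /=.
rewrite exchange_big /=; apply: eq_bigr => a _; apply: eq_bigr => b _.
rewrite [RHS]big_mkcond; apply: eq_bigr => c _.
rewrite [mmul _ a]mulmC mulmA.
by case: eqP => // _; rewrite mulrC mulrA.
Qed.

Lemma fps_mul1 : left_id fps_one fps_mul.
Proof.
move=> f; apply: fpsP => m; rewrite /= (cauchy_coefE _ _ (@divisors_monoP m)) /=.
have D1 : mone \in divisors_mono m by apply: (@divisors_monoP m mone m); rewrite mul1m.
have Dm : m \in divisors_mono m by apply: (@divisors_monoP m m mone); rewrite mulm1.
rewrite (big_fsetD1 _ D1) /= [X in _ + X]big_seq [X in _ + X]big1 ?addr0.
  rewrite big_mkcond (big_fsetD1 _ Dm) /= mul1m !eqxx mul1r.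
  rewrite big_seq big1 ?addr0// => b; rewrite in_fsetD1 mul1m => /andP[bm _].
  by rewrite (negbTE bm).
by move=> a; rewrite in_fsetD1 => /andP[/negbTE a1 _]; rewrite big1// => b _; rewrite a1 mul0r.
Qed.

Lemma fps_mulDl : left_distributive fps_mul fps_add.
Proof.
move=> f g h; apply: fpsP => m.
rewrite /fps_add /=.
rewrite !(cauchy_coefE _ _ (@divisors_monoP m)) -big_split /=.
apply: eq_bigr => a _; rewrite -big_split /=.
by apply: eq_bigr => b _; rewrite mulrDl.
Qed.

Lemma fps_addA : associative fps_add.
Proof. by move=> f g h; apply: fpsP => m /=; rewrite addrA. Qed.

Lemma fps_addC : commutative fps_add.
Proof. by move=> f g; apply: fpsP => m /=; rewrite addrC. Qed.

Lemma fps_add0 : left_id fps_zero fps_add.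
Proof. by move=> f; apply: fpsP => m /=; rewrite add0r. Qed.

Lemma fps_addN : left_inverse fps_zero fps_opp fps_add.
Proof. by move=> f; apply: fpsP => m /=; rewrite addNr. Qed.

HB.instance Definition _ :=
  GRing.isZmodule.Build (fps R) fps_addA fps_addC fps_add0 fps_addN.

Lemma fps_one_neq0 : fps_one != 0 :> fps R.
Proof.
apply/eqP => /(congr1 (fun f => fcoef f mone)) /= /eqP.
by rewrite eqxx oner_eq0.
Qed.

HB.instance Definition _ := GRing.Zmodule_isComNzRing.Build (fps R)
  fps_mulA fps_mulC fps_mul1 fps_mulDl fps_one_neq0.

Lemma fps_scaleA a b f : fps_scale a (fps_scale b f) = fps_scale (a * b) f.
Proof. by apply: fpsP => m /=; rewrite mulrA. Qed.

Lemma fps_scale1 : left_id 1 fps_scale.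
Proof. by move=> f; apply: fpsP => m /=; rewrite mul1r. Qed.

Lemma fps_scaleDr : right_distributive fps_scale +%R.
Proof. by move=> a f g; apply: fpsP => m /=; rewrite mulrDr. Qed.

Lemma fps_scaleDl f : {morph fps_scale^~ f : a b / a + b}.
Proof. by move=> a b; apply: fpsP => m /=; rewrite mulrDl. Qed.

HB.instance Definition _ := GRing.Zmodule_isLmodule.Build R (fps R)
  fps_scaleA fps_scale1 fps_scaleDr fps_scaleDl.

Lemma fps_scaleAl a f g : a *: (f * g) = (a *: f) * g.
Proof.
apply: fpsP => m /=.
rewrite !(cauchy_coefE _ _ (@divisors_monoP m)) mulr_sumr; apply: eq_bigr => b _.
by rewrite mulr_sumr; apply: eq_bigr => c _ /=; rewrite mulrA.
Qed.

HB.instance Definition _ :=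
  GRing.Lmodule_isLalgebra.Build R (fps R) fps_scaleAl.
HB.instance Definition _ := GRing.Lalgebra_isComAlgebra.Build R (fps R).

End FPSRing.

(** Spans, linear extensions, bases and polynomial evaluation. *)

Section Linear.
Variable A : zmodType.

Definition lincomb (T : choiceType) (b : T -> A) (c : {fsfun T -> int with 0}) : A :=
  \sum_(t <- finsupp c) b t *~ c t.

Definition zspan (G : set A) : set A :=
  [set f | exists s : seq (int * A),
     (forall p, p \in s -> G p.2) /\ f = \sum_(p <- s) p.2 *~ p.1].

Definition zbasis (S : set A) (T : choiceType) (b : T -> A) : Prop :=
  (forall c, lincomb b c = 0 -> forall t, c t = 0) /\ range (lincomb b) = S.

(* When [b] is linearly independent over Z, [linext b v] is the Z-linear map
   with [b t |-> v t] on the Z-span of [b], and it is 0 outside that span. *)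
Definition linext (T : choiceType) (b v : T -> A) (f : A) : A :=
  xget 0 [set g | exists c, f = lincomb b c /\ g = lincomb v c].

Lemma linextE (T : choiceType) (b v : T -> A) c :
  (forall c1 c2, lincomb b c1 = lincomb b c2 -> c1 = c2) ->
  linext b v (lincomb b c) = lincomb v c.
Proof.
move=> b_inj; apply: xget_unique; first by exists c.
by move=> g [c' [/b_inj <- ->]].
Qed.

End Linear.

Definition qspan (A : lmodType rat) (G : set A) : set A :=
  [set f | exists s : seq (rat * A),
     (forall p, p \in s -> G p.2) /\ f = \sum_(p <- s) p.1 *: p.2].

Definition ideal_gen (A : comNzRingType) (G : set A) : set A :=
  [set f | exists s : seq (A * A),
     (forall p, p \in s -> G p.2) /\ f = \sum_(p <- s) p.1 * p.2].

Definition subring_gen (A : nzRingType) (G : set A) : set A :=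
  smallest [set S : set A | subring_closed [in S]] G.

(** [polyZ I] and [polyQ I] are the polynomial rings over Z and Q in variables
    indexed by [I]; [evalZ] and [evalQ] substitute [b i] for the variable [i]. *)
Notation polyZ I := {malg int[{cmonom I}]}.
Notation polyQ I := {malg rat[{cmonom I}]}.

Definition meval (I : choiceType) (A : comNzRingType) (b : I -> A)
    (m : {cmonom I}) : A :=
  \prod_(i <- finsupp m) b i ^+ m i.

Definition evalZ (I : choiceType) (A : comNzRingType) (b : I -> A)
    (p : polyZ I) : A :=
  mmap intr (meval b) p.

Definition evalQ (I : choiceType) (A : comAlgType rat) (b : I -> A)
    (p : polyQ I) : A :=
  mmap (in_alg A) (meval b) p.

(* [b] is algebraically independent over Q and generates the Q-algebra [S]. *)
Definition poly_basis (A : comAlgType rat) (S : set A) (I : choiceType)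
    (b : I -> A) : Prop :=
  injective (evalQ b) /\ range (evalQ b) = S.

(** The ambient ring is Q[[x_0, x_1, ...]]; Z[[x_0, x_1, ...]] is identified with
    its subring of series with integer coefficients, and, accordingly, S (x) Q
    with the Q-span of S for a subgroup S of Z[[x_0, x_1, ...]]. *)
Notation QX := (fps rat).

(* The series \sum_(t in S) x^(e t); every monomial must be of the form [e t]
   for finitely many [t] in [S] only. *)
Definition monomial_sum (T : choiceType) (S : set T) (e : T -> mono) : QX :=
  FPS (fun m => \sum_(t \in S `&` e @^-1` [set m]) (1 : rat)).

(** Compositions are sequences of positive integers; the empty one is included,
    with [M [::] = F [::] = 1]. *)
Definition is_comp (a : seq nat) : bool := all (ltn 0) a.
Definition composition : choiceType := {a : seq nat | is_comp a}.
Definition odd_composition : choiceType := {a : seq nat | all odd a}.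

Definition descents (a : seq nat) : {fset nat} :=
  [fset sumn (take i.+1 a) | i in iota 0 (size a).-1]%fset.

Definition scale_comp (k : nat) (a : seq nat) : seq nat := map (muln k) a.

Definition M (a : seq nat) : QX :=
  monomial_sum [set w : seq nat | size w = size a /\ sorted ltn w]
    (fun w => \big[mmul/mone]_(p <- zip w a) expcmn (ucm p.1) p.2).

Definition F (a : seq nat) : QX :=
  monomial_sum
    [set w : seq nat | [/\ size w = sumn a, sorted leq w &
       forall k, k \in descents a -> (nth 0 w k.-1 < nth 0 w k)%N]]
    (fun w => \big[mmul/mone]_(i <- w) ucm i).

Definition peak_subset (n : nat) (P : {fset nat}) : Prop :=
  forall i, i \in P -> (2 <= i < n)%N /\ i.-1 \notin P.

(* D triangle (D + 1) for D = D(a). *)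
Definition descents_shift_diff (a : seq nat) : {fset nat} :=
  let D := descents a in
  let D1 := [fset i.+1 | i in D]%fset in
  ((D `\` D1) `|` (D1 `\` D))%fset.

Definition K (n : nat) (P : {fset nat}) : QX :=
  (\sum_(a \in [set a | [/\ is_comp a, sumn a = n &
                           (P `<=` descents_shift_diff a)%fset]]) F a)
  *+ (2 ^ (#|` P|).+1).

Definition PQSym : set QX :=
  zspan [set f | f = 1 \/
    exists n P, [/\ (0 < n)%N, peak_subset n P & f = K n P]].

Definition PQSymQ : set QX := qspan PQSym.

Definition peaks (a : seq nat) : {fset nat} :=
  [fset i in descents a | (2 <= i < sumn a)%N && (i.-1 \notin descents a)]%fset.

(* vartheta, as the Z-linear map with the prescribed values on the basis of QSym
   formed by 1 = F [::] and the F_a. *)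
Definition theta : QX -> QX :=
  linext (fun a : composition => F (val a))
         (fun a : composition => if val a == [::] then 1 else K (sumn (val a)) (peaks (val a))).

(* [L [::] = theta 1 = 1]. *)
Definition L (a : seq nat) : QX := theta (M a).

(* Phi^n, as the Z-linear map with the prescribed values on the Z-basis of PQSym
   formed by 1 = L [::] and the L_a, a a nonempty composition with odd parts. *)
Definition adams (n : nat) : QX -> QX :=
  linext (fun a : odd_composition => L (val a))
         (fun a : odd_composition => if val a == [::] then 1
                           else if odd n then L (scale_comp n (val a)) else 0).

(* The coefficient of t^n in exp (\sum_(k >= 1) a k t^k); [a 0] is not used. *)
Definition exp_coef (A : comAlgType rat) (a : nat -> A) (n : nat) : A :=
  \sum_(j < n.+1)
    (j`!%:R^-1 : rat) *: ((\poly_(k < n.+1) (if (k == 0)%N then 0 else a k)) ^+ j)`_n.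

Definition lambda_op (n : nat) (f : QX) : QX :=
  exp_coef (fun k => ((-1) ^+ k.-1 / k%:R : rat) *: adams k f) n.

Definition q (n : nat) (a : seq nat) : QX := lambda_op n (L a).

Definition q_part (l : seq nat) (a : seq nat) : QX := \prod_(i <- l) q i a.

(** The symmetric functions q_n: on a monomial in the variables x_0, ..., x_(N-1),
    the coefficient of the infinite product \prod_i (1 + x_i z) / (1 - x_i z) is
    that of its first N factors, and 1 / (1 - x_i z) is the geometric series,
    which may be truncated at z^n. *)
Definition xvar (i : nat) : QX := FPS (fun m => (m == ucm i)%:R).

Definition qsym (n : nat) : QX :=
  FPS (fun m =>
    let N := (\max_(i <- finsupp m) i).+1 in
    fcoef (\prod_(i < N) ((1 + (xvar i)%:P * 'X) * \poly_(k < n.+1) xvar i ^+ k))`_n m).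

Definition Gamma : set QX := subring_gen [set f | exists2 n, (0 < n)%N & f = qsym n].

Definition GammaQ : set QX := qspan Gamma.

(** Lyndon words, with the lexicographic order on [seq nat]. *)
Definition lyndon (w : seq nat) : bool :=
  (w != [::]) &&
  all (fun i => ((w : seqlexi nat) < (drop i w : seqlexi nat))%O)
      (iota 1 (size w).-1).

Definition elementary (w : seq nat) : bool := (\big[gcdn/0]_(i <- w) i == 1)%N.

Definition is_eLYNo (w : seq nat) : bool := [&& lyndon w, elementary w & all odd w].

Definition eLYNo : choiceType := {w : seq nat | is_eLYNo w}.

Definition posnat : choiceType := {n : nat | (0 < n)%N}.
Definition oddnat : choiceType := {n : nat | odd n}.

(** The presentation of PQSym. *)
Definition qindex : choiceType := (eLYNo * posnat)%type.

Definition qgen (x : qindex) : QX := q (val x.2) (val x.1).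

Definition Y (a : eLYNo) (n : nat) : polyZ qindex :=
  if insub n is Some k then << ucm ((a, k) : qindex) >> else 1.

Definition qrel (a : eLYNo) (n : nat) : polyZ qindex :=
  \sum_(i < n.+1) (-1) ^+ i * Y a i * Y a (n - i).

(** Families of strict partitions, almost all empty. *)
Definition is_strict_part (l : seq nat) : bool := sorted gtn l && all (ltn 0) l.
Definition strict_part : choiceType := {l : seq nat | is_strict_part l}.
Definition strict_part0 : strict_part := Sub [::] isT.

Definition spfam : choiceType := {fsfun eLYNo -> strict_part with strict_part0}.

Definition qfam (l : spfam) : QX :=
  \prod_(a <- finsupp l) q_part (val (l a)) (val a).

Definition qodd (x : eLYNo * oddnat) : QX := q (val x.2) (val x.1).

(* Main.v *)
(* Identify a series with its coefficients [co f w] at the words [w], that is at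
   the monomials x_0^(w_0) x_1^(w_1) ... Then PQSym consists of the series of
   bounded degree such that [co f w] does not change when zeros are inserted in
   [w], such that \sum_(p + q = k) (-1)^q co f (u p q v) = 0 for k > 0, and such
   that 2^(number of nonzero letters of w) divides [co f w].  These conditions
   define a ring, an element of which is determined by its coefficients at the
   words with odd letters, with respect to which the L_a are triangular.

   Killing all but finitely many variables turns \sum_n q_n(a) t^n into a product
   of factors (1 + u t) / (1 - u t), with u a monomial.  This gives the relations
   and the integrality of q_n(a), and, through the norm of the extension
   A[z] / A[z^d], it shows that q_n(d a) is, for d odd, an integral polynomial in
   the q_k(a).

   If w = b_1^(n_1) b_2^(n_2) ... is the factorization of a word with odd letters
   into decreasing Lyndon words, then w is the largest word at which
   \prod_i q_(n_i)(b_i) does not vanish, and the coefficient is 2^(size w).  Hence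
   these products generate PQSym over Z.  Modulo the relations, every polynomial
   is a combination of strict monomials; by Glaisher's bijection and the Lyndon
   factorization, there are at most as many of them in each weight as words with
   odd letters, so their images are independent.  The same count settles the
   algebraic independence of the q_n(a), n odd. *)

Require Import Defs.
From HB Require Import structures.
From mathcomp Require Import all_boot all_order all_algebra.
From mathcomp Require Import finmap.
From mathcomp Require Import boolp classical_sets functions cardinality fsbigop.
From mathcomp Require Import monalg.
From mathcomp Require Import zify ring lra.
Set Implicit Arguments.
Unset Strict Implicit.
Unset Printing Implicit Defensive.
Import Order.TTheory GRing.Theory Num.Theory.
Local Open Scope classical_set_scope.
Local Open Scope ring_scope.

(** * Coefficients at words *)

(** The cancellation condition says that t disappears when two adjacent variables are set to t and
    -t, a substitution that respects products. The powers of 2 come from one formula: [L a] has the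
    coefficient 2^(number of nonzero letters of w) at each w coarser than a, and 0 elsewhere; the
    signed sum of the [K] behind it collapses because the parts of a are odd. The same formula
    allows a monomial with r nonzero letters to be listed 2^(r-1) times in an alphabet whose odd
    power sums, doubled, are the L_(k a), and (1 + 2 g)^(2^(r-1)) = 1 + 2^r h then gives the
    divisibility of q_n(a). That triangularity holds over Z, and not only over Q, is due to a
    cancellation of factorials: n! q_n(a) is L_a^n up to words with fewer letters, a product of L_b
    counts shuffles at the words of full length, and a decreasing product of Lyndon words with
    multiplicities n_i is a shuffle of its factors in exactly n_1! n_2! ... ways. *)

Definition wmono (w : seq nat) : mono :=
  [cmonom nth 0%N w i | i in [fset j in iota 0 (size w)]%fset]%M.

Lemma wmonoE w i : wmono w i = nth 0%N w i.
Proof.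
rewrite cmE fsfunE inE /= mem_iota add0n /=.
by case: ltnP => // /(nth_default 0%N) ->.
Qed.

Lemma wmono_eq w w' : (forall i, nth 0%N w i = nth 0%N w' i) -> wmono w = wmono w'.
Proof. by move=> ww'; apply/eqP/cmP => i; rewrite !wmonoE. Qed.

Lemma wmono_inj n w w' : size w = n -> size w' = n -> wmono w = wmono w' -> w = w'.
Proof.
move=> <- sw' ww'; apply: (@eq_from_nth _ 0%N) => // i _.
by rewrite -!wmonoE ww'.
Qed.

Definition mono_word (N : nat) (m : mono) : seq nat := [seq m i | i <- iota 0 N].

Lemma mono_wordK N (m : mono) : {in finsupp m, forall i, (i < N)%N} -> wmono (mono_word N m) = m.
Proof.
move=> mN; apply/eqP/cmP => i; rewrite wmonoE.
case: (ltnP i N) => iN.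
  by rewrite (nth_map 0%N) ?size_iota // nth_iota.
rewrite nth_default ?size_map ?size_iota //; apply/esym/eqP.
by rewrite cmE_eq0; apply/negP => /mN; rewrite ltnNge iN.
Qed.

Definition mono_size (m : mono) : nat := (\max_(i <- finsupp m) i).+1.

Lemma mono_sizeP (m : mono) N : (mono_size m <= N)%N -> {in finsupp m, forall i, (i < N)%N}.
Proof.
move=> mN i im; apply: leq_trans mN; rewrite ltnS.
by rewrite (big_fsetD1 i im) /= leq_maxl.
Qed.

Section Co.
Variable R : comNzRingType.
Implicit Types f g : fps R.

Definition co f w := fcoef f (wmono w).

Arguments co : simpl never.

Lemma co_ext f g : (forall w, co f w = co g w) -> f = g.
Proof.
move=> fg; apply: fpsP => m.
by rewrite -(mono_wordK (mono_sizeP (leqnn (mono_size m)))); apply: fg.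
Qed.

Lemma co_cat_nseq0 f w n : co f (w ++ nseq n 0%N) = co f w.
Proof.
congr fcoef; apply: wmono_eq => i; rewrite nth_cat.
by case: ltnP => // iw; rewrite nth_nseq if_same nth_default.
Qed.

Lemma coD f g w : co (f + g) w = co f w + co g w. Proof. by []. Qed.
Lemma coN f w : co (- f) w = - co f w. Proof. by []. Qed.
Lemma coB f g w : co (f - g) w = co f w - co g w. Proof. by []. Qed.
Lemma coZ c f w : co (c *: f) w = c * co f w. Proof. by []. Qed.
Lemma co0 w : co (0 : fps R) w = 0. Proof. by []. Qed.
Lemma co1 w : co (1 : fps R) w = (all (pred1 0%N) w)%:R.
Proof.
rewrite /co /= ; congr (_%:R); congr nat_of_bool; apply/eqP/idP => [w1|/allP w0].
  apply/(all_nthP 0%N) => i iw /=.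
  by rewrite -wmonoE w1 cm1.
apply/eqP/cmP => i; rewrite wmonoE cm1.
case: (ltnP i (size w)) => iw; last by rewrite nth_default.
by apply/eqP/w0/mem_nth.
Qed.

Lemma co_sum I (r : seq I) (P : pred I) F w :
  co (\sum_(i <- r | P i) F i : fps R) w = \sum_(i <- r | P i) co (F i) w.
Proof. by rewrite (big_morph (fun f => co f w) (fun f g => coD f g w) (co0 w)). Qed.

Lemma coMn f n w : co (f *+ n) w = co f w *+ n.
Proof. by elim: n => [|n IH]; rewrite ?mulr0n // !mulrS coD IH. Qed.

Lemma coMz f (z : int) w : co (f *~ z) w = co f w *~ z.
Proof. by case: z => n; rewrite ?NegzE ?mulrNz -?pmulrn ?coN coMn. Qed.

End Co.
Arguments co : simpl never.

(** The pairs of words of the length of [w] with letterwise sum [w]. They list the factorizations of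
    the monomial of [w], so that a Cauchy product becomes a sum over a sequence. *)
Fixpoint splits (w : seq nat) : seq (seq nat * seq nat) :=
  if w is c :: w' then
    [seq (i :: p.1, (c - i)%N :: p.2) | i <- iota 0 c.+1, p <- splits w']
  else [:: ([::], [::])].

Arguments splits : simpl never.

Lemma splits_cons c w : splits (c :: w) =
  [seq (i :: p.1, (c - i)%N :: p.2) | i <- iota 0 c.+1, p <- splits w].
Proof. by []. Qed.

Lemma mem_splits w d e : ((d, e) \in splits w) =
  [&& size d == size w, size e == size w &
    all (fun i => nth 0 d i + nth 0 e i == nth 0 w i)%N (iota 0 (size w))].
Proof.
elim: w d e => [|c w IH] d e.
  by rewrite inE; case: d => [|? ?]; case: e => [|? ?].
rewrite splits_cons; apply/allpairsP/idP => [[[i [d' e']]] /= [ic de [-> ->]] /=|].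
  move: de; rewrite IH => /and3P[/eqP -> /eqP -> H]; rewrite !eqxx /=.
  move: ic; rewrite in_cons mem_iota => ic; apply/andP; split; first lia.
  by rewrite (iotaDl 1 0) all_map.
case: d => [|i d] //; case: e => [|j e]; rewrite /= ?andbF // !eqSS => /and3P[sd se /andP[/eqP ij H]].
exists (i, (d, e)) => /=; split.
- rewrite in_cons mem_iota; lia.
- by rewrite IH sd se /=; move: H; rewrite (iotaDl 1 0) all_map.
- by rewrite -ij addKn.
Qed.

Lemma splits_uniq w : uniq (splits w).
Proof.
elim: w => // c w IH; rewrite splits_cons.
apply: allpairs_uniq => //; first exact: iota_uniq.
by move=> [i [d e]] [j [d' e']] _ _ /= [-> -> _ ->].
Qed.

Section CoM.
Variable R : comNzRingType.
Implicit Types f g : fps R.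

Lemma coM f g w : co (f * g) w = \sum_(p <- splits w) co f p.1 * co g p.2.
Proof.
rewrite {1}/co /= /cauchy_coef /=.
set S := [seq (wmono p.1, wmono p.2) | p <- splits w].
have uS : uniq S.
  rewrite map_inj_in_uniq ?splits_uniq // => -[d e] [d' e'].
  rewrite !mem_splits /= => /and3P[/eqP sd /eqP se _] /and3P[/eqP sd' /eqP se' _] [dd ee].
  by rewrite (wmono_inj sd sd' dd) (wmono_inj se se' ee).
rewrite (_ : mono_split (wmono w) = [set` S]).
  by rewrite -fsbig_seq //= /S big_map; apply: eq_bigr => -[d e].
apply/seteqP; split=> -[a b] /=.
  rewrite /mono_split /= => ab.
  have abE i : (a i + b i = nth 0 w i)%N by rewrite -wmonoE -ab cmM.
  have fa : {in finsupp a, forall i, (i < size w)%N}.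
    move=> i; rewrite -cmE_neq0; have := abE i.
    by case: ltnP => // iw; rewrite [nth _ w i]nth_default //; lia.
  have fb : {in finsupp b, forall i, (i < size w)%N}.
    move=> i; rewrite -cmE_neq0; have := abE i.
    by case: ltnP => // iw; rewrite [nth _ w i]nth_default //; lia.
  apply/mapP; exists (mono_word (size w) a, mono_word (size w) b); last first.
    by rewrite /= !mono_wordK.
  rewrite mem_splits !size_map !size_iota !eqxx /=; apply/allP => i.
  rewrite mem_iota => iw; rewrite !(nth_map 0%N) ?size_iota //; try by case/andP: iw.
  by rewrite nth_iota ?add0n ?abE //; case/andP: iw.
case/mapP => -[d e]; rewrite mem_splits => /and3P[/eqP sd /eqP se /allP H] /= [-> ->].
rewrite /mono_split /=; apply/eqP/cmP => i; rewrite cmM !wmonoE.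
case: (ltnP i (size w)) => iw; first by apply/eqP/H; rewrite mem_iota.
by rewrite !nth_default ?sd ?se.
Qed.

End CoM.

Lemma big_splits_cons (A : nmodType) c w (F : seq nat -> seq nat -> A) :
  \sum_(p <- splits (c :: w)) F p.1 p.2 =
  \sum_(i < c.+1) \sum_(p <- splits w) F ((i : nat) :: p.1) ((c - i)%N :: p.2).
Proof.
rewrite splits_cons big_allpairs_dep.
by rewrite -[iota _ _]/(index_iota 0 c.+1) big_mkord.
Qed.

Lemma big_splits_cat (A : nmodType) u v (F : seq nat -> seq nat -> A) :
  \sum_(p <- splits (u ++ v)) F p.1 p.2 =
  \sum_(p <- splits u) \sum_(r <- splits v) F (p.1 ++ r.1) (p.2 ++ r.2).
Proof.
elim: u F => [|c u IH] F; first by rewrite big_seq1.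
rewrite cat_cons big_splits_cons.
rewrite (big_splits_cons _ _ (fun a b => \sum_(r <- splits v) F (a ++ r.1) (b ++ r.2))).
by apply: eq_bigr => i _; rewrite (IH (fun a b => F ((i : nat) :: a) ((c - i)%N :: b))).
Qed.

Lemma splits_sumn w d e : (d, e) \in splits w -> sumn w = (sumn d + sumn e)%N.
Proof.
elim: w d e => [|c w IH] d e; first by rewrite inE => /eqP[-> ->].
rewrite splits_cons => /allpairsP[[i [d' e']]] /= [ic de [-> ->]] /=; rewrite (IH _ _ de).
by move: ic; rewrite in_cons mem_iota; lia.
Qed.

Definition nz (w : seq nat) : nat := count (fun c => c != 0)%N w.
Definition strip (w : seq nat) : seq nat := [seq c <- w | c != 0]%N.

Lemma size_strip w : size (strip w) = nz w. Proof. exact: size_filter. Qed.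

Lemma splits_nz w d e : (d, e) \in splits w -> (nz w <= nz d + nz e)%N.
Proof.
elim: w d e => [|c w IH] d e //.
rewrite splits_cons => /allpairsP[[i [d' e']]] /= [ic de [-> ->]] /=; have := IH _ _ de.
by rewrite /nz /=; move: ic; rewrite in_cons mem_iota; lia.
Qed.

(** * The invariants characterizing PQSym *)

Section Conv.
Variable A : nmodType.

Lemma big_triangleA n (h : nat -> nat -> nat -> A) :
  \sum_(s < n.+1) \sum_(i < s.+1) h i (s - i)%N (n - s)%N =
  \sum_(i < n.+1) \sum_(j < (n - i).+1) h i j (n - i - j)%N.
Proof.
transitivity (\sum_(0 <= s < n.+1) \sum_(0 <= i < n.+1 | (i <= s)%N) h i (s - i)%N (n - s)%N).
  rewrite big_mkord; apply: eq_bigr => s _.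
  rewrite -(big_mkord xpredT (fun i => h i (s - i)%N (n - s)%N)).
  rewrite (@big_nat_widen _ _ _ 0 s.+1 n.+1) //=.
rewrite (exchange_big_dep_nat xpredT) //= big_mkord; apply: eq_bigr => i _.
rewrite -(big_mkord xpredT (fun j => h i j (n - i - j)%N)).
transitivity (\sum_(i <= s < n.+1) h i (s - i)%N (n - s)%N).
  rewrite [RHS](@big_nat_widenl _ _ _ i 0) //=.
by rewrite -{1}[i : nat]add0n big_addn subSn 1?leq_ord //; apply: eq_bigr => j _; rewrite addnK subnDA subnAC.
Qed.

Lemma big_triangleC n (h : nat -> nat -> nat -> A) :
  \sum_(i < n.+1) \sum_(j < (n - i).+1) h i j (n - i - j)%N =
  \sum_(j < n.+1) \sum_(i < (n - j).+1) h i j (n - j - i)%N.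
Proof.
rewrite -big_triangleA -(big_triangleA n (fun j i c => h i j c)); apply: eq_bigr => s _.
rewrite (reindex_inj rev_ord_inj) /=; apply: eq_bigr => i _.
by rewrite !subSS subKn ?leq_ord // -ltnS.
Qed.

(** Both sides run over the quadruples with sum [k]: the left groups the first two arguments of [F],
    the right the first and the third. For a product of two series this is the passage from grouping
    by variable to grouping by factor. *)
Lemma big_splits_pair (F : nat -> nat -> nat -> nat -> A) k :
  \sum_(p < k.+1) \sum_(i < p.+1) \sum_(j < (k - p).+1) F i (p - i)%N j (k - p - j)%N =
  \sum_(s < k.+1) \sum_(i < s.+1) \sum_(j < (k - s).+1) F i j (s - i)%N (k - s - j)%N.
Proof.
rewrite (big_triangleA k (fun i i' q => \sum_(j < q.+1) F i i' j (q - j)%N)).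
rewrite (big_triangleA k (fun i i' q => \sum_(j < q.+1) F i j i' (q - j)%N)).
apply: eq_bigr => i _.
exact: (big_triangleC (k - i) (fun a b c => F i a b c)).
Qed.
End Conv.

Section PQdef.
Implicit Types f g : QX.

Definition qsym_inv f := forall u v, co f (u ++ 0%N :: v) = co f (u ++ v).
(** The coefficient of t^k after two adjacent variables have been set to t and -t. Hence
    [cancelling] says that t disappears under this substitution, and [czetaM] that the substitution
    is multiplicative. *)
Definition czeta f u v k : rat :=
  \sum_(p < k.+1) (-1) ^+ (k - p) * co f (u ++ (p : nat) :: (k - p)%N :: v).
Definition cancelling f := forall u v k, (0 < k)%N -> czeta f u v k = 0.
Definition wbound N f := forall w, (N < sumn w)%N -> co f w = 0.
Definition pow2div f := forall w, exists z : int, co f w = z%:~R * 2 ^+ nz w.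

Lemma coM_cat2 f g u v p q : co (f * g) (u ++ p :: q :: v) =
  \sum_(a <- splits u) \sum_(b <- splits v) \sum_(i < p.+1) \sum_(j < q.+1)
    co f (a.1 ++ (i : nat) :: (j : nat) :: b.1) *
    co g (a.2 ++ (p - i)%N :: (q - j)%N :: b.2).
Proof.
rewrite coM (big_splits_cat _ _ (fun a b => co f a * co g b)).
apply: eq_bigr => a _.
rewrite (big_splits_cons _ _ (fun x y => co f (a.1 ++ x) * co g (a.2 ++ y))).
rewrite [RHS]exchange_big; apply: eq_bigr => i _.
rewrite (big_splits_cons _ _
  (fun x y => co f (a.1 ++ (i : nat) :: x) * co g (a.2 ++ (p - i)%N :: y))).
by rewrite exchange_big.
Qed.

Lemma czetaM f g u v k : czeta (f * g) u v k =
  \sum_(a <- splits u) \sum_(b <- splits v)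
    \sum_(i < k.+1) czeta f a.1 b.1 i * czeta g a.2 b.2 (k - i).
Proof.
rewrite /czeta.
under eq_bigr => p _ do rewrite coM_cat2 big_distrr /=.
rewrite exchange_big /=; apply: eq_bigr => a _.
under eq_bigr => p _ do rewrite big_distrr /=.
rewrite exchange_big /=; apply: eq_bigr => b _.
pose F i i' j j' : rat := (-1) ^+ (j + j') *
  (co f (a.1 ++ i :: j :: b.1) * co g (a.2 ++ i' :: j' :: b.2)).
transitivity (\sum_(p < k.+1) \sum_(i < p.+1) \sum_(j < (k - p).+1) F i (p - i)%N j (k - p - j)%N).
  apply: eq_bigr => p _; rewrite big_distrr /=; apply: eq_bigr => i _.
  rewrite big_distrr /=; apply: eq_bigr => j _.
  by rewrite /F subnKC // -ltnS.
rewrite big_splits_pair; apply: eq_bigr => s _.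
rewrite big_distrl /=; apply: eq_bigr => i _; rewrite big_distrr /=.
by apply: eq_bigr => j _; rewrite /F exprD mulrACA.
Qed.

Lemma czetaD f g u v k : czeta (f + g) u v k = czeta f u v k + czeta g u v k.
Proof. by rewrite -big_split; apply: eq_bigr => p _; rewrite coD mulrDr. Qed.

Lemma czetaZ c f u v k : czeta (c *: f) u v k = c * czeta f u v k.
Proof. by rewrite big_distrr; apply: eq_bigr => p _; rewrite coZ mulrCA. Qed.

Lemma cancelling1 : cancelling 1.
Proof.
move=> u v k k0; rewrite /czeta big1 // => p _; rewrite co1 all_cat /=.
have -> : (all (pred1 0%N) u && [&& p == 0 :> nat, k - p == 0 & all (pred1 0) v])%N = false.
  lia.
by rewrite mulr0.
Qed.

Lemma cancellingM f g : cancelling f -> cancelling g -> cancelling (f * g).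
Proof.
move=> cf cg u v k k0; rewrite czetaM big1 // => a _; rewrite big1 // => b _.
rewrite big1 // => i _; case: (posnP i) => [->|i0]; last by rewrite cf // mul0r.
by rewrite cg ?mulr0 // subn0.
Qed.

Lemma qsym_invM f g : qsym_inv f -> qsym_inv g -> qsym_inv (f * g).
Proof.
move=> qf qg u v; rewrite !coM.
rewrite !(big_splits_cat _ _ (fun a b => co f a * co g b)); apply: eq_bigr => a _.
rewrite (big_splits_cons _ _ (fun x y => co f (a.1 ++ x) * co g (a.2 ++ y))).
by rewrite big_ord_recl big_ord0 addr0; apply: eq_bigr => b _; rewrite qf qg.
Qed.

Lemma wboundM N N' f g : wbound N f -> wbound N' g -> wbound (N + N') (f * g).
Proof.
move=> bf bg w wN; rewrite coM big_seq big1 // => -[d e] /splits_sumn /= sw.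
case: (ltnP N (sumn d)) => dN; first by rewrite bf // mul0r.
by rewrite bg ?mulr0 //; lia.
Qed.

Lemma pow2divM f g : pow2div f -> pow2div g -> pow2div (f * g).
Proof.
move=> pf pg w; rewrite coM big_seq.
apply: (big_ind (fun x : rat => exists z : int, x = z%:~R * 2 ^+ nz w)).
- by exists 0; rewrite mul0r.
- by move=> x y [a ->] [b ->]; exists (a + b); rewrite -mulrDl intrD.
move=> [d e] /splits_nz /= le; have [a ->] := pf d; have [b ->] := pg e.
exists (a * b * 2 ^+ (nz d + nz e - nz w)).
have e2 : 2 ^+ (nz d + nz e - nz w) * 2 ^+ nz w = 2 ^+ nz d * 2 ^+ nz e :> rat.
  by rewrite -!exprD subnK.
by rewrite !intrM rmorphXn -[in RHS]mulrA [_%:~R ^+ _ * _]e2 mulrACA.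
Qed.

Definition pqsymQ : {pred QX} := fun f =>
  `[< [/\ qsym_inv f, cancelling f & exists N, wbound N f] >].
Definition pqsymZ : {pred QX} := fun f => (f \in pqsymQ) && `[< pow2div f >].

Lemma pqsymQP f :
  reflect [/\ qsym_inv f, cancelling f & exists N, wbound N f] (f \in pqsymQ).
Proof. exact: asboolP. Qed.

Lemma pqsymZP f : reflect (f \in pqsymQ /\ pow2div f) (f \in pqsymZ).
Proof. by apply: (iffP andP) => -[? /asboolP]; split=> //; apply/asboolP. Qed.

Lemma pqsymQ_subalg : subalg_closed pqsymQ.
Proof.
split.
- apply/pqsymQP; split; [|exact: cancelling1|exists 0%N].
    by move=> u v; rewrite !co1 !all_cat.
  move=> w w0; rewrite co1; suff -> : all (pred1 0%N) w = false by [].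
  by elim: w w0 => //= c w IH cw; case: c cw => [|c] //; rewrite add0n => /IH.
- move=> c f g /pqsymQP[qf cf [N bf]] /pqsymQP[qg cg [N' bg]]; apply/pqsymQP; split.
  + by move=> u v; rewrite !coD !coZ qf qg.
  + by move=> u v k k0; rewrite czetaD czetaZ cf // cg // mulr0 addr0.
  + exists (maxn N N') => w wN; rewrite coD coZ bf ?bg ?mulr0 ?addr0 //; lia.
- move=> f g /pqsymQP[qf cf [N bf]] /pqsymQP[qg cg [N' bg]]; apply/pqsymQP; split.
  + exact: qsym_invM.
  + exact: cancellingM.
  + by exists (N + N')%N; apply: wboundM.
Qed.

HB.instance Definition _ := GRing.isSubalgClosed.Build rat QX pqsymQ pqsymQ_subalg.

Lemma pow2div_sub f g : pow2div f -> pow2div g -> pow2div (f - g).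
Proof.
move=> pf pg w; rewrite coB; have [a ->] := pf w; have [b ->] := pg w.
by exists (a - b); rewrite intrB mulrBl.
Qed.

Lemma pow2div1 : pow2div 1.
Proof.
move=> w; rewrite co1; case w0: (all _ _); last by exists 0; rewrite mul0r.
exists 1; rewrite mul1r (_ : nz w = 0%N) //.
by elim: w w0 => //= c w IH /andP[/eqP -> /IH].
Qed.

Lemma pqsymZ_subring : subring_closed pqsymZ.
Proof.
split.
- by apply/pqsymZP; split; [exact: rpred1|exact: pow2div1].
- move=> f g /pqsymZP[qf pf] /pqsymZP[qg pg]; apply/pqsymZP; split.
    exact: rpredB.
  exact: pow2div_sub.
- move=> f g /pqsymZP[qf pf] /pqsymZP[qg pg]; apply/pqsymZP; split.
    exact: rpredM.
  exact: pow2divM.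
Qed.

HB.instance Definition _ := GRing.isSubringClosed.Build QX pqsymZ pqsymZ_subring.

Lemma pqsymZ_Q f : f \in pqsymZ -> f \in pqsymQ. Proof. by case/andP. Qed.

Lemma co_strip f w : f \in pqsymQ -> co f (strip w) = co f w.
Proof.
case/pqsymQP => qf _ _; rewrite -[strip w]cat0s -[w in RHS]cat0s.
elim: w [::] => //= c w IH u; case: eqP => [->|_]; first by rewrite qf.
by rewrite -!cat_rcons.
Qed.

(* The cancellation relation expresses a coefficient at a word with an even
   part through coefficients at longer words of the same weight. *)
Lemma pqsymQ_eq0 f : f \in pqsymQ ->
  (forall w, all odd w -> co f w = 0) -> f = 0.
Proof.
move=> fQ f0; case/pqsymQP: (fQ) => qf cf _.
apply: co_ext => w; rewrite co0 -co_strip //.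
have: all (leq 1) (strip w) by apply/allP => c; rewrite mem_filter lt0n => /andP[].
have [n] := ubnP (sumn (strip w) - size (strip w)).
elim: n (strip w) => // n IH {}w lt_n w1.
case: (boolP (all odd w)) => [/f0 //|/allPn[k kw kodd]].
case/splitPr: kw lt_n w1 => a b; rewrite all_cat /= sumn_cat size_cat /=.
move=> lt_n /and3P[a1 k1 b1].
have size_le (s : seq nat) : all (leq 1) s -> (size s <= sumn s)%N.
  by elim: s => //= c s IHs /andP[c1 /IHs]; lia.
have [la lb] := (size_le _ a1, size_le _ b1).
have := cf a b k k1; rewrite /czeta.
case: k k1 kodd lt_n => // k _ kodd lt_n.
(* The inner terms belong to words of the same weight with one more letter. The two extreme terms
   are the coefficient at the given word, both with sign [+1] as the letter is even, so that twice
   this coefficient is 0. *)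
rewrite big_ord_recl big_ord_recr /= big1 => [|i _]; last first.
  rewrite IH ?mulr0 //; rewrite ?all_cat /= ?sumn_cat ?size_cat /= /bump /= ?a1 ?b1 /=.
    by have := ltn_ord i; lia.
  by have := ltn_ord i; lia.
rewrite subn0 /bump /= add1n subnn expr0 mul1r add0r qf.
rewrite -[a ++ _ :: 0%N :: b]cat_rcons qf cat_rcons.
have -> : (-1) ^+ k.+1 = 1 :> rat by rewrite -signr_odd (negbTE kodd).
by rewrite mul1r => /eqP; rewrite -mulr2n mulrn_eq0 => /eqP.
Qed.

End PQdef.

(** * Orders on words and triangular families *)

Definition lle (u v : seq nat) : bool := ((u : seqlexi nat) <= (v : seqlexi nat))%O.
Definition llt (u v : seq nat) : bool := ((u : seqlexi nat) < (v : seqlexi nat))%O.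

Lemma lle_nil v : lle [::] v. Proof. by []. Qed.
Lemma lle_cons a u b v : lle (a :: u) (b :: v) = (a < b)%N || (a == b) && lle u v.
Proof. rewrite /lle lexi_cons /Order.le /=; case: ltngtP => //=. Qed.
Lemma lle_refl u : lle u u. Proof. exact: le_refl. Qed.
Lemma lle_trans v u w : lle u v -> lle v w -> lle u w. Proof. exact: le_trans. Qed.
Lemma lle_total u v : lle u v || lle v u. Proof. exact: le_total. Qed.
Lemma lle_anti u v : lle u v -> lle v u -> u = v.
Proof. by move=> uv vu; apply: (@le_anti _ (seqlexi nat)); apply/andP. Qed.
Lemma llt_def u v : llt u v = (u != v) && lle u v.
Proof. by rewrite /llt lt_def eq_sym. Qed.
Lemma lltNle u v : llt u v = ~~ lle v u. Proof. exact: ltNge. Qed.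
Lemma llt_cons a u b v : llt (a :: u) (b :: v) = (a < b)%N || (a == b) && llt u v.
Proof. by rewrite !lltNle lle_cons; case: ltngtP. Qed.

(** Length comes first because coarser words have fewer letters and lengths add up in products; the
    lexicographic order only separates words of equal length. *)
Definition rle (u v : seq nat) : bool :=
  (size u < size v)%N || (size u == size v) && lle u v.
Lemma rle_total : total rle.
Proof. by move=> u v; rewrite /rle; case: ltngtP => //= _; apply: lle_total. Qed.
Lemma rle_trans : transitive rle.
Proof.
move=> v u w; rewrite /rle.
case: (ltngtP (size u) (size v)) => //= uv; case: (ltngtP (size v) (size w)) => //= vw.
- by rewrite (ltn_trans uv vw).
- by rewrite -vw uv.
- by rewrite uv vw.
- by rewrite uv vw ltnn eqxx /=; apply: lle_trans.
Qed.
Lemma rle_anti u v : rle u v -> rle v u -> u = v.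
Proof. by rewrite /rle; case: ltngtP => //= _; apply: lle_anti. Qed.

Fixpoint words (n m : nat) : seq (seq nat) :=
  if n is n'.+1 then [seq c :: w | c <- iota 0 m.+1, w <- words n' m] else [:: [::]].

Lemma mem_words n m w : (w \in words n m) = (size w == n) && all (fun c => c <= m)%N w.
Proof.
elim: n w => [|n IH] w; first by rewrite inE; case: w.
rewrite -[words _ _]/([seq c :: w | c <- iota 0 m.+1, w <- words n m]).
apply/allpairsP/idP => [[[c v]] /= [cm]|].
  rewrite IH => /andP[sv av] -> /=; rewrite eqSS sv av andbT.
  by move: cm; rewrite in_cons mem_iota; lia.
case: w => [//|c w] /= /andP[sw /andP[cm aw]]; exists (c, w); split=> //.
  by rewrite /= ?in_cons mem_iota; lia.
by rewrite IH -eqSS sw aw.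
Qed.

Lemma words_uniq n m : uniq (words n m).
Proof.
elim: n => // n IH; rewrite -[words _ _]/([seq c :: w | c <- iota 0 m.+1, w <- words n m]).
apply: allpairs_uniq => //; first exact: iota_uniq.
by move=> [i d] [j d'] _ _ /= [-> ->].
Qed.

Definition odd_words (N : nat) : seq (seq nat) :=
  [seq w <- flatten [seq words n N | n <- iota 0 N.+1] | all odd w && (sumn w <= N)%N].

Lemma all_odd_size w : all odd w -> (size w <= sumn w)%N.
Proof. by elim: w => //= c w IH /andP[c1 /IH]; case: c c1 => //; lia. Qed.

Lemma mem_odd_words N w : (w \in odd_words N) = all odd w && (sumn w <= N)%N.
Proof.
rewrite mem_filter; case: (boolP (all odd w && _)%N) => // /andP[ow sw].
rewrite andTb; apply/flattenP; exists (words (size w) N).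
  apply: (map_f (fun n => words n N)); rewrite mem_iota /= add0n ltnS; exact: leq_trans (all_odd_size ow) sw.
rewrite mem_words eqxx /=; apply/allP => c cw; apply: leq_trans sw.
by rewrite sumnE (big_rem c) //= leq_addr.
Qed.

Section Spanning.
Variable g : seq nat -> QX.
Hypothesis gZ : forall w, all odd w -> g w \in pqsymZ.
Hypothesis gb : forall w, all odd w -> wbound (sumn w) (g w).
Hypothesis gw : forall w, all odd w -> co (g w) w = 2 ^+ size w.
Hypothesis gle : forall w v, all odd w -> all odd v -> co (g w) v != 0 -> rle v w.

Lemma all_odd_nz w : all odd w -> nz w = size w.
Proof. by rewrite /nz; elim: w => //= c w IH /andP[oc /IH ->]; case: c oc. Qed.

(** Induction along [rle]: at the largest odd word [w0] that is left, the coefficient of [f] is a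
    multiple of 2^(size w0), the leading coefficient of [g w0], so an integral multiple of [g w0]
    removes it. The bound on the weight keeps the list of words finite. The family [g] will be both
    [L] and [qword]. *)
Lemma pqsymZ_span f : f \in pqsymZ -> exists s : seq (int * seq nat),
  (forall p, p \in s -> all odd p.2) /\ f = \sum_(p <- s) g p.2 *~ p.1.
Proof.
move=> fZ; case/pqsymZP: (fZ) => /pqsymQP[_ _ [N fN]] _.
pose S := sort rle (odd_words N).
have memS w : (w \in S) = all odd w && (sumn w <= N)%N by rewrite mem_sort mem_odd_words.
suff H k : forall f, f \in pqsymZ -> wbound N f ->
    (forall w, all odd w -> co f w != 0 -> w \in take k S) ->
    exists s : seq (int * seq nat),
    (forall p, p \in s -> all odd p.2) /\ f = \sum_(p <- s) g p.2 *~ p.1.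
  apply: (H (size S)) => // w ow fw0; rewrite take_size memS ow /= leqNgt.
  by apply/negP => /fN; apply/eqP.
elim: k => [|k IH] {fN fZ f} f fZ fN fS.
  exists [::]; split => //; rewrite big_nil; apply: pqsymQ_eq0 (pqsymZ_Q fZ) _ => w ow.
  by apply/eqP/negPn/negP => /(fS w ow); rewrite take0.
case: (ltnP k (size S)) => kS; last first.
  by apply: IH => // w ow /(fS w ow); rewrite !take_oversize // ltnW.
pose w0 := nth [::] S k.
have w0S : w0 \in S by rewrite mem_nth.
have /andP[ow0 sw0] : all odd w0 && (sumn w0 <= N)%N by rewrite -memS.
have [_ /(_ w0)[z fw0]] := pqsymZP _ fZ.
have sS : sorted rle S by apply: sort_sorted; apply: rle_total.
have [] := IH (f - g w0 *~ z).
- by rewrite rpredB // rpredMz // gZ.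
- move=> w wN; rewrite coB coMz fN // (gb ow0) ?mul0rz ?subr0 //; lia.
- move=> w ow; rewrite coB coMz => w_neq0.
  have wS : w \in S.
    rewrite memS ow leqNgt /=; apply/negP => wN; move/eqP: w_neq0; apply.
    by rewrite fN // (gb ow0) ?mul0rz ?subr0 //; lia.
  have ww0 : w != w0.
    apply: contraNneq w_neq0 => ->.
    by rewrite fw0 gw // all_odd_nz // mulrzl subrr.
  have : index w S != k by apply: contraNneq ww0 => e; rewrite /w0 -e nth_index.
  case: (ltngtP (index w S) k) => // iwk _.
    by rewrite -[w](nth_index [::] wS) -(nth_take _ iwk) mem_nth // size_take kS.
  suff : rle w w0.
    move=> le1; case/eqP: ww0; apply: rle_anti le1 _.
    rewrite -[w in X in is_true X](nth_index [::] wS); apply: (sorted_leq_nth rle_trans _ [::] sS); rewrite ?inE ?index_mem //.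
      by move=> u; rewrite /rle eqxx lle_refl orbT.
    exact: ltnW.
  case: (eqVneq (co (g w0) w) 0) => [gw0|]; last exact: gle.
  move: w_neq0; rewrite gw0 mul0rz subr0 => /(fS w ow).
  move=> /(nthP [::])[i]; rewrite size_take_min leq_min ltnS => /andP[ik _].
  rewrite nth_take // => wi.
  have : (index w S <= i)%N.
    by rewrite -wi leqNgt; apply/negP => /(before_find [::]) /=; rewrite eqxx.
  by rewrite leqNgt (leq_ltn_trans ik iwk).
move=> s [so fs]; exists ((z, w0) :: s); split.
  by move=> p; rewrite inE => /orP[/eqP -> //|/so].
by rewrite big_cons -fs /= addrC subrK.
Qed.

(** At the [rle]-largest word with a nonzero coefficient only its own member of the family
    contributes. *)
Lemma span_indep (s : seq (seq nat)) (c : seq nat -> rat) : uniq s -> all (all odd) s ->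
  \sum_(w <- s) c w *: g w = 0 -> forall w, w \in s -> c w = 0.
Proof.
move=> us so s0 w ws; apply/eqP/negPn/negP => cw.
pose t := sort rle [seq v <- s | c v != 0].
have wt : w \in t by rewrite mem_sort mem_filter cw.
have st : sorted rle t by apply: sort_sorted; apply: rle_total.
pose m := last [::] t.
have mt : m \in t by rewrite /m; case: (t) wt => //= a t' _; exact: mem_last.
have mmax v : v \in t -> rle v m.
  move=> vt; rewrite /m (last_nth [::]).
  case: (t) st vt => // a t' st vt /=.
  rewrite -[v](nth_index [::] vt).
  apply: (sorted_leq_nth rle_trans _ [::] st); rewrite ?inE ?index_mem //.
    by move=> u; rewrite /rle eqxx lle_refl orbT.
  by rewrite -ltnS index_mem.
have := congr1 (fun f => co f m) s0; rewrite co0 co_sum.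
move: mt; rewrite mem_sort mem_filter => /andP[cm ms].
have mo : all odd m by move/allP: so; apply.
rewrite (bigD1_seq m) //= coZ gw // big_seq_cond big1 ?addr0 => [/eqP|v /andP[vs vm]].
  by rewrite mulf_eq0 (negbTE cm) expf_eq0 /= andbF.
rewrite coZ; apply/eqP; rewrite mulf_eq0; apply/orP.
case: (eqVneq (c v) 0) => [|cv]; [by left|right].
have vo : all odd v by move/allP: so; apply.
apply/negPn/negP => /(gle vo mo) mv; case/eqP: vm; apply: rle_anti mv => //.
by apply: mmax; rewrite mem_sort mem_filter cv.
Qed.

End Spanning.

(** * Coefficients of M, F, K and L *)

Fixpoint psums (w : seq nat) : seq nat :=
  if w is c :: w' then 0%N :: map (addn c) (psums w') else [:: 0%N].

Lemma psumsE w : psums w = [seq sumn (take i w) | i <- iota 0 (size w).+1].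
Proof.
elim: w => // c w IH; rewrite [psums _]/= IH.
rewrite -[iota 0 (size (c :: w)).+1]/(0%N :: iota (1 + 0) (size w).+1) iotaDl map_cons.
by rewrite -!map_comp; congr (_ :: _); apply: eq_map.
Qed.

Lemma psums0 w : 0%N \in psums w. Proof. by case: w. Qed.

Lemma psums_le w k : k \in psums w -> (k <= sumn w)%N.
Proof.
elim: w k => [|c w IH] k /=; first by rewrite inE => /eqP->.
by rewrite inE => /orP[/eqP->//|/mapP[j /IH jw ->]]; rewrite leq_add2l.
Qed.

Lemma psums_sumn w : sumn w \in psums w.
Proof. by elim: w => //= c w IH; rewrite inE map_f ?orbT. Qed.

(** Bit [j] records whether [j + 1] is a partial sum of [w]. Zero letters leave no trace, so these
    bits determine exactly [strip w]. *)
Fixpoint pbits (w : seq nat) : seq bool :=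
  if w is c :: w' then (if c is c'.+1 then rcons (nseq c' false) true else [::]) ++ pbits w'
  else [::].

Lemma size_pbits w : size (pbits w) = sumn w.
Proof. by elim: w => //= c w IH; rewrite size_cat IH; case: c => // c; rewrite size_rcons size_nseq. Qed.

Lemma nth_pbits w j : nth false (pbits w) j = (j.+1 \in psums w).
Proof.
elim: w j => [|c w IH] j /=; first by rewrite nth_nil.
rewrite inE /= nth_cat.
case: c => [|c] /=; first by rewrite subn0 IH (eq_map add0n) map_id.
rewrite size_rcons size_nseq; case: ltnP => jc.
  rewrite nth_rcons size_nseq nth_nseq if_same.
  move: jc; rewrite ltnS leq_eqVlt => /orP[/eqP->|jc].
    by rewrite ltnn eqxx; apply/esym/mapP; exists 0%N; rewrite ?psums0 ?addn0.
  by rewrite jc; apply/esym/negbTE/negP => /mapP[i _]; lia.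
rewrite IH; apply/idP/mapP => [jw|[i iw ji]].
  by exists (j - c.+1).+1 => //; lia.
by rewrite (_ : (j - c.+1).+1 = i) //; lia.
Qed.

Lemma pbits_strip w : pbits (strip w) = pbits w.
Proof. by elim: w => //= c w IH; case: c => //= c; rewrite IH. Qed.

Lemma count_pbits w : count id (pbits w) = nz w.
Proof.
rewrite /nz; elim: w => //= c w IH; rewrite count_cat IH; case: c => // c.
by rewrite -cats1 count_cat count_nseq /= mul0n.
Qed.

Lemma pbits_inj a b : is_comp a -> is_comp b -> pbits a = pbits b -> a = b.
Proof.
elim: a b => [|c a IH] [|d b] //=.
- by case: d => //= d _ _ /(congr1 size) /=; rewrite size_cat size_rcons.
- by case: c => //= c _ _ /(congr1 size) /=; rewrite size_cat size_rcons.
case: c => // c; case: d => // d /= ca db; rewrite !cat_rcons => e.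
have cd : c = d.
  have := congr1 (index true) e; rewrite !index_cat !mem_nseq /= !andbF !size_nseq.
  by lia.
move: e; rewrite cd => /eqP; rewrite eqseq_cat // eqxx /= eqseq_cons eqxx /= => /eqP /IH -> //.
Qed.

Lemma strip_comp a : is_comp a -> strip a = a.
Proof. by move=> ca; apply/all_filterP; apply: sub_all ca => c; case: c. Qed.

Lemma strip_is_comp w : is_comp (strip w).
Proof. by apply/allP => c; rewrite mem_filter -lt0n => /andP[]. Qed.

Lemma mem_descents a k : is_comp a ->
  (k \in descents a) = (0 < k < sumn a)%N && (k \in psums a).
Proof.
move=> ca; rewrite /descents.
apply/imfsetP/idP => /= [[i]|/andP[/andP[k0 ka]]].
  rewrite mem_iota add0n => ia ->.
  have ia' : (i.+1 < size a)%N by case: (size a) ia.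
  have pos (s : seq nat) : is_comp s -> (0 < size s)%N -> (0 < sumn s)%N.
    by case: s => //= c s /andP[c0 _] _; rewrite addn_gt0 c0.
  move: ca; rewrite -{1}(cat_take_drop i.+1 a) /is_comp all_cat => /andP[ct cd].
  rewrite (pos _ ct) ?size_take ?ia' //=.
  rewrite -{2}(cat_take_drop i.+1 a) sumn_cat -{1}[sumn _]addn0 ltn_add2l pos ?size_drop ?subn_gt0 //=.
  rewrite psumsE; apply: (map_f (fun i => sumn (take i a))).
  by rewrite mem_iota; lia.
rewrite psumsE => /mapP[i]; rewrite mem_iota => ia kE.
case: i ia kE => [|i] ia kE; first by rewrite kE take0 in k0.
exists i => //=; rewrite mem_iota /= add0n.
have : (i.+1 != size a) by apply: contraTneq ka => ie; rewrite kE ie take_size ltnn.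
by move: ia; lia.
Qed.

Section Monomials.

Lemma cm_big (I : choiceType) (T : Type) (r : seq T) (G : T -> {cmonom I}) j :
  (\big[mmul/mone]_(i <- r) G i) j = (\sum_(i <- r) G i j)%N.
Proof.
elim: r => [|i r IH]; first by rewrite !big_nil cm1.
by rewrite !big_cons cmM IH.
Qed.

Lemma expcmnE (I : choiceType) (m : {cmonom I}) n j : expcmn m n j = (n * m j)%N.
Proof.
rewrite /expcmn; case: n => [|n]; first by rewrite onecmE.
rewrite iteropS; elim: n => [|n IH] /=; first by rewrite mul1n.
by rewrite mulcmE IH mulSn.
Qed.

(** For [M] and [F] a monomial comes from at most one index word [t0], and the sum over the fibre
    reduces to an indicator. *)
Lemma monomial_sum1 (T : choiceType) (S : set T) (e : T -> mono) w t0 (b : bool) :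
  (forall t, (S t /\ e t = wmono w) <-> (t = t0 /\ b)) ->
  co (monomial_sum S e) w = b%:R.
Proof.
move=> H; rewrite /co /=.
have -> : S `&` e @^-1` [set wmono w] = if b then [set t0] else set0.
  apply/seteqP; split=> t /=.
    by move=> [St et]; have /H [-> ->] : S t /\ e t = wmono w by [].
  by case: b H => H //= ->; have [] := (H t0).2 (conj erefl isT).
by case: b {H}; rewrite ?fsbig_set1 ?fsbig_set0.
Qed.

Lemma sum_zip (s a : seq nat) j : uniq s -> size s = size a ->
  (\sum_(p <- zip s a) p.2 * (p.1 == j) = nth 0 a (index j s))%N.
Proof.
elim: s a => [|x s IH] [|c a] //=; first by rewrite big_nil.
move=> /andP[xs us] [sa]; rewrite big_cons /= IH //.
case: (eqVneq x j) xs => [<- xs|_ _]; last by rewrite muln0.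
by rewrite muln1 nth_default ?addn0 // -sa leqNgt index_mem.
Qed.

Definition pos (w : seq nat) : seq nat := [seq i <- iota 0 (size w) | nth 0%N w i != 0%N].

Lemma strip_pos w : strip w = [seq nth 0%N w i | i <- pos w].
Proof. by rewrite -[w in LHS](mkseq_nth 0%N) /strip /mkseq filter_map. Qed.

Lemma mem_pos w i : (i \in pos w) = (nth 0%N w i != 0%N).
Proof.
rewrite mem_filter mem_iota /=; case: (ltnP i (size w)) => iw; rewrite ?andbT //.
by rewrite nth_default.
Qed.

Lemma co_M a w : is_comp a -> co (M a) w = (strip w == a)%:R.
Proof.
move=> ca; apply: (monomial_sum1 (t0 := pos w)) => t /=.
have eE j (s : seq nat) : (\big[mmul/mone]_(p <- zip s a) expcmn (ucm p.1) p.2) j =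
    (\sum_(p <- zip s a) p.2 * (p.1 == j))%N.
  by rewrite cm_big; apply: eq_bigr => p _; rewrite expcmnE ucmE.
split=> [[[st srt] et]|[-> /eqP sa]].
  have ut : uniq t by apply: sorted_uniq srt => //; [exact: ltn_trans|exact: ltnn].
  have tw j : nth 0%N w j = nth 0%N a (index j t).
    by rewrite -wmonoE -et eE sum_zip.
  have tp : t = pos w.
    apply: (irr_sorted_eq ltn_trans ltnn) => //.
      exact: (sorted_filter ltn_trans _ (iota_ltn_sorted 0 (size w))).
    move=> j; rewrite mem_pos tw; case: (boolP (j \in t)) => jt.
      by apply/esym; rewrite -lt0n; move/allP: ca; apply; rewrite mem_nth // -st index_mem.
    by rewrite nth_default // -st leqNgt index_mem.
  split=> //; apply/eqP; rewrite strip_pos -tp.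
  apply: (@eq_from_nth _ 0%N); rewrite ?size_map // => i it.
  by rewrite (nth_map 0%N) // tw index_uniq.
have srt : sorted ltn (pos w) by exact: (sorted_filter ltn_trans _ (iota_ltn_sorted 0 (size w))).
have ut : uniq (pos w) by rewrite filter_uniq ?iota_uniq.
have sp : size (pos w) = size a by rewrite -sa strip_pos size_map.
split; first by split.
apply/eqP/cmP => j; rewrite eE sum_zip // wmonoE -sa strip_pos.
case: (boolP (j \in pos w)) => jp.
  by rewrite (nth_map 0%N) ?index_mem // nth_index.
rewrite [LHS]nth_default; last by rewrite size_map leqNgt index_mem.
by move: jp; rewrite mem_pos negbK => /eqP.
Qed.

(** The weakly increasing sequence of variable indices, with repetitions, of the monomial with
    exponents [w] in the variables from index [i] on. It is the unique index word of [F] over that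
    monomial. *)
Fixpoint runs (i : nat) (w : seq nat) : seq nat :=
  if w is c :: w' then nseq c i ++ runs i.+1 w' else [::].

Lemma size_runs i w : size (runs i w) = sumn w.
Proof. by elim: w i => //= c w IH i; rewrite size_cat size_nseq IH. Qed.

Lemma runs_ge i w : all (leq i) (runs i w).
Proof.
elim: w i => //= c w IH i; rewrite all_cat all_nseq leqnn orbT /=.
by apply: sub_all (IH i.+1) => j; apply: ltnW.
Qed.

Lemma runs_sorted i w : sorted leq (runs i w).
Proof.
elim: w i => //= c w IH i.
rewrite sorted_pairwise; last exact: leq_trans.
rewrite pairwise_cat -(sorted_pairwise _ (runs i.+1 w)) ?IH ?andbT; last exact: leq_trans.
apply/andP; split.
  apply/allrelP => x y /nseqP[-> _] yw.
  by apply: ltnW; move/allP: (runs_ge i.+1 w); apply.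
rewrite -sorted_pairwise; last exact: leq_trans.
by apply: (@path_sorted _ _ i); elim: c => //= c ->; rewrite leqnn.
Qed.

Lemma count_runs i w j : count_mem (i + j)%N (runs i w) = nth 0%N w j.
Proof.
elim: w i j => [|c w IH] i j; first by rewrite nth_nil.
rewrite /= count_cat count_nseq /=; case: j => [|j] /=.
  rewrite addn0 eqxx mul1n (_ : count _ _ = 0%N) ?addn0 //.
  apply/eqP; rewrite -leqn0 leqNgt -has_count; apply/hasPn => x xw.
  by have /allP/(_ _ xw) := runs_ge i.+1 w; rewrite /=; lia.
by rewrite addnS -addSn IH (_ : i == _ = false) ?mul0n //; lia.
Qed.

Lemma runs_strict i w k : (0 < k < sumn w)%N ->
  (nth 0 (runs i w) k.-1 < nth 0 (runs i w) k)%N = (k \in psums w).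
Proof.
elim: w i k => [|c w IH] i k; first by rewrite ltn0 andbF.
rewrite [sumn _]/= [runs _ _]/= [psums _]/= inE !nth_cat size_nseq => /andP[k0 kw].
rewrite gtn_eqF //=.
case: (ltngtP k c) => kc.
- rewrite (_ : (k.-1 < c)%N); last lia.
  rewrite !nth_nseq kc (_ : (k.-1 < c)%N) ?ltnn; last lia.
  by apply/esym/negbTE/negP => /mapP[j _]; lia.
- have -> : (k.-1 < c)%N = false by lia.
  rewrite (_ : (k.-1 - c)%N = (k - c).-1); last lia.
  rewrite IH; last lia.
  apply/idP/mapP => [kw'|[j jw ->]]; first by exists (k - c)%N => //; lia.
  by rewrite addKn.
- rewrite (_ : (k.-1 < c)%N) ?nth_nseq; last lia.
  rewrite (_ : (k.-1 < c)%N) ?kc ?subnn; last lia.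
  have -> : (i < nth 0 (runs i.+1 w) 0)%N.
    have /allP := runs_ge i.+1 w; apply; apply: mem_nth; rewrite size_runs; lia.
  by apply/esym/mapP; exists 0%N; rewrite ?psums0 ?addn0.
Qed.

Definition coarser (a w : seq nat) : bool :=
  (sumn w == sumn a) && all (fun k => k \in psums w) (psums a).

Lemma co_F a w : is_comp a -> co (F a) w = (coarser a w)%:R.
Proof.
move=> ca; apply: (monomial_sum1 (t0 := runs 0 w)) => t /=.
have eE j (s : seq nat) : (\big[mmul/mone]_(i <- s) ucm i : mono) j = count_mem j s.
  rewrite cm_big -sum1_count [RHS]big_mkcond /=; apply: eq_bigr => i _.
  by rewrite ucmE; case: (i == j).
have C s : sorted leq s -> (\big[mmul/mone]_(i <- s) ucm i = wmono w :> mono) -> s = runs 0 w.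
  move=> srt e; apply: (sorted_eq leq_trans anti_leq) => //; first exact: runs_sorted.
  apply/permP => p; rewrite -!sum1_count; apply: perm_big.
  apply/allP => j _ /=; rewrite -eE e wmonoE -[j in count_mem j _]add0n count_runs //.
have D : sumn w = sumn a ->
  (forall k, k \in descents a -> (nth 0 (runs 0 w) k.-1 < nth 0 (runs 0 w) k)%N) <->
  all (fun k => k \in psums w) (psums a).
  move=> wa; split=> [H|/allP H k].
    apply/allP => k ka; case: (posnP k) => [->|k0]; first exact: psums0.
    case: (ltnP k (sumn a)) => ks.
      by rewrite -(runs_strict 0) ?k0 ?wa // H // mem_descents // k0 ks.
    by rewrite (_ : k = sumn w) ?psums_sumn // wa; apply/eqP; rewrite eqn_leq psums_le.
  by rewrite mem_descents // => /andP[ks /H]; rewrite runs_strict ?wa.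
split=> [[[st srt ds] et]|[-> /andP[/eqP wa H]]].
  have tr := C t srt et; split=> //; rewrite tr size_runs in st.
  by rewrite /coarser st eqxx /=; apply/D => // k /ds; rewrite tr.
split; last by apply/eqP/cmP => j; rewrite eE wmonoE -[j in count_mem j _]add0n count_runs.
split; [by rewrite size_runs|exact: runs_sorted|by apply/D].
Qed.

End Monomials.

(** * Compositions as bit sequences and the coefficients of K *)

Fixpoint bseqs (m : nat) : seq (seq bool) :=
  if m is m'.+1 then map (cons true) (bseqs m') ++ map (cons false) (bseqs m')
  else [:: [::]].

Lemma big_bseqs (A : nmodType) m (G : seq bool -> A) :
  \sum_(b <- bseqs m.+1) G b =
  \sum_(b <- bseqs m) G (true :: b) + \sum_(b <- bseqs m) G (false :: b).
Proof. by rewrite /= big_cat !big_map. Qed.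

Lemma mem_bseqs m b : (b \in bseqs m) = (size b == m).
Proof.
elim: m b => [|m IH] b /=; first by rewrite inE; case: b.
rewrite mem_cat; case: b => [|x b].
  by apply/negbTE; rewrite negb_or; apply/andP; split; apply/mapP => -[].
rewrite eqSS -IH; case: x.
  rewrite (mem_map (_ : injective (cons true))); last by move=> ? ? [].
  by case: (b \in bseqs m) => //; apply/mapP => -[].
rewrite orbC (mem_map (_ : injective (cons false))); last by move=> ? ? [].
by case: (b \in bseqs m) => //; apply/mapP => -[].
Qed.

Lemma bseqs_uniq m : uniq (bseqs m).
Proof.
elim: m => //= m IH; rewrite cat_uniq !map_inj_uniq ?IH; try by move=> ? ? [].
by rewrite andbT /=; apply/hasPn => _ /mapP[b _ ->]; apply/mapP => -[].
Qed.

Fixpoint bcomp (acc : nat) (b : seq bool) : seq nat :=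
  match b with
  | [::] => [:: acc.+1]
  | true :: b' => acc.+1 :: bcomp 0 b'
  | false :: b' => bcomp acc.+1 b'
  end.

Lemma bcomp_is_comp acc b : is_comp (bcomp acc b).
Proof. by elim: b acc => [|[] b IH] acc //=; apply: IH. Qed.

Lemma pbits_bcomp acc b : pbits (bcomp acc b) = nseq acc false ++ rcons b true.
Proof.
elim: b acc => [|[] b IH] acc /=; first by rewrite cats0 cats1.
  by rewrite IH cat_rcons.
by rewrite IH -[in RHS]cat1s catA -[[:: false]]/(nseq 1 false) -nseqD addn1.
Qed.

Lemma sumn_bcomp b : sumn (bcomp 0 b) = (size b).+1.
Proof. by rewrite -size_pbits pbits_bcomp size_rcons. Qed.

Lemma bcomp_inj b b' : bcomp 0 b = bcomp 0 b' -> b = b'.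
Proof. by move/(congr1 pbits); rewrite !pbits_bcomp /= => /rcons_inj[]. Qed.

(** The last bit of [pbits w] is always true in positive weight. Without it there remains the
    characteristic sequence of the descent set inside [n-1]. *)
Definition ibits (w : seq nat) : seq bool := take (sumn w).-1 (pbits w).

Lemma pbits_ibits w : (0 < sumn w)%N -> pbits w = rcons (ibits w) true.
Proof.
move=> w0; rewrite /ibits -[in LHS](cat_take_drop (sumn w).-1 (pbits w)) -cats1.
congr (_ ++ _); rewrite (drop_nth false) ?size_pbits ?prednK //.
by rewrite nth_pbits prednK // psums_sumn drop_oversize ?size_pbits.
Qed.

Lemma size_ibits w : size (ibits w) = (sumn w).-1.
Proof. by rewrite size_takel ?size_pbits ?leq_pred. Qed.

Lemma nth_ibits w i : (i < (sumn w).-1)%N -> nth false (ibits w) i = (i.+1 \in psums w).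
Proof. by move=> iw; rewrite nth_take // nth_pbits. Qed.

Lemma bcomp_ibits a : is_comp a -> (0 < sumn a)%N -> bcomp 0 (ibits a) = a.
Proof.
move=> ca a0; apply: pbits_inj => //; first exact: bcomp_is_comp.
by rewrite pbits_bcomp -pbits_ibits.
Qed.

Lemma ibits_bcomp b : ibits (bcomp 0 b) = b.
Proof.
have := pbits_ibits (w := bcomp 0 b); rewrite sumn_bcomp pbits_bcomp.
by move=> /(_ isT) /rcons_inj[].
Qed.

Fixpoint subb (s t : seq bool) : bool :=
  match s, t with
  | x :: s', y :: t' => (x ==> y) && subb s' t'
  | _, _ => true
  end.

Lemma subbP s t : size s = size t ->
  subb s t = all (fun i => nth false s i ==> nth false t i) (iota 0 (size s)).
Proof.
elim: s t => [|x s IH] [|y t] //= [st]; rewrite IH // (iotaDl 1 0) all_map.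
by congr (_ && _).
Qed.

Lemma subb_rcons s t x : size s = size t -> subb (rcons s x) (rcons t x) = subb s t.
Proof. by elim: s t => [|y s IH] [|z t] //= => [_|[/IH->]]; rewrite ?implybb. Qed.

Lemma subb_count s t : size s = size t -> subb s t ->
  (count id s <= count id t)%N /\ (count id s = count id t -> s = t).
Proof.
elim: s t => [|x s IH] [|y t] //= [st] /andP[xy /(IH _ st)[le eq]].
case: x y xy => -[] //= _; split=> [|e]; try lia.
- by rewrite eq //; lia.
- by rewrite eq.
Qed.

Lemma coarserE a w : sumn w = sumn a -> coarser a w = subb (pbits a) (pbits w).
Proof.
move=> wa; rewrite /coarser wa eqxx subbP ?size_pbits //=; apply/allP/allP => H k.
  by move=> _; rewrite !nth_pbits; apply/implyP; apply: H.
case: k => [|k] ka; first exact: psums0.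
have := H k; rewrite mem_iota !nth_pbits ka; apply.
by rewrite add0n /=; exact: psums_le ka.
Qed.

Lemma coarserEi a w : (0 < sumn a)%N -> sumn w = sumn a ->
  coarser a w = subb (ibits a) (ibits w).
Proof.
move=> a0 wa; rewrite coarserE // !pbits_ibits ?wa // subb_rcons //.
by rewrite !size_ibits wa.
Qed.

(** With P, D and E the sets given by [p], [b] and [e], the recursions [xcond], [sparse] and [kcond]
    encode that P lies in the symmetric difference of D and D + 1, that P has no two adjacent
    elements, and that P lies in the union of E and E + 1. The flag is the bit preceding the first
    one. *)
Fixpoint xcond (pv : bool) (b p : seq bool) : bool :=
  match b, p with
  | x :: b', y :: p' => (y ==> (x != pv)) && xcond x b' p'
  | _, _ => true
  end.

Fixpoint sparse (pv : bool) (p : seq bool) : bool :=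
  if p is x :: p' then ~~ (pv && x) && sparse x p' else true.

Fixpoint kcond (pe : bool) (e p : seq bool) : bool :=
  match e, p with
  | c :: e', y :: p' => (y ==> (c || pe)) && kcond c e' p'
  | _, _ => true
  end.

Definition xcount (pv : bool) (e p : seq bool) : nat :=
  \sum_(b <- bseqs (size e)) (xcond pv b p && subb b e : nat).

Lemma xcount_cons pv c e y p : xcount pv (c :: e) (y :: p) =
  ((if c && (y ==> ~~ pv) then xcount true e p else 0) +
   (if y ==> pv then xcount false e p else 0))%N.
Proof.
rewrite /xcount [size _]/= big_bseqs; congr (_ + _)%N.
  by case: c y pv => -[] [] //=; rewrite big1 // => b _; rewrite ?andbF.
by case: y pv => -[] //=; rewrite big1.
Qed.

Lemma xcount0 pv : xcount pv [::] [::] = 1%N. Proof. by rewrite /xcount big_seq1. Qed.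

(** A peak at [i] asks that exactly one of the bits [i - 1] and [i] of [b] be set. As peaks are not
    adjacent, these pairs of positions are disjoint; each of them halves the number of subsets [b]
    of [e] if [e] meets the pair, and leaves none otherwise. The flags have no influence, since
    [sparse true p] forbids a peak at the first bit. *)
Lemma xcountE p e pv pe : size p = size e -> sparse true p ->
  (xcount pv e p * 2 ^ count id p = 2 ^ count id e * kcond pe e p)%N.
Proof.
have [n] := ubnP (size e); elim: n p e pv pe => // n IH [|x p] [|c e] pv pe //.
  by rewrite xcount0.
rewrite [size _]/= ltnS => en [pe_size] /andP[/= /negbTE -> sp].
rewrite xcount_cons /= andbT add0n.
case: p pe_size sp => [|[] p].
- by case: e en => // _ _ _; rewrite !xcount0; case: c.
- case: e en => // c' e en [pe_size] /= sp.
  have I pv' := IH p e pv' c' (ltn_trans (ltnSn _) en) pe_size sp.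
  rewrite !xcount_cons /= !andbF !andbT /= !add0n addn0.
  have := I true; have := I false; rewrite !expnD; move: (xcount _ _ _) (xcount _ _ _) => X Y.
  by clear; case: c; case: c' => /=; nia.
move=> pe_size sp.
have sp' : sparse true (false :: p) by [].
have I pv' := IH (false :: p) e pv' c en pe_size sp'.
have := I true; have := I false; rewrite !expnD; move: (xcount _ _ _) (xcount _ _ _) => X Y.
by clear; case: c => /=; nia.
Qed.

Lemma xcondP pv b p : size b = size p -> xcond pv b p =
  all (fun i => nth false p i ==> (nth false b i != nth false (pv :: b) i)) (iota 0 (size p)).
Proof. by elim: b p pv => [|x b IH] [|y p] pv //= [st]; rewrite IH // (iotaDl 1 0) all_map. Qed.

Lemma kcondP pe e p : size e = size p -> kcond pe e p =
  all (fun i => nth false p i ==> (nth false e i || nth false (pe :: e) i)) (iota 0 (size p)).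
Proof. by elim: e p pe => [|x e IH] [|y p] pe //= [st]; rewrite IH // (iotaDl 1 0) all_map. Qed.

Lemma sparseP pv p : sparse pv p =
  all (fun i => ~~ (nth false (pv :: p) i && nth false p i)) (iota 0 (size p)).
Proof. by elim: p pv => [|x p IH] pv //=; rewrite IH (iotaDl 1 0) all_map. Qed.

Section KCoef.
Variables (n : nat) (P : {fset nat}).
Hypothesis n0 : (0 < n)%N.
Hypothesis PP : peak_subset n P.

Let pb : seq bool := [seq i.+1 \in P | i <- iota 0 n.-1].

Lemma peak_set_bits (Q : pred nat) :
  all (fun i => nth false pb i ==> Q i.+1) (iota 0 n.-1) = all Q (enum_fset P).
Proof.
apply/allP/allP => H p.
  move=> pP; have [/andP[p2 pn] _] := PP pP; case: p pP p2 pn => // p pP p2 pn.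
  have ip : p \in iota 0 n.-1 by rewrite mem_iota; lia.
  have := H p ip; rewrite (nth_map 0%N) ?size_iota ?nth_iota ?add0n; try lia.
  by move/implyP; apply.
rewrite mem_iota => pn; rewrite (nth_map 0%N) ?size_iota ?nth_iota ?add0n; try lia.
by apply/implyP; apply: H.
Qed.

Let spb : size pb = n.-1. Proof. by rewrite size_map size_iota. Qed.

Let pb_sparse : sparse true pb.
Proof.
rewrite sparseP spb; apply/allP => i; rewrite mem_iota add0n => /= ilt.
rewrite (nth_map 0%N) ?size_iota ?nth_iota ?add0n //.
apply/negP => /andP[H /PP[/andP[i2 _]]]; case: i ilt i2 H => // i ilt _ /=.
rewrite (nth_map 0%N) ?size_iota ?nth_iota ?add0n; try lia.
by move=> ->.
Qed.

Let count_pb : count id pb = #|` P|.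
Proof.
rewrite count_map -size_filter -(size_map S); apply/perm_size/uniq_perm.
- by rewrite map_inj_uniq ?filter_uniq ?iota_uniq // => ? ? [].
- exact: fset_uniq.
move=> p; apply/mapP/idP => [[i]|pP]; first by rewrite mem_filter => /andP[/= ? _] ->.
have [/andP[p2 pn] _] := PP pP; case: p pP p2 pn => // p pP p2 pn.
by exists p => //; rewrite mem_filter /= pP mem_iota; lia.
Qed.

Let shift_xcond b : size b = n.-1 ->
  (P `<=` descents_shift_diff (bcomp 0 b))%fset = xcond true b pb.
Proof.
move=> sb; rewrite xcondP ?spb //.
transitivity (all (fun p => nth false b p.-1 != nth false (true :: b) p.-1) (enum_fset P)); last first.
  exact/esym/(peak_set_bits (fun p => nth false b p.-1 != nth false (true :: b) p.-1)).
have dE k : (0 < k < n)%N -> (k \in descents (bcomp 0 b)) = nth false b k.-1.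
  move=> kn; rewrite mem_descents ?bcomp_is_comp // sumn_bcomp sb prednK // kn /=.
  case: k kn => // k kn; rewrite -nth_pbits pbits_bcomp /= nth_rcons sb.
  by case: ltngtP => //; lia.
apply/fsubsetP/allP => H p pP; have [/andP[p2 pn] _] := PP pP.
  have := H p pP; rewrite /descents_shift_diff in_fsetU !in_fsetD dE; last lia.
  have -> : (p \in [fset i.+1 | i in descents (bcomp 0 b)]%fset) = nth false b p.-2.
    rewrite -dE; last lia.
    apply/imfsetP/idP => /= [[i iD ->] //|pD].
    by exists p.-1 => //; lia.
  by case: p p2 {pP pn} => // -[|p] //= _; case: (nth _ _ _); case: (nth _ _ _).
have := H p pP; rewrite /descents_shift_diff in_fsetU !in_fsetD dE; last lia.
have -> : (p \in [fset i.+1 | i in descents (bcomp 0 b)]%fset) = nth false b p.-2.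
  rewrite -dE; last lia.
  apply/imfsetP/idP => /= [[i iD ->] //|pD].
  by exists p.-1 => //; lia.
by case: p p2 {pP pn} => // -[|p] //= _; case: (nth _ _ _); case: (nth _ _ _).
Qed.

Definition peak_covered (w : seq nat) : bool :=
  all (fun p => (p \in psums w) || (p.-1 \in psums w)) (enum_fset P).

(** By [xcountE] every peak halves the number of compositions that contribute. The factor 2^(|P| +
    1) of [K] undoes these halvings, and its extra 2 stands for the last bit of [pbits w], which
    [ibits w] omits. *)
Lemma co_K w : co (K n P) w =
  if (sumn w == n) && peak_covered w then 2 ^+ nz w else 0.
Proof.
rewrite /K coMn.
have -> : [set a | [/\ is_comp a, sumn a = n & (P `<=` descents_shift_diff a)%fset]] =
    [set` [seq bcomp 0 b | b <- [seq b <- bseqs n.-1 | xcond true b pb]]].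
  apply/seteqP; split=> a /=.
    move=> [ca an Pa]; apply/mapP; exists (ibits a); last by rewrite bcomp_ibits ?an.
    rewrite mem_filter mem_bseqs size_ibits an eqxx andbT -shift_xcond ?size_ibits ?an //.
    by rewrite bcomp_ibits ?an.
  case/mapP => b; rewrite mem_filter mem_bseqs => /andP[xb /eqP sb] ->.
  by rewrite bcomp_is_comp sumn_bcomp sb prednK // shift_xcond.
rewrite -fsbig_seq; last first.
  by rewrite (map_inj_uniq bcomp_inj) filter_uniq ?bseqs_uniq.
rewrite co_sum big_map big_filter.
case: eqP => [wn|wn] /=; last first.
  rewrite big_seq_cond big1 ?mul0rn // => b; rewrite mem_bseqs => /andP[/eqP sb _].
  rewrite co_F ?bcomp_is_comp // /coarser sumn_bcomp sb prednK //.
  by case: eqP wn.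
have w0 : (0 < sumn w)%N by rewrite wn.
have sE : size (ibits w) = n.-1 by rewrite size_ibits wn.
have -> : \sum_(b <- bseqs n.-1 | xcond true b pb) co (F (bcomp 0 b)) w =
    (xcount true (ibits w) pb)%:R.
  rewrite /xcount sE natr_sum big_mkcond /= big_seq [RHS]big_seq; apply: eq_bigr => b.
  rewrite mem_bseqs => /eqP sb; case: ifP => // xb.
  rewrite co_F ?bcomp_is_comp // coarserEi ?sumn_bcomp ?sb ?prednK //.
  by rewrite ibits_bcomp.
rewrite -mulrnA expnS mulnCA -count_pb (xcountE _ true) ?spb ?sE //.
have -> : nz w = (count id (ibits w)).+1.
  by rewrite -count_pbits pbits_ibits // -cats1 count_cat /= addn1.
have -> : peak_covered w = kcond true (ibits w) pb.
  rewrite kcondP ?sE ?spb // /peak_covered.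
  transitivity (all (fun p => nth false (ibits w) p.-1 || nth false (true :: ibits w) p.-1) (enum_fset P)); last first.
    by apply/esym; apply: (peak_set_bits (fun p => nth false _ p.-1 || nth false (true :: _) p.-1)).
  apply: eq_in_all => p pP; have [/andP[p2 pn] _] := PP pP.
  case: p {pP} p2 pn => // -[|p] //= _ pn; rewrite !nth_ibits ?wn //; lia.
case: kcond; last by rewrite !muln0 mulr0n.
by rewrite muln1 -expnS natrX.
Qed.

End KCoef.

(** * The peak functions satisfy the invariants *)

Lemma mem_psums_cat u v k : (k \in psums (u ++ v)) =
  (k \in psums u) || (k \in map (addn (sumn u)) (psums v)).
Proof.
elim: u k => [|c u IH] k /=.
  by rewrite (eq_map add0n) map_id inE; case: eqP => // ->; rewrite psums0.
rewrite !inE -orbA; congr (_ || _).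
apply/mapP/orP => [[j]|[/mapP[j ju ->]|/mapP[j jv ->]]].
- rewrite IH => /orP[ju|/mapP[i iv ->]] ->; first by left; apply: map_f.
  by right; apply/mapP; exists i => //; rewrite addnA.
- by exists j => //; rewrite IH ju.
- by exists (sumn u + j)%N; rewrite ?addnA // IH map_f ?orbT.
Qed.

Lemma mem_psums_cat2 u v p q k : (k \in psums (u ++ p :: q :: v)) =
  [|| k \in psums u, k == (sumn u + p)%N | k \in map (addn (sumn u + (p + q))) (psums v)].
Proof.
rewrite mem_psums_cat /= !inE addn0 orbA.
case: (eqVneq k (sumn u)) => [->|_] /=; first by rewrite psums_sumn.
rewrite orbF addn0; congr (_ || (_ || _)).
by rewrite -!map_comp; congr (k \in _); apply: eq_map => j /=; rewrite !addnA.
Qed.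

Lemma nz_cat u v : nz (u ++ v) = (nz u + nz v)%N. Proof. exact: count_cat. Qed.

Lemma alt_sum k : \sum_(p < k.+1) (-1) ^+ (k - p) = (~~ odd k)%:R :> rat.
Proof.
elim: k => [|k IH]; first by rewrite big_ord1.
rewrite big_ord_recr /= subnn expr0.
under eq_bigr => i _ do rewrite subSn ?leq_ord // exprS mulN1r.
by rewrite sumrN IH negbK; case: odd; rewrite ?oppr0 ?add0r ?addNr.
Qed.

Section KPQ.
Variables (n : nat) (P : {fset nat}).
Hypothesis n0 : (0 < n)%N.
Hypothesis PP : peak_subset n P.

(* If some element [x] of [P] is not a partial sum of the coarser word, nor the
   successor of one, then the terms with the new partial sum at [x] and at
   [x - 1] cancel, as [P] has no two consecutive elements. *)
Lemma K_cancelling : cancelling (K n P).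
Proof.
move=> u v k k0; rewrite /czeta.
case: (eqVneq (sumn u + (k + sumn v))%N n) => [un|/negbTE un]; last first.
  rewrite big1 // => p _; rewrite co_K // sumn_cat /= (addnA p) subnKC ?un ?mulr0 //.
  by rewrite -ltnS.
pose B j := (j \in psums u) || (j \in map (addn (sumn u + k)) (psums v)).
pose cov j := B j || B j.-1.
pose x p := all (fun j => cov j || (j == (sumn u + p)%N) || (j == (sumn u + p).+1)) (enum_fset P).
pose X := all cov (enum_fset P).
have E (p : 'I_k.+1) : co (K n P) (u ++ (p : nat) :: (k - p)%N :: v) =
    2 ^+ (nz u + nz v) * ((x p)%:R * (2 ^+ (p != 0 :> nat) * 2 ^+ (p != k :> nat))).
  have pk : (p <= k)%N by rewrite -ltnS.
  rewrite co_K // sumn_cat /= (addnA p) subnKC // un eqxx /=.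
  have -> : peak_covered P (u ++ (p : nat) :: (k - p)%N :: v) = x p.
    apply: eq_in_all => j jP; have [/andP[j2 _] _] := PP jP.
    rewrite !mem_psums_cat2 subnKC // /cov /B.
    have -> : (j.-1 == (sumn u + p)%N) = (j == (sumn u + p).+1) by lia.
    set a1 := (_ \in _); set c1 := (_ \in _); set a2 := (_ \in _); set c2 := (_ \in _).
    by case: a1 c1 a2 c2 (j == _) (j == _) => -[] [] [] [] [].
  case: (x p); last by rewrite mul0r mulr0.
  rewrite mul1r -!exprD nz_cat /nz /=; congr (_ ^+ _).
  have -> : (k - p != 0)%N = (p != k :> nat) by lia.
  by lia.
have x0 : x 0%N = X.
  apply: eq_in_all => j jP; rewrite addn0 /cov /B.
  case: (eqVneq j (sumn u)) => [->|_]; first by rewrite psums_sumn.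
  by case: (eqVneq j (sumn u).+1) => [->|_]; rewrite ?orbF //= psums_sumn !orbT.
have su_k : (sumn u + k)%N \in map (addn (sumn u + k)) (psums v).
  by apply/mapP; exists 0%N; rewrite ?psums0 ?addn0.
have xk : x k = X.
  apply: eq_in_all => j jP; rewrite /cov /B.
  case: (eqVneq j (sumn u + k)%N) => [->|_]; first by rewrite su_k !orbT.
  by case: (eqVneq j (sumn u + k).+1) => [->|_]; rewrite ?orbF //= su_k !orbT.
under eq_bigr => p _ do rewrite E mulrCA.
rewrite -mulr_sumr; apply/eqP; rewrite mulf_eq0; apply/orP; right; apply/eqP.
(* If the coarser word covers all peaks, so does every splitting of the letter [k]. Splittings with
   a zero letter then have weight 2 and the others weight 4, and [alt_sum] shows that the
   alternating sum vanishes. *)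
case XE: X; rewrite XE in x0 xk.
  have x1 p : x p.
    by apply/allP => j jP; rewrite (allP XE).
  under eq_bigr => p _ do rewrite x1 mul1r.
  have [k' kE] : exists k', k = k'.+1 by case: (k) k0 => // k' _; exists k'.
  have := alt_sum k; rewrite kE.
  rewrite big_ord_recl big_ord_recr /= => S.
  rewrite big_ord_recl big_ord_recr /= /bump /= add1n eqxx /= subnn subn0.
  under eq_bigr => i _.
    have -> : (1 + i == k'.+1)%N = false by have := ltn_ord i; lia.
    rewrite /= expr1.
  over.
  rewrite -mulr_suml; move: S; rewrite /bump /= add1n subnn subn0; set T := \sum_(_ < _) _.
  rewrite -signr_odd oddS; case: (odd k') => /=; rewrite ?expr0 ?expr1; lra.
have /allPn[q qP nq] : ~~ X by rewrite XE.
have [/andP[q2 qn] qN] := PP qP.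
have xq p : x p -> (q == (sumn u + p)%N) || (q == (sumn u + p).+1).
  by move=> /allP /(_ q qP); rewrite (negbTE nq).
have xx : (sumn u + 1 < q < sumn u + k)%N -> x (q - sumn u)%N = x (q - sumn u).-1.
  move=> qb; apply: eq_in_all => j jP; rewrite subnKC; last lia.
  rewrite (_ : (sumn u + (q - sumn u).-1)%N = q.-1) ?prednK; try lia.
  have [_ jN] := PP jP.
  have -> : (j == q.+1) = false by apply: contraNF jN => /eqP ->.
  have -> : (j == q.-1) = false by apply: contraNF qN => /eqP <-.
  by rewrite !orbF.
have nqu : q != sumn u by apply: contraNneq nq => ->; rewrite /cov /B psums_sumn.
have nqu1 : q != (sumn u).+1 by apply: contraNneq nq => ->; rewrite /cov /B psums_sumn !orbT.
have nqk : q != (sumn u + k)%N by apply: contraNneq nq => ->; rewrite /cov /B su_k !orbT.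
have nqk1 : q != (sumn u + k).+1 by apply: contraNneq nq => ->; rewrite /cov /B su_k !orbT.
case: (boolP (sumn u + 1 < q < sumn u + k)%N) => qb; last first.
  rewrite big1 // => p _; case xp: (x p); last by rewrite mul0r mulr0.
  have pk : (p <= k)%N by rewrite -ltnS.
  have := xq _ xp; have : (p : nat) != 0%N by apply: contraTneq xp => ->; rewrite x0.
  have : (p : nat) != k by apply: contraTneq xp => ->; rewrite xk.
  by move: nqu nqu1 nqk nqk1 qb pk; clear; move: (nat_of_ord p) => m; lia.
have p1 : (q - sumn u < k.+1)%N by clear -qb; lia.
have p2 : ((q - sumn u).-1 < k.+1)%N by clear -qb; lia.
have p12 : Ordinal p2 != Ordinal p1 by rewrite -val_eqE /=; clear -qb; lia.
rewrite (bigD1 (Ordinal p1)) //= (bigD1 (Ordinal p2)) //= big1 ?addr0 => [|p /andP[pp1 pp2]]; last first.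
  case xp: (x p); last by rewrite mul0r mulr0.
  by have := xq _ xp; move: pp1 pp2 qb; rewrite -!val_eqE /=; clear; lia.
rewrite -xx //.
have -> : (q - sumn u != 0)%N by clear -qb; lia.
have -> : ((q - sumn u).-1 != 0)%N by clear -qb; lia.
have -> : (q - sumn u != k)%N by clear -qb; lia.
have -> : ((q - sumn u).-1 != k)%N by clear -qb; lia.
have -> : (k - (q - sumn u).-1 = (k - (q - sumn u)).+1)%N by clear -qb; lia.
by rewrite exprS mulN1r mulNr addrN.
Qed.

Lemma K_pqsymZ : K n P \in pqsymZ.
Proof.
apply/pqsymZP; split; last first.
  by move=> w; rewrite co_K //; case: ifP => _; [exists 1; rewrite mul1r|exists 0; rewrite mul0r].
apply/pqsymQP; split; last first.
- by exists n => w nw; rewrite co_K //; case: eqP nw => // ->; rewrite ltnn.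
- exact: K_cancelling.
move=> u v; rewrite !co_K // !sumn_cat !nz_cat.
have -> : nz (0%N :: v) = nz v by [].
have -> // : peak_covered P (u ++ 0%N :: v) = peak_covered P (u ++ v).
have H k : (k \in psums (u ++ 0%N :: v)) = (k \in psums (u ++ v)).
  rewrite !mem_psums_cat /= (eq_map add0n) map_id !inE addn0.
  by case: eqP => // ->; rewrite psums_sumn.
by apply: eq_all => j; rewrite !H.
Qed.

End KPQ.

(** * Linear combinations and independence of the F *)

Section Lincomb.
Variables (A : zmodType) (T : choiceType).
Implicit Types (b : T -> A) (c : {fsfun T -> int with 0}).

Lemma lincombEw b c (s : seq T) : uniq s -> {subset finsupp c <= s} ->
  lincomb b c = \sum_(t <- s) b t *~ c t.
Proof.
move=> us cs; rewrite /lincomb.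
have -> : \sum_(t <- s) b t *~ c t = \sum_(t <- [fset x in s]%fset) b t *~ c t.
  by apply: perm_big; apply: uniq_perm; rewrite ?fset_uniq // => t; rewrite !inE.
apply: big_fset_incl => [|t _ /fsfun_dflt ->]; last by rewrite mulr0z.
by apply/fsubsetP => t /cs; rewrite !inE.
Qed.

Lemma lincomb_seq (s : seq T) (h : T -> int) : uniq s ->
  exists c, forall b, lincomb b c = \sum_(t <- s) b t *~ h t.
Proof.
move=> us; exists [fsfun t in [fset x in s]%fset => h t] => b.
rewrite (@lincombEw _ _ s) //; last first.
  by move=> t; rewrite mem_finsupp fsfunE inE; case: ifP; rewrite ?eqxx.
by rewrite big_seq [RHS]big_seq; apply: eq_bigr => t ts; rewrite fsfunE inE /= ts.
Qed.

Definition seq_free b := forall (s : seq T) (h : T -> int),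
  uniq s -> \sum_(t <- s) b t *~ h t = 0 -> forall t, t \in s -> h t = 0.

Lemma lincomb_inj b : seq_free b -> forall c1 c2, lincomb b c1 = lincomb b c2 -> c1 = c2.
Proof.
move=> fb c1 c2 e; apply/fsfunP => t.
pose s := undup (t :: finsupp c1 ++ finsupp c2).
have us : uniq s by apply: undup_uniq.
have ts : t \in s by rewrite mem_undup inE eqxx.
apply/eqP; rewrite -subr_eq0; apply/eqP.
apply: (fb s (fun t => c1 t - c2 t)) ts => //.
under eq_bigr => i _ do rewrite mulrzBr.
rewrite sumrB -!(@lincombEw b) ?e ?subrr //.
  by move=> i ic; rewrite mem_undup inE mem_cat ic !orbT.
by move=> i ic; rewrite mem_undup inE mem_cat ic !orbT.
Qed.

Lemma lincomb1 (t : T) : exists c, forall b, lincomb b c = b t.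
Proof.
have [c cE] := @lincomb_seq [:: t] (fun=> 1) isT.
by exists c => b; rewrite cE big_seq1.
Qed.

End Lincomb.

(** Choose [a] with a nonzero coefficient and as few parts as possible. At the word [a] only coarser
    compositions contribute; they have fewer parts unless they are [a] itself. *)
Lemma F_free : seq_free (fun a : composition => F (val a)).
Proof.
move=> s h us s0 t ts; apply/eqP/negPn/negP => ht.
have ex : exists n, has (fun u : composition => (h u != 0) && (size (val u) == n)) s.
  by exists (size (val t)); apply/hasP; exists t; rewrite ?ht /=.
case: (ex_minnP ex) => n /hasP[a sa /andP[ha /eqP an]] nmin.
have := congr1 (fun f => co f (val a)) s0; rewrite co0 co_sum (bigD1_seq a) //=.
rewrite coMz co_F ?(valP a) // {1}/coarser eqxx (_ : all _ _); last by apply/allP.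
rewrite big_seq_cond big1 ?addr0 => [/eqP|u /andP[us' ua]].
  by rewrite intr_eq0 (negbTE ha).
rewrite coMz co_F ?(valP u) //.
case: (eqVneq (h u) 0) => [->|hu]; first by rewrite mulr0z.
case C: (coarser _ _); last by rewrite mul0rz.
case/eqP: ua; apply: val_inj => /=.
have su : sumn (val a) = sumn (val u) by move/andP: C => [/eqP].
have su' : size (pbits (val u)) = size (pbits (val a)) by rewrite !size_pbits.
move: C; rewrite coarserE // => /(subb_count su')[le eq].
apply: pbits_inj; [exact: (valP u)|exact: (valP a)|apply: eq].
have nzs (v : composition) : nz (val v) = size (val v).
  by rewrite -size_strip strip_comp //; apply: (valP v).
move: le; rewrite !count_pbits !nzs => le; apply/eqP; rewrite eqn_leq le an.
by apply: nmin; apply/hasP; exists u; rewrite ?hu /=.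
Qed.

(** * Coefficients of the monomial peak functions *)

Definition bcomposition (b : seq bool) : composition :=
  exist _ (bcomp 0 b) (bcomp_is_comp 0 b).

Definition sgnb (b c : seq bool) : int := (-1) ^+ (count id b + count id c).

(** Moebius inversion in the Boolean lattice, one bit at a time. *)
Lemma subb_sign_sum A E : size E = size A ->
  \sum_(b <- bseqs (size A)) (subb A b && subb b E)%:R * (sgnb b A)%:~R = (E == A)%:R :> rat.
Proof.
elim: A E => [|a A IH] [|e E] //= => [_|[EA]]; first by rewrite big_seq1.
rewrite -/(bseqs (size A).+1) big_bseqs eqseq_cons /=.
have sg x y b : (sgnb (x :: b) (y :: A))%:~R = (-1) ^+ (x + y) * (sgnb b A)%:~R :> rat.
  by rewrite /sgnb /= addnACA exprD intrM !rmorphXn.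
under eq_bigr => b _ do rewrite sg.
under [X in _ + X]eq_bigr => b _ do rewrite sg.
case: a e => -[] /=.
- rewrite [X in _ + X]big1 ?addr0 => [|b _]; last by rewrite mul0r.
  by rewrite -IH //; apply: eq_bigr => b _; rewrite sqrrN expr1n mul1r.
- by rewrite !big1 ?addr0 // => b _; rewrite ?andbF mul0r.
- rewrite -big_split big1 // => b _ /=.
  by rewrite expr1 expr0 mul1r mulN1r mulrN addNr.
- rewrite big1 ?add0r => [|b _]; last by rewrite andbF mul0r.
  by rewrite -IH //; apply: eq_bigr => b _; rewrite mul1r.
Qed.

Lemma M_lincomb a : is_comp a -> (0 < sumn a)%N ->
  M a = \sum_(b <- [seq b <- bseqs (sumn a).-1 | subb (ibits a) b])
           F (bcomp 0 b) *~ sgnb b (ibits a).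
Proof.
move=> ca a0; apply: co_ext => w; rewrite co_M // co_sum.
case: (eqVneq (sumn w) (sumn a)) => [wa|wa]; last first.
  rewrite big1_seq => [|b /andP[_]].
    case: eqP => // sw; case/eqP: wa.
    by rewrite -size_pbits -pbits_strip sw size_pbits.
  rewrite mem_filter mem_bseqs => /andP[_ /eqP sb].
  rewrite coMz co_F ?bcomp_is_comp // /coarser sumn_bcomp sb prednK //.
  by rewrite (negbTE wa) mul0rz.
have w0 : (0 < sumn w)%N by rewrite wa.
have -> : (strip w == a) = (ibits w == ibits a).
  apply/eqP/eqP => [<-|e].
    by rewrite /ibits pbits_strip -!size_pbits pbits_strip.
  by apply: pbits_inj; rewrite ?strip_is_comp // pbits_strip !pbits_ibits // e.
rewrite -(@subb_sign_sum (ibits a)) ?size_ibits ?wa // big_filter [RHS]big_mkcond /=.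
rewrite big_seq [RHS]big_seq; apply: eq_bigr => b; rewrite mem_bseqs => /eqP sb.
case: ifP => _; last by rewrite mul0r.
rewrite coMz co_F ?bcomp_is_comp // coarserEi ?sumn_bcomp ?sb ?prednK //.
by rewrite ibits_bcomp [LHS]mulrzr.
Qed.

(** [linext] can be computed on combinations of the [F] only, so [M a] is first expanded by
    inclusion-exclusion; [F_free] makes the value independent of the expansion. *)
Lemma theta_M a : is_comp a -> (0 < sumn a)%N ->
  L a = \sum_(b <- [seq b <- bseqs (sumn a).-1 | subb (ibits a) b])
           K (sumn a) (peaks (bcomp 0 b)) *~ sgnb b (ibits a).
Proof.
move=> ca a0; rewrite /L /theta (M_lincomb ca a0).
set bs := [seq _ <- _ | _].
have uS : uniq [seq bcomposition b | b <- bs].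
  rewrite map_inj_uniq ?filter_uniq ?bseqs_uniq // => b b' /(congr1 val).
  exact: bcomp_inj.
have [c cE] := lincomb_seq QX (fun t : composition => sgnb (ibits (val t)) (ibits a)) uS.
have E (v : composition -> QX) : lincomb v c =
    \sum_(b <- bs) v (bcomposition b) *~ sgnb b (ibits a).
  by rewrite cE big_map; apply: eq_bigr => b _; rewrite /= ibits_bcomp.
rewrite -(E (fun t => F (val t))) linextE; last exact: lincomb_inj F_free.
rewrite E big_seq [RHS]big_seq; apply: eq_bigr => b.
rewrite mem_filter mem_bseqs => /andP[_ /eqP sb] /=.
rewrite sumn_bcomp sb prednK //; case: eqP => // e.
by have := sumn_bcomp b; rewrite e.
Qed.

Lemma L_nil : L [::] = 1.
Proof.
have [c cE] := lincomb1 QX (exist _ [::] isT : composition).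
have M1 : M [::] = F [::].
  apply: co_ext => w; rewrite co_M // co_F // /coarser /= psums0 andbT.
  by congr (_%:R); congr nat_of_bool; rewrite eq_sym; elim: w => //= c' w; case: c'.
rewrite /L /theta M1 -(cE (fun t => F (val t))) linextE ?cE //.
exact: lincomb_inj F_free.
Qed.

Lemma odd_is_comp a : all odd a -> is_comp a.
Proof. by apply: sub_all => -[]. Qed.

Lemma peaks_peak_subset a : is_comp a -> peak_subset (sumn a) (peaks a).
Proof.
move=> ca i; rewrite !inE /= => /andP[id' /andP[i2 ni]]; split=> //.
by rewrite (negbTE ni).
Qed.

(** Reads from left to right whether [e] covers the peaks of [b]. The flag [fr] says that the
    previous position lies in [b] or in [e]: then a descent here is not a peak, or it is covered by
    its predecessor. It starts as [true] because 1 is never a peak. *)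
Fixpoint okb (fr : bool) (b e : seq bool) : bool :=
  match b, e with
  | x :: b', c :: e' => (x ==> (fr || c)) && okb (x || c) b' e'
  | _, _ => true
  end.

Lemma okbP fr b e : size b = size e -> okb fr b e =
  all (fun i => nth false b i ==>
    ((if i is j.+1 then nth false b j || nth false e j else fr) || nth false e i))
    (iota 0 (size b)).
Proof.
elim: b e fr => [|x b IH] [|c e] fr //= [st]; rewrite IH // (iotaDl 1 0) all_map.
congr (_ && _); apply: eq_all => i /=; case: i => //.
Qed.

Lemma peak_covered_okb b w : sumn w = (size b).+1 ->
  peak_covered (peaks (bcomp 0 b)) w = okb true b (ibits w).
Proof.
move=> wb.
have se : size (ibits w) = size b by rewrite size_ibits wb.
have dE k : (0 < k < (size b).+1)%N -> (k \in descents (bcomp 0 b)) = nth false b k.-1.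
  move=> kn; rewrite mem_descents ?bcomp_is_comp // sumn_bcomp kn /=.
  case: k kn => // k kn; rewrite -nth_pbits pbits_bcomp /= nth_rcons.
  by case: ltngtP => //; lia.
have eE i : (i < size b)%N -> nth false (ibits w) i = (i.+1 \in psums w).
  by move=> ib; rewrite nth_ibits // wb.
rewrite okbP ?se //; apply/allP/allP => H i.
  rewrite mem_iota add0n => /= ib; apply/implyP => bi.
  case: i ib bi => // j ib bi; rewrite !eE //; last exact: ltnW.
  case bj: (nth false b j) => //=.
  have := H j.+2; rewrite orbC; apply.
  rewrite !inE /= sumn_bcomp !dE /= ?bi ?bj; lia.
rewrite !inE /= sumn_bcomp => /andP[iD /andP[/andP[i2 ib] iN]].
case: i i2 ib iD iN => // -[|i] // _ ib; rewrite !dE /=; try lia.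
move=> bi /negbTE bi'; have := H i.+1; rewrite mem_iota bi bi' !eE /=; lia.
Qed.

(** What is left of the coefficient of [L a] at [w] when the common power of 2 has been taken out,
    with [A] and [E] the inner bits of [a] and [w]. *)
Definition signed_count (fr : bool) (A E : seq bool) : rat :=
  \sum_(b <- bseqs (size A)) (subb A b && okb fr b E)%:R * (sgnb b A)%:~R.

Lemma signed_count_true fr A e E :
  signed_count fr (true :: A) (e :: E) = if fr || e then signed_count true A E else 0.
Proof.
rewrite /signed_count /= -/(bseqs (size A).+1) big_bseqs /=.
rewrite [X in _ + X]big1 ?addr0 => [|b _]; last by rewrite mul0r.
case: (fr || e) => /=; last by rewrite big1 // => b _; rewrite andbF mul0r.
apply: eq_bigr => b _; congr (_ * _).
by rewrite /sgnb /= addnACA exprD rmorphM rmorphXn /= sqrrN expr1n mul1r.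
Qed.

Lemma signed_count_false fr A e E : signed_count fr (false :: A) (e :: E) =
  signed_count e A E - (if fr || e then signed_count true A E else 0).
Proof.
rewrite /signed_count /= -/(bseqs (size A).+1) big_bseqs addrC /=; congr (_ + _).
case: (fr || e) => /=; last by rewrite big1 ?oppr0 // => b _; rewrite andbF mul0r.
rewrite -sumrN; apply: eq_bigr => b _; rewrite -mulrN; congr (_ * _).
rewrite /sgnb.
have -> : (count id (true :: b) + count id (false :: A) = (count id b + count id A).+1)%N.
  by rewrite /=; lia.
by rewrite exprS mulN1r rmorphN.
Qed.

(** At a position of [E] outside [A] the bit of [b] can be toggled: [okb] does not notice it,
    whereas the sign changes, so the terms cancel in pairs. *)
Lemma signed_count0 fr A E : size E = size A -> ~~ subb E A -> signed_count fr A E = 0.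
Proof.
elim: A E fr => [|a A IH] [|e E] fr //= [EA].
rewrite negb_and negb_imply => H.
case: a H => [H|]; last rewrite /= andbT => H.
  rewrite signed_count_true; case: ifP => // _; apply: IH => //.
  by move: H; rewrite andbF.
rewrite signed_count_false; case: e H => /= [_|H]; first by rewrite orbT subrr.
by rewrite !IH // if_same subrr.
Qed.

Lemma signed_count_nseq z A E :
  signed_count false (nseq z false ++ A) (nseq z false ++ E) = signed_count false A E /\
  signed_count true (nseq z false ++ A) (nseq z false ++ E) =
    if odd z then signed_count false A E - signed_count true A E else signed_count true A E.
Proof.
elim: z => // z [IH1 IH2]; rewrite /= !signed_count_false /= IH1 IH2 subr0; split=> //.
by case: (odd z) => //=; rewrite opprB addrC subrK.
Qed.

Lemma subb_nseq_false E z : subb E (nseq z false) -> size E = z -> E = nseq z false.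
Proof.
by elim: z E => [|z IH] [|[] E] //= sE [zE]; congr (_ :: _); exact: IH.
Qed.

(** A part of [a] starts with a run of [c] false bits, and [c] is even because the part is odd. By
    [signed_count_nseq] an even run leaves the count unchanged, so the parts can be removed one
    after the other; an odd run would produce a difference of two counts. *)
Lemma signed_count_odd a A E : all odd a -> (0 < size a)%N -> rcons A true = pbits a ->
  size E = size A -> subb E A -> signed_count true A E = 1.
Proof.
elim: a A E => // -[//|c] a IH A E /andP[/= oc oa] _ eA sE EA.
have [a0|a0] := posnP (size a).
  move: eA; rewrite (size0nil a0) cats0 => /rcons_inj[eA]; rewrite eA in sE EA *.
  rewrite size_nseq in sE.
  rewrite (subb_nseq_false EA sE) -[nseq c false]cats0 (signed_count_nseq c [::] [::]).2.
  by rewrite (negbTE oc) /signed_count big_seq1 /= mul1r.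
have pa : (0 < sumn a)%N.
  exact: leq_trans a0 (all_odd_size oa).
move: eA; rewrite (pbits_ibits pa) -rcons_cat => /rcons_inj[eA].
rewrite eA cat_rcons in sE EA *.
pose E1 := take c E; pose E2 := drop c E.
have cE : (c <= size E)%N by rewrite sE size_cat size_nseq leq_addr.
have E12 : E = E1 ++ E2 by rewrite cat_take_drop.
have sE1 : size E1 = c by rewrite size_takel.
have subb_cat (s1 s2 t1 t2 : seq bool) : size s1 = size t1 ->
    subb (s1 ++ s2) (t1 ++ t2) = subb s1 t1 && subb s2 t2.
  elim: s1 t1 => [|x s1 IHs] [|y t1] //= [/IHs ->]; exact: andbA.
move: EA; rewrite E12 subb_cat ?size_nseq // => /andP[h1 sE2].
rewrite (subb_nseq_false h1 sE1).
rewrite (signed_count_nseq c _ _).2 (negbTE oc).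
move: sE; rewrite E12 !size_cat sE1 size_nseq => /addnI.
case: E2 sE2 {E12} => // e E2 /= sE2 [sE]; rewrite signed_count_true /=.
exact: (IH _ _ oa a0 (esym (pbits_ibits pa)) sE (andP sE2).2).
Qed.

(** Each [K] in [theta_M] has coefficient 2^(nz w) or 0 at [w]. The power factors out, and the
    remaining signed count is 1 or 0 according to whether the bits of [w] are among those of [a]. *)
Lemma co_L a w : all odd a -> co (L a) w = if coarser w a then 2 ^+ nz w else 0.
Proof.
move=> oa; case: (posnP (size a)) => [/size0nil ->|a0].
  have w0E : (0 == sumn w)%N = all (pred1 0%N) w.
    by rewrite eq_sym; elim: w => //= c w <-; case: c.
  rewrite L_nil co1 /coarser -[sumn [::]]/0%N w0E; case: allP => //= w0.
  have sw : (0 == sumn w)%N by rewrite w0E; apply/allP.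
  have -> : all (fun k => k \in [:: 0%N]) (psums w).
    by apply/allP => k /psums_le; rewrite -(eqP sw) inE leqn0.
  suff -> : nz w = 0%N by [].
  by apply/eqP; rewrite -leqn0 leqNgt -has_count; apply/hasPn => c /w0 /= ->.
have ca := odd_is_comp oa.
have sa : (0 < sumn a)%N := leq_trans a0 (all_odd_size oa).
rewrite theta_M // co_sum big_filter big_mkcond /=.
have K_co b : size b = (sumn a).-1 -> co (K (sumn a) (peaks (bcomp 0 b))) w =
    if (sumn w == sumn a) && peak_covered (peaks (bcomp 0 b)) w then 2 ^+ nz w else 0.
  move=> sb; rewrite co_K //.
  by have := peaks_peak_subset (bcomp_is_comp 0 b); rewrite sumn_bcomp sb prednK.
rewrite /coarser eq_sym; case: eqP K_co => [wa|wa] K_co; last first.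
  rewrite big_seq big1 // => b; rewrite mem_bseqs => /eqP sb.
  by rewrite coMz K_co // mul0rz if_same.
transitivity (2 ^+ nz w * signed_count true (ibits a) (ibits w)).
  rewrite /signed_count size_ibits mulr_sumr big_seq [RHS]big_seq.
  apply: eq_bigr => b; rewrite mem_bseqs => /eqP sb; rewrite coMz K_co //=.
  rewrite peak_covered_okb ?sb ?prednK //.
  case: (subb _ _) => /=; last by rewrite mul0r mulr0.
  case: (okb _ _ _); last by rewrite !(mul0rz, mul0r, mulr0).
  by rewrite mul1r mulrzr.
have -> : all (fun k => k \in psums a) (psums w) = subb (ibits w) (ibits a).
  by rewrite -coarserEi ?wa // /coarser wa eqxx.
have sE : size (ibits w) = size (ibits a) by rewrite !size_ibits wa.
case: ifP => [wa'|/negbT wa']; last by rewrite signed_count0 ?mulr0.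
by rewrite (signed_count_odd oa) ?mulr1 // pbits_ibits.
Qed.

Lemma L_pqsymZ a : all odd a -> L a \in pqsymZ.
Proof.
move=> oa; case: (posnP (size a)) => [/size0nil ->|a0]; first by rewrite L_nil rpred1.
have sa : (0 < sumn a)%N := leq_trans a0 (all_odd_size oa).
rewrite theta_M ?odd_is_comp //; rewrite big_seq; apply: rpred_sum => b.
rewrite mem_filter mem_bseqs => /andP[_ /eqP sb]; apply: rpredMz; apply: K_pqsymZ => //.
by have := peaks_peak_subset (bcomp_is_comp 0 b); rewrite sumn_bcomp sb prednK.
Qed.

Lemma coarser_refl a : coarser a a.
Proof. by rewrite /coarser eqxx; apply/allP. Qed.

Lemma coarser_nz w a : coarser w a -> (nz w <= nz a)%N /\ (nz w = nz a -> strip w = strip a).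
Proof.
move=> C; have wa : sumn a = sumn w by case/andP: C => /eqP.
move: C; rewrite coarserE // => /subb_count; rewrite !size_pbits wa !count_pbits.
case=> // le eq; split=> // /eq e; apply: pbits_inj; rewrite ?strip_is_comp //.
by rewrite !pbits_strip.
Qed.

Lemma L_bound a : all odd a -> wbound (sumn a) (L a).
Proof.
move=> oa w wa; rewrite co_L // /coarser; case: eqP => //= e.
by rewrite e ltnn in wa.
Qed.

Lemma L_self a : all odd a -> co (L a) a = 2 ^+ size a.
Proof. by move=> oa; rewrite co_L // coarser_refl all_odd_nz. Qed.

Lemma L_rle a v : all odd a -> all odd v -> co (L a) v != 0 -> rle v a.
Proof.
move=> oa ov; rewrite co_L //; case: ifP => [|_]; last by rewrite eqxx.
move=> /coarser_nz; rewrite !all_odd_nz // /rle => -[le eq] _.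
case: ltngtP le => //= sva _.
by have := eq sva; rewrite !strip_comp ?odd_is_comp // => ->; apply: lle_refl.
Qed.

Lemma zspanP (A : zmodType) (G : set A) : zmod_closed [in zspan G].
Proof.
split=> [|f g]; rewrite !inE.
  by exists [::]; split=> //; rewrite big_nil.
move=> [s [sG ->]] [t [tG ->]]; exists (s ++ [seq (- p.1, p.2) | p <- t]); split.
  by move=> p; rewrite mem_cat => /orP[/sG//|/mapP[r /tG rG ->]].
rewrite big_cat big_map; congr (_ + _); rewrite -sumrN.
by apply: eq_bigr => p _; rewrite mulrNz.
Qed.

Lemma zspan_gen (A : zmodType) (G : set A) f : G f -> zspan G f.
Proof.
by move=> Gf; exists [:: (1, f)]; rewrite big_seq1; split=> // p; rewrite inE => /eqP ->.
Qed.

Lemma zspan_sum (A : zmodType) (G : set A) I (s : seq I) (P : pred I) (f : I -> A) (z : I -> int) :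
  (forall i, P i -> zspan G (f i)) -> zspan G (\sum_(i <- s | P i) f i *~ z i).
Proof.
move=> H; pose V := [in zspan G].
have [V0 VB] := zspanP G.
have VN x : V x -> V (- x) by move=> Vx; rewrite -[- x]add0r; apply: VB.
have VD x y : V x -> V y -> V (x + y).
  by move=> Vx Vy; rewrite -[y]opprK; apply: VB => //; apply: VN.
suff : V (\sum_(i <- s | P i) f i *~ z i) by rewrite /V inE.
apply: (big_ind V) => // i /H Hi.
have Vi : V (f i) by rewrite /V inE.
have Vn n : V (f i *+ n) by elim: n => [|n IH]; rewrite ?mulr0n // mulrS; apply: VD.
by case: (z i) => n; rewrite ?NegzE ?mulrNz -?pmulrn //; apply: VN.
Qed.

(** The [K] satisfy the invariants; conversely, the [L] span all series satisfying them, by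
    triangularity, and are integral combinations of the [K]. *)
Lemma PQSymE : PQSym = [set` pqsymZ].
Proof.
apply/seteqP; split=> f /=.
  move=> [s [sG ->]]; rewrite big_seq; apply: rpred_sum => p /sG Gp; apply: rpredMz.
  by case: Gp => [->|[n [P [n0 PP ->]]]]; [exact: rpred1|exact: K_pqsymZ].
move=> fZ; have [s [so ->]] := pqsymZ_span L_pqsymZ L_bound L_self L_rle fZ.
rewrite big_seq; apply: zspan_sum => p /so oa.
case: (posnP (size p.2)) => [/size0nil ->|a0].
  by rewrite L_nil; apply: zspan_gen; left.
have sa : (0 < sumn p.2)%N := leq_trans a0 (all_odd_size oa).
rewrite theta_M ?odd_is_comp //; rewrite big_seq; apply: zspan_sum => b.
rewrite mem_filter mem_bseqs => /andP[_ /eqP sb]; apply: zspan_gen; right.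
exists (sumn p.2), (peaks (bcomp 0 b)); split=> //.
by have := peaks_peak_subset (bcomp_is_comp 0 b); rewrite sumn_bcomp sb prednK.
Qed.

(** * The elements q_n(a) *)

Section ConvRing.
Variable A : comNzRingType.
Implicit Types e f g b : nat -> A.

Definition conv e f n : A := \sum_(i < n.+1) e i * f (n - i)%N.

Lemma convC e f : conv e f =1 conv f e.
Proof.
move=> n; rewrite /conv (reindex_inj rev_ord_inj) /=; apply: eq_bigr => i _.
by rewrite subSS subKn 1?mulrC // -ltnS.
Qed.

Lemma convA e f g n : conv e (conv f g) n = conv (conv e f) g n.
Proof.
rewrite /conv; under [RHS]eq_bigr => s _ do rewrite mulr_suml.
rewrite (big_triangleA n (fun i j k => e i * f j * g k)); apply: eq_bigr => i _.
by rewrite mulr_sumr; apply: eq_bigr => j _; rewrite mulrA.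
Qed.

Lemma eq_conv e e' f f' n : (forall i, (i <= n)%N -> e i = e' i) ->
  (forall i, (i <= n)%N -> f i = f' i) -> conv e f n = conv e' f' n.
Proof.
move=> ee ff; apply: eq_bigr => i _; rewrite ee ?ff ?leq_subr //.
by rewrite -ltnS.
Qed.

(* [e] is the sequence of coefficients of [exp (\sum_(k > 0) (b k / k) t ^ k)]. *)
Definition is_exp b e : Prop := e 0%N = 1 /\ forall n, n%:R * e n = conv b e n.

Lemma is_exp_conv b e b' e' : is_exp b e -> is_exp b' e' ->
  is_exp (fun k => b k + b' k) (conv e e').
Proof.
move=> [e0 He] [e0' He']; split; first by rewrite /conv big_ord1 e0 e0' mulr1.
move=> n; pose d (h : nat -> A) k := k%:R * h k.
have -> : n%:R * conv e e' n = conv (d e) e' n + conv e (d e') n.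
  rewrite /conv -big_split mulr_sumr; apply: eq_bigr => i _ /=.
  rewrite /d -{1}(subnKC (leq_ord i)) natrD; ring.
have -> : conv (fun k => b k + b' k) (conv e e') n =
    conv b (conv e e') n + conv b' (conv e e') n.
  by rewrite /conv -big_split; apply: eq_bigr => i _; rewrite mulrDl.
congr (_ + _).
  by rewrite convA; apply: eq_conv => // i _; apply: He.
rewrite (eq_conv (e := b') (e' := b') (f' := conv e' e)) // => [|i _]; last exact: convC.
by rewrite convA convC; apply: eq_conv => // i _; apply: He'.
Qed.

Lemma is_exp0 : is_exp (fun=> 0) (fun n => (n == 0%N)%:R).
Proof.
split=> // n; rewrite /conv big1 => [|i _]; last by rewrite mul0r.
by case: eqP => [->|]; rewrite ?mul0r ?mulr0.
Qed.

Lemma eq_is_exp b b' e : b =1 b' -> is_exp b e -> is_exp b' e.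
Proof. by move=> /funext ->. Qed.

End ConvRing.

Section ExpCoef.
Variable A : comAlgType rat.
Implicit Types a b e : nat -> A.

Lemma natmul_inj n (x y : A) : (0 < n)%N -> n%:R * x = n%:R * y -> x = y.
Proof.
move=> n0; have E z : n%:R * z = (n%:R : rat) *: z :> A.
  by rewrite -mulr_algl scaler_nat.
rewrite !E => /(congr1 (fun z => (n%:R : rat)^-1 *: z)).
by rewrite !scalerA mulVf ?scale1r // pnatr_eq0 -lt0n.
Qed.

(** The equation z E' = B E determines each term from the earlier ones after a division by [n].
    Sequences are identified below by showing that they solve the same equation. *)
Lemma is_exp_uniq b e e' : b 0%N = 0 -> is_exp b e -> is_exp b e' -> e =1 e'.
Proof.
move=> b0 [e0 He] [e0' He'] n.
elim/ltn_ind: n => -[|n] IH; first by rewrite e0 e0'.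
apply: (@natmul_inj n.+1) => //; rewrite He He' /conv big_ord_recl [RHS]big_ord_recl b0 !mul0r !add0r.
by apply: eq_bigr => i _; rewrite IH // lift0 subSS ltnS leq_subr.
Qed.

Definition log_poly a N : {poly A} := \poly_(k < N.+1) (if (k == 0)%N then 0 else a k).

Definition exp_poly a N : {poly A} :=
  \sum_(j < N.+1) (j`!%:R^-1 : rat)%:A *: log_poly a N ^+ j.

Lemma coef_expr_low (p : {poly A}) j n : p`_0 = 0 -> (n < j)%N -> (p ^+ j)`_n = 0.
Proof.
move=> p0; elim: j n => // j IH n nj; rewrite exprS coefM big1 // => -[[|i] ilt] _ /=.
  by rewrite p0 mul0r.
by rewrite IH ?mulr0 //; lia.
Qed.

Lemma coef_expr_eq (p p' : {poly A}) j n : (forall i, (i <= n)%N -> p`_i = p'`_i) ->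
  (p ^+ j)`_n = (p' ^+ j)`_n.
Proof.
elim: j n => [|j IH] n pp //; rewrite !exprS !coefM; apply: eq_bigr => i _.
have le := leq_ord i; rewrite pp // IH // => k kn; apply: pp.
by apply: leq_trans kn (leq_subr _ _).
Qed.

Lemma log_poly0 a N : (log_poly a N)`_0 = 0.
Proof. by rewrite coef_poly. Qed.

Lemma exp_coefE a n N : (n <= N)%N -> exp_coef a n = (exp_poly a N)`_n.
Proof.
move=> nN; rewrite /exp_coef /exp_poly coef_sum.
rewrite (big_ord_widen N.+1 (fun j => (j`!%:R^-1 : rat) *: ((\poly_(k < n.+1) (if (k == 0)%N then 0 else a k)) ^+ j)`_n)) // big_mkcond /=.
apply: eq_bigr => j _; rewrite coefZ mulr_algl; case: ifP => jn.
  congr (_ *: _); apply: coef_expr_eq => i i_n.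
  by rewrite !coef_poly !ltnS i_n (leq_trans i_n nN).
by rewrite coef_expr_low ?scaler0 ?log_poly0 //; lia.
Qed.

(** The derivative of the truncated exponential of p is p' times the same sum without its last term,
    a multiple of p^(n+1). As p has no constant term, that term does not reach degree [n]. *)
Lemma exp_coef_is_exp a : is_exp (fun k => k%:R * a k) (exp_coef a).
Proof.
have e0 : exp_coef a 0 = 1.
  by rewrite /exp_coef big_ord1 expr0 coef1 eqxx fact0 invr1 scale1r.
split=> // -[|n]; first by rewrite /conv big_ord1 !mul0r.
rewrite /conv big_ord_recl !mul0r add0r.
pose p := log_poly a n.+1.
have dE : (exp_poly a n.+1)^`() =
    p^`() * (exp_poly a n.+1 - ((n.+1)`!%:R^-1 : rat)%:A *: p ^+ n.+1).
  rewrite /exp_poly [X in (X)^`()]big_ord_recl [in RHS]big_ord_recr /= addrK.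
  rewrite derivD expr0 derivZ derivC scaler0 add0r (big_morph _ (@derivD A) (deriv0 A)) mulr_sumr.
  apply: eq_bigr => j _; rewrite /bump add1n derivZ deriv_exp /= -/p -[RHS]scalerAr.
  rewrite -scaler_nat scalerA; congr (_ *: _).
  rewrite factS natrM invfM mulr_algl -(scaler_nat j.+1 (1 : A)) scalerA.
  by rewrite mulrAC mulVf ?mul1r // pnatr_eq0.
have := congr1 (fun q : {poly A} => q`_n) dE; rewrite coef_deriv -exp_coefE //.
rewrite mulr_natl => ->; rewrite mulrBr coefB [X in _ - X]coefM [X in _ - X]big1 ?subr0; last first.
  move=> i _; rewrite coefZ coef_expr_low ?mulr0 ?log_poly0 //.
  by rewrite ltnS leq_subr.
rewrite coefM; apply: eq_bigr => i _.
have il := ltn_ord i.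
rewrite lift0 subSS (@exp_coefE _ (n - i) n.+1); last exact: leqW (leq_subr _ _).
by rewrite coef_deriv coef_poly /= ltnS il mulr_natl.
Qed.

End ExpCoef.

(** * Products of the factors (1 + u t) / (1 - u t) *)

Section Alphabet.
Variable A : comNzRingType.
Implicit Types (u : A) (us : seq A).

(** The coefficients of (1 + u t) / (1 - u t) = 1 + 2 u t + 2 u^2 t^2 + ... Then [es] belongs to the
    product over an alphabet, and [odd_power_sum] to t times its logarithmic derivative. *)
Definition es1 u n : A := if n == 0%N then 1 else u ^+ n *+ 2.

Fixpoint es us : nat -> A :=
  if us is u :: us' then conv (es1 u) (es us') else fun n => (n == 0%N)%:R.

Definition odd_power_sum us k : A := if odd k then \sum_(u <- us) u ^+ k *+ 2 else 0.

Lemma sum_odd n : (\sum_(i < n) odd i = n./2)%N.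
Proof. by elim: n => [|n IH]; rewrite ?big_ord0 // big_ord_recr /= IH uphalf_half addnC. Qed.

Lemma es1_is_exp u : is_exp (odd_power_sum [:: u]) (es1 u).
Proof.
split=> // n; rewrite /conv /odd_power_sum big_ord_recr /= subnn.
under eq_bigr => i _.
  have -> : (if odd i then \sum_(u <- [:: u]) u ^+ i *+ 2 else 0) * es1 u (n - i)%N =
      (u ^+ n *+ 4) *+ odd i.
    rewrite big_seq1 /es1 subn_eq0 leqNgt ltn_ord; case: (odd i); last by rewrite mul0r.
    by rewrite mulr1n mulrnAl mulrnAr -mulrnA -exprD subnKC // ltnW.
  over.
rewrite sumrMnr sum_odd big_seq1 /es1 eqxx mulr1.
case: eqP => [->|_]; first by rewrite mul0r mulr0n add0r.
rewrite mulr_natl -!mulrnA.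
have -> : (if odd n then u ^+ n *+ 2 else 0) = u ^+ n *+ (2 * odd n).
  by case: odd; rewrite ?muln1 // muln0.
rewrite -mulrnDr; congr (_ *+ _); have := odd_double_half n; lia.
Qed.

Lemma es_is_exp us : is_exp (odd_power_sum us) (es us).
Proof.
elim: us => [|u us IH] /=.
  apply: (eq_is_exp _ (is_exp0 A)) => k.
  by rewrite /odd_power_sum big_nil if_same.
apply: (eq_is_exp _ (is_exp_conv (es1_is_exp u) IH)) => k.
by rewrite /odd_power_sum; case: odd; rewrite ?addr0 // big_seq1 big_cons.
Qed.

Definition eqXn N (p q : {poly A}) := forall n, (n < N)%N -> p`_n = q`_n.

Lemma eqXnM N p q p' q' : eqXn N p q -> eqXn N p' q' -> eqXn N (p * p') (q * q').
Proof.
move=> pq pq' n nN; rewrite !coefM; apply: eq_bigr => i _.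
by rewrite pq ?pq' //; [exact: leq_ltn_trans (leq_subr _ _) nN|exact: leq_trans (ltn_ord i) nN].
Qed.

Lemma eqXn_trans N p q r : eqXn N p q -> eqXn N q r -> eqXn N p r.
Proof. by move=> pq qr n nN; rewrite pq ?qr. Qed.

Lemma eqXn_sym N p q : eqXn N p q -> eqXn N q p.
Proof. by move=> pq n nN; rewrite pq. Qed.

Lemma eqXn_prod N I (s : seq I) (p q : I -> {poly A}) :
  (forall i, eqXn N (p i) (q i)) -> eqXn N (\prod_(i <- s) p i) (\prod_(i <- s) q i).
Proof.
by move=> pq; elim: s => [|i s IH]; rewrite ?big_nil // !big_cons; apply: eqXnM.
Qed.

Definition espoly N us : {poly A} := \poly_(n < N) es us n.

Lemma espolyE N us : eqXn N (espoly N us) (\prod_(u <- us) \poly_(n < N) es1 u n).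
Proof.
elim: us => [|u us IH].
  by move=> n nN; rewrite coef_poly nN big_nil coef1.
rewrite big_cons; apply: eqXn_trans (eqXnM (fun _ _ => erefl) IH) => n nN.
rewrite coef_poly nN coefM; apply: eq_bigr => i _; rewrite !coef_poly.
by rewrite (leq_trans (ltn_ord i) nN) (leq_ltn_trans (leq_subr _ _) nN).
Qed.

Lemma es1_geometric N u : eqXn N (\poly_(n < N) es1 u n) ((1 + u%:P * 'X) * \poly_(k < N) u ^+ k).
Proof.
move=> n nN; rewrite mulrDl mul1r coefD -mulrA coefCM coefXM !coef_poly nN.
case: n nN => [|n] nN /=; first by rewrite mulr0 addr0 expr0.
by rewrite (ltn_trans (ltnSn n) nN) -exprS.
Qed.

Lemma es1_linear N u : eqXn N ((\poly_(n < N) es1 u n) * (1 - u%:P * 'X)) (1 + u%:P * 'X).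
Proof.
move=> n nN; rewrite mulrBr mulr1 coefB mulrCA coefCM coefMX coefD coef1 coefCM coefX !coef_poly nN.
case: n nN => [|n] nN /=; first by rewrite !mulr0 subr0 addr0.
rewrite (ltn_trans (ltnSn n) nN) /es1 /= add0r; case: n nN => [|n] _ /=.
  by rewrite !mulr1 expr1 mulr2n addrK.
by rewrite mulr0 mulrnAr [u ^+ n.+2]exprS subrr.
Qed.

Lemma espoly_linear N us :
  eqXn N (espoly N us * \prod_(u <- us) (1 - u%:P * 'X)) (\prod_(u <- us) (1 + u%:P * 'X)).
Proof.
apply: eqXn_trans (eqXnM (@espolyE N us) (fun _ _ => erefl)) _.
by rewrite -big_split; apply: eqXn_prod => u; apply: es1_linear.
Qed.

Lemma es_geometric us n : es us n =
  (\prod_(u <- us) ((1 + u%:P * 'X) * \poly_(k < n.+1) u ^+ k))`_n.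
Proof.
have := @espolyE n.+1 us n (ltnSn n); rewrite coef_poly ltnSn => ->.
by apply: (@eqXn_prod n.+1) => // u; apply: es1_geometric.
Qed.

End Alphabet.

(** * Restriction to finitely many variables *)

Definition delta (m : mono) : QX := FPS (fun m' => (m' == m)%:R).

Lemma deltaM m m' : delta m * delta m' = delta (mmul m m').
Proof.
apply: fpsP => m0; rewrite /= /cauchy_coef /=; case: eqP => [->|m0m].
  transitivity (\sum_(p \in [set (m, m')]) ((p.1 == m)%:R * (p.2 == m')%:R : rat)).
    apply/esym/fsbig_widen => [_ ->|[a b]] //=.
    case=> _ /= ne; case: eqP => [am|_]; last by rewrite mul0r.
    by case: eqP => [bm|_]; rewrite ?mulr0 //; case: ne; rewrite am bm.
  by rewrite fsbig_set1 /= !eqxx mulr1.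
apply: fsbig1 => -[a b] /= ab; case: eqP => [am|_]; last by rewrite mul0r.
by case: eqP => [bm|_]; rewrite ?mulr0 //; case: m0m; rewrite -ab am bm.
Qed.

Lemma delta1 : delta mone = 1. Proof. by []. Qed.

Definition Xw (w : seq nat) : QX := delta (wmono w).

Lemma co_Xw v w : size v = size w -> co (Xw v) w = (w == v)%:R.
Proof.
move=> vw; rewrite /co /=; congr (_%:R); congr nat_of_bool.
by apply/eqP/eqP => [|->//]; apply: wmono_inj.
Qed.

Lemma Xw_expr v k : Xw v ^+ k = Xw (scale_comp k v).
Proof.
elim: k => [|k IH].
  rewrite expr0 -delta1; congr delta; apply/eqP/cmP => i; rewrite cm1 wmonoE.
  case: (ltnP i (size v)) => iv; first by rewrite (nth_map 0%N).
  by rewrite nth_default ?size_map.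
rewrite exprS IH deltaM; congr delta; apply/eqP/cmP => i; rewrite cmM !wmonoE.
case: (ltnP i (size v)) => iv; first by rewrite !(nth_map 0%N) // mulSn.
by rewrite !nth_default ?size_map.
Qed.

Section Res.
Variable N : nat.

Definition res (f : QX) : QX :=
  FPS (fun m : mono => if all (fun i => (i < N)%N) (finsupp m) then fcoef f m else 0).

Lemma co_res f w : co (res f) w = if all (pred1 0%N) (drop N w) then co f w else 0.
Proof.
rewrite /co /=; congr (if _ then _ else _); apply/allP/(all_nthP 0%N) => H i.
  rewrite size_drop nth_drop => iw /=; apply/negPn/negP => wi.
  have : (N + i)%N \in finsupp (wmono w) by rewrite -cmE_neq0 wmonoE.
  by move/H; rewrite ltnNge leq_addr.
rewrite -cmE_neq0 wmonoE => wi; rewrite ltnNge; apply/negP => Ni.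
have iw : (i < size w)%N by rewrite ltnNge; apply/negP => /(nth_default 0%N) e; rewrite e in wi.
have := H (i - N)%N; rewrite size_drop nth_drop subnKC // => /(_ _)/= wi0.
by rewrite wi0 // in wi; rewrite ltn_sub2r // (leq_ltn_trans Ni).
Qed.

Lemma resB f g : res (f - g) = res f - res g.
Proof. by apply: co_ext => w; rewrite coB !co_res coB; case: ifP; rewrite ?subr0. Qed.

Lemma resM f g : res (f * g) = res f * res g.
Proof.
apply: co_ext => w; rewrite co_res !coM.
transitivity (\sum_(p <- splits w)
    if all (pred1 0%N) (drop N w) then co f p.1 * co g p.2 else 0).
  by case: all; rewrite // big1.
rewrite big_seq [RHS]big_seq; apply: eq_bigr => -[d e] de; rewrite !co_res /=.
have -> : all (pred1 0%N) (drop N w) = all (pred1 0%N) (drop N d) && all (pred1 0%N) (drop N e).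
  elim: {f g} N w d e de => [|n IH] w d e.
    rewrite !drop0; elim: w d e => [|c w IH] d e; first by rewrite inE => /eqP[-> ->].
    rewrite splits_cons => /allpairsP[[i [d' e']] /= [ic de [-> ->]]] /=.
    have -> : (c == 0)%N = (i == 0)%N && (c - i == 0)%N.
      by move: ic; rewrite in_cons mem_iota; lia.
    by rewrite (IH _ _ de) andbACA.
  case: w => [|c w]; first by rewrite inE => /eqP[-> ->].
  by rewrite splits_cons => /allpairsP[[i [d' e']] /= [ic de [-> ->]]] /=; apply: IH.
by case: all; case: all; rewrite ?mul0r ?mulr0.
Qed.

Lemma res1 : res 1 = 1.
Proof.
apply: co_ext => w; rewrite co_res !co1; case: ifP => // H.
by rewrite -{1}(cat_take_drop N w) all_cat H andbF.
Qed.

Lemma res_zmod : zmod_morphism res. Proof. exact: resB. Qed.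
Lemma res_monoid : monoid_morphism res. Proof. by split; [exact: res1|exact: resM]. Qed.

HB.instance Definition _ := GRing.isZmodMorphism.Build QX QX res res_zmod.
HB.instance Definition _ := GRing.isMonoidMorphism.Build QX QX res res_monoid.

End Res.

Lemma res_inj f g : (forall N, res N f = res N g) -> f = g.
Proof.
move=> fg; apply: co_ext => w; have := congr1 (fun h => co h w) (fg (size w)).
by rewrite /= !co_res drop_size.
Qed.

Lemma co_ext_ge N (f g : QX) : (forall w, (N <= size w)%N -> co f w = co g w) -> f = g.
Proof.
move=> fg; apply: co_ext => w; rewrite -(co_cat_nseq0 f w N) -(co_cat_nseq0 g w N).
by apply: fg; rewrite size_cat size_nseq leq_addl.
Qed.

Lemma L_free_rat (s : seq (seq nat)) (c : seq nat -> rat) : uniq s -> all (all odd) s ->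
  \sum_(w <- s) c w *: L w = 0 -> forall w, w \in s -> c w = 0.
Proof. exact: (span_indep L_self L_rle). Qed.

Lemma scale_intr (V : lmodType rat) (z : int) (v : V) : v *~ z = z%:~R *: v.
Proof. by rewrite scaler_int. Qed.

Lemma L_free : seq_free (fun a : odd_composition => L (val a)).
Proof.
move=> s h us s0 t ts.
pose c w : rat := if insub w is Some a then (h (a : odd_composition))%:~R else 0.
have cE (a : odd_composition) : c (val a) = (h a)%:~R.
  by rewrite /c (insubT (fun w => all odd w) (valP a)) /=; congr (h _)%:~R; apply: val_inj.
have : c (val t) = 0.
  apply: (@L_free_rat (map val s)); rewrite ?map_inj_uniq ?map_f //; try exact: val_inj.
    by apply/allP => w /mapP[a _ ->]; apply: (valP a).
  rewrite big_map -[RHS]s0; apply: eq_bigr => a _.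
  by rewrite cE scale_intr.
by rewrite cE => /eqP; rewrite intr_eq0 => /eqP.
Qed.

Lemma all_odd_scale k a : odd k -> all odd a -> all odd (scale_comp k a).
Proof. by move=> ok; rewrite all_map; apply: sub_all => c /=; rewrite oddM ok. Qed.

Lemma scale_compA k d a : scale_comp k (scale_comp d a) = scale_comp (k * d) a.
Proof. by rewrite /scale_comp -map_comp; apply: eq_map => c /=; rewrite mulnA. Qed.

Lemma scale_comp1 a : scale_comp 1 a = a.
Proof. by rewrite /scale_comp (eq_map mul1n) map_id. Qed.

Lemma sumn_scale k a : sumn (scale_comp k a) = (k * sumn a)%N.
Proof. by elim: a => [|c a IH] /=; rewrite ?muln0 // IH mulnDr. Qed.

Lemma psums_scale k a : psums (scale_comp k a) = map (muln k) (psums a).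
Proof.
elim: a => [|c a IH] /=; rewrite ?muln0 // IH -!map_comp; congr (_ :: _).
by apply: eq_map => j /=; rewrite mulnDr.
Qed.

Lemma nz_scale k a : (0 < k)%N -> nz (scale_comp k a) = nz a.
Proof. by move=> k0; rewrite /nz count_map; apply: eq_count => c /=; rewrite muln_eq0; lia. Qed.

Lemma coarser_scale k v a : (0 < k)%N ->
  coarser (scale_comp k v) (scale_comp k a) = coarser v a.
Proof.
move=> k0; rewrite /coarser !sumn_scale !psums_scale eqn_pmul2l // all_map.
congr (_ && _); apply: eq_all => j /=; apply: mem_map => x y /eqP.
by rewrite eqn_pmul2l // => /eqP.
Qed.

Lemma psums_dvd k v : all (fun j => (k %| j)%N) (psums v) -> v = scale_comp k [seq (c %/ k)%N | c <- v].
Proof.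
elim: v => //= c v IH /andP[_]; rewrite all_map => H.
have kc : (k %| c)%N by have := allP H 0%N (psums0 v); rewrite /= addn0.
rewrite [(k * _)%N]mulnC divnK // -IH //; apply/allP => j /(allP H) /=.
by rewrite dvdn_addr.
Qed.

Lemma coarser_scaleP k v a : (0 < k)%N -> coarser v (scale_comp k a) ->
  exists2 u, v = scale_comp k u & coarser u a.
Proof.
move=> k0 C; have vE : v = scale_comp k [seq (c %/ k)%N | c <- v].
  apply: psums_dvd; case/andP: C => _; apply: sub_all => j.
  by rewrite psums_scale => /mapP[i _ ->]; rewrite dvdn_mulr.
by rewrite vE coarser_scale // in C; exists [seq (c %/ k)%N | c <- v].
Qed.

Lemma adamsE n a : all odd a -> a != [::] ->
  adams n (L a) = if odd n then L (scale_comp n a) else 0.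
Proof.
move=> oa a0; have [c cE] := lincomb1 QX (exist _ a oa : odd_composition).
rewrite /adams -(cE (fun t => L (val t))) linextE ?cE /= ?(negbTE a0) //.
exact: lincomb_inj L_free.
Qed.

Definition adams_odd (a : seq nat) (k : nat) : QX :=
  if odd k then L (scale_comp k a) else 0.

Lemma q_is_exp a : all odd a -> a != [::] -> is_exp (adams_odd a) (q^~ a).
Proof.
move=> oa a0; apply: (eq_is_exp _ (exp_coef_is_exp _)) => k.
rewrite adamsE // /adams_odd; case: (boolP (odd k)) => ok; last by rewrite scaler0 mulr0.
case: k ok => // k ok; rewrite -scalerAr mulr_natl -scaler_nat scalerA.
rewrite /= mulfVK ?pnatr_eq0 // -signr_odd.
by move: ok => /= /negbTE ->; rewrite expr0 scale1r.
Qed.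

(** The restriction of [L a] to [N] variables is twice the sum of this alphabet: of the coefficient
    2^(nz v), one factor 2 is reserved for [odd_power_sum], and the rest becomes a multiplicity. *)
Definition alph (N : nat) (a : seq nat) : seq QX :=
  flatten [seq nseq (2 ^ (nz v).-1) (Xw v) | v <- [seq v <- words N (sumn a) | coarser v a]].

Lemma sumn_gt0 a : all odd a -> a != [::] -> (0 < sumn a)%N.
Proof. by case: a => // c a /andP[oc _] _; rewrite /= addn_gt0; case: c oc. Qed.

Lemma nz_gt0 v : (0 < sumn v)%N -> (0 < nz v)%N.
Proof. by elim: v => //= c v IH; rewrite /nz /=; case: c. Qed.

Lemma sum_alph N a k : all odd a -> a != [::] ->
  \sum_(u <- alph N a) u ^+ k *+ 2 =
  \sum_(v <- [seq v <- words N (sumn a) | coarser v a]) Xw (scale_comp k v) *+ 2 ^ nz v.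
Proof.
move=> oa a0; rewrite /alph big_flatten big_map; apply: eq_big_seq => v.
rewrite mem_filter => /andP[/andP[/eqP va _] _].
rewrite big_nseq iter_addr_0 Xw_expr -mulrnA -expnS prednK //.
by rewrite nz_gt0 // -va sumn_gt0.
Qed.

Lemma co_sum_alph k a v0 : all odd a -> odd k ->
  \sum_(v <- [seq v <- words (size v0) (sumn a) | coarser v a])
    co (Xw (scale_comp k v) *+ 2 ^ nz v) v0 =
  if coarser v0 (scale_comp k a) then 2 ^+ nz v0 else 0.
Proof.
move=> oa ok; have k0 : (0 < k)%N by case: (k) ok.
case: ifP => [C|C].
  have [u uE ua] := coarser_scaleP k0 C.
  have su : size u = size v0 by rewrite uE size_map.
  rewrite (bigD1_seq u) ?filter_uniq ?words_uniq //=; last first.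
    rewrite mem_filter ua mem_words su eqxx /=; apply/allP => c cu.
    case/andP: ua => /eqP -> _; rewrite sumnE (big_rem c) //=; exact: leq_addr.
  rewrite coMn co_Xw; last by rewrite size_map.
  rewrite -uE eqxx [in RHS]uE nz_scale // natrX.
  rewrite big_seq_cond big1 ?addr0 // => v; rewrite mem_filter mem_words.
  move=> /andP[/andP[_ /andP[/eqP sv _]] vu]; rewrite coMn co_Xw; last by rewrite size_map.
  case: eqP => [e|_]; last by rewrite mul0rn.
  case/eqP: vu; rewrite uE in e; apply/esym; apply: (inj_map _ e) => x y /eqP.
  by rewrite eqn_pmul2l // => /eqP.
rewrite big_seq big1 // => v; rewrite mem_filter mem_words.
move=> /andP[va /andP[/eqP sv _]]; rewrite coMn co_Xw; last by rewrite size_map.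
case: eqP => [e|_]; last by rewrite mul0rn.
by rewrite e coarser_scale // va in C.
Qed.

(** A word coarser than [k a] is [k u] with [u] coarser than [a], and [u] has as many nonzero
    letters; hence the Adams operation raises every monomial of the alphabet to its k-th power. *)
Lemma res_L N k a : all odd a -> a != [::] -> odd k ->
  res N (L (scale_comp k a)) = \sum_(u <- alph N a) u ^+ k *+ 2.
Proof.
move=> oa a0 ok; have k0 : (0 < k)%N by case: (k) ok.
rewrite sum_alph //; apply: (@co_ext_ge N) => w Nw.
rewrite co_res -(cat_take_drop N w); set v0 := take N w; set t := drop N w.
have sv0 : size v0 = N by rewrite size_takel.
rewrite drop_size_cat // co_sum; case: ifP => [t0|t0]; last first.
  rewrite big_seq big1 // => v; rewrite mem_filter mem_words => /andP[_ /andP[/eqP sv _]].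
  rewrite coMn /co /=; case: eqP => [e|]; last by rewrite mul0rn.
  move/negP: t0; case; apply/(all_nthP 0%N) => i it /=.
  have := congr1 (fun m : mono => m (N + i)%N) e; rewrite !wmonoE nth_cat sv0.
  rewrite ltnNge leq_addr /= addKn => ->.
  by rewrite nth_default // size_map sv leq_addr.
have tE : t = nseq (size t) 0%N by apply/all_pred1P.
rewrite tE co_cat_nseq0 co_L ?all_odd_scale // -(co_sum_alph _ oa ok) sv0.
by apply: eq_bigr => v _; rewrite co_cat_nseq0.
Qed.

Lemma is_exp_rmorph (A B : comNzRingType) (f : {rmorphism A -> B}) b e :
  is_exp b e -> is_exp (f \o b) (f \o e).
Proof.
move=> [e0 He]; split=> [|n] /=; first by rewrite e0 rmorph1.
rewrite -(rmorph_nat f) -rmorphM He /conv rmorph_sum.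
by apply: eq_bigr => i _; rewrite rmorphM.
Qed.

Lemma res_q_scale N d n a : all odd a -> a != [::] -> odd d ->
  res N (q n (scale_comp d a)) = es [seq u ^+ d | u <- alph N a] n.
Proof.
move=> oa a0 od.
have ne : scale_comp d a != [::] by rewrite -size_eq0 size_map size_eq0.
have H := is_exp_rmorph (res N) (q_is_exp (all_odd_scale od oa) ne).
apply: (is_exp_uniq _ H); last first.
  apply: eq_is_exp (es_is_exp _) => k; rewrite /odd_power_sum /adams_odd /=.
  case: ifP => [ok|_]; last by rewrite rmorph0.
  rewrite scale_compA res_L ?oddM ?ok // big_map.
  by apply: eq_bigr => u _; rewrite -exprM mulnC.
by rewrite /= /adams_odd /= rmorph0.
Qed.

Lemma res_q N n a : all odd a -> a != [::] -> res N (q n a) = es (alph N a) n.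
Proof.
move=> oa a0; rewrite -{1}(scale_comp1 a) res_q_scale //.
by rewrite (eq_map (fun u => expr1 u)) map_id.
Qed.

Lemma q0 a : q 0 a = 1.
Proof. by rewrite /q /lambda_op; have [] := exp_coef_is_exp (fun k => ((-1) ^+ k.-1 / k%:R : rat) *: adams k (L a)). Qed.

(** The exponent contains only odd powers of t, so replacing t by -t inverts the generating series;
    the relation is a coefficient of the product of the two series. *)
Lemma q_relation a n : all odd a -> a != [::] -> (0 < n)%N ->
  \sum_(i < n.+1) (-1) ^+ i * q i a * q (n - i) a = 0.
Proof.
move=> oa a0 n0; have H := q_is_exp oa a0.
have H' : is_exp (fun k => - adams_odd a k) (fun i => (-1) ^+ i * q i a).
  case: H => e0 He; split=> [|m]; first by rewrite expr0 mul1r.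
  rewrite mulrCA He /conv mulr_sumr; apply: eq_bigr => i _.
  rewrite /adams_odd; case: ifP => oi; last by rewrite oppr0 !mul0r mulr0.
  rewrite -{1}(subnKC (leq_ord i)) exprD -[(-1) ^+ i]signr_odd oi expr1; ring.
have E : conv (fun i => (-1) ^+ i * q i a) (q^~ a) =1 (fun n => (n == 0%N)%:R).
  apply: (is_exp_uniq _ (is_exp_conv H' H)).
    by rewrite /adams_odd /= oppr0 addr0.
  by apply: eq_is_exp (is_exp0 _) => k; rewrite addNr.
by rewrite -[LHS]/(conv (fun i => (-1) ^+ i * q i a) (q^~ a) n) E; case: n n0 E.
Qed.

(** * Homogeneity and divisibility by powers of 2 *)

Definition homog N (f : QX) := forall w, co f w != 0 -> sumn w = N.

Lemma homogD N f g : homog N f -> homog N g -> homog N (f + g).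
Proof.
move=> hf hg w; rewrite coD; case: (eqVneq (co f w) 0) => [->|/hf //].
by rewrite add0r => /hg.
Qed.

Lemma homogZ N c f : homog N f -> homog N (c *: f).
Proof. by move=> hf w; rewrite coZ mulf_eq0 => /norP[_ /hf]. Qed.

Lemma homog0 N : homog N 0. Proof. by move=> w; rewrite co0 eqxx. Qed.

Lemma homog1 : homog 0 1.
Proof.
move=> w; rewrite co1; case w0: (all _ _); last by rewrite eqxx.
by move=> _; elim: w w0 => //= c w IH /andP[/eqP -> /IH].
Qed.

Lemma homog_sum N I (s : seq I) (P : pred I) F :
  (forall i, P i -> homog N (F i)) -> homog N (\sum_(i <- s | P i) F i).
Proof. by move=> H; apply: (big_ind (homog N)); [exact: homog0|exact: homogD|]. Qed.

Lemma homogM N N' f g : homog N f -> homog N' g -> homog (N + N') (f * g).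
Proof.
move=> hf hg w; rewrite coM => nz_sum.
have : has (fun p => co f p.1 * co g p.2 != 0) (splits w).
  apply: contraNT nz_sum => /hasPn H; rewrite big_seq big1 // => p /H.
  by rewrite negbK => /eqP.
case/hasP => -[d e] /splits_sumn -> /=.
by rewrite mulf_eq0 => /norP[/hf -> /hg ->].
Qed.

Lemma homogX N f n : homog N f -> homog (n * N) (f ^+ n).
Proof.
by move=> hf; elim: n => [|n IH]; [exact: homog1|rewrite exprS mulSn; exact: homogM].
Qed.

Lemma homog_wbound N f : homog N f -> wbound N f.
Proof. by move=> hf w wN; apply: contraTeq wN => /hf ->; rewrite ltnn. Qed.

Lemma L_homog a : all odd a -> homog (sumn a) (L a).
Proof.
move=> oa w; rewrite co_L //; case: ifP; last by rewrite eqxx.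
by case/andP => /eqP ->.
Qed.

Section ExpClosed.
Variable a : seq nat.
Hypotheses (oa : all odd a) (a0 : a != [::]).

Lemma q_rec n : q n.+1 a =
  (n.+1%:R^-1 : rat) *: \sum_(i < n.+1) adams_odd a i.+1 * q (n - i) a.
Proof.
have [_ /(_ n.+1)] := q_is_exp oa a0.
rewrite /conv big_ord_recl /adams_odd /= mul0r add0r mulr_natl -scaler_nat.
move=> /(congr1 (fun f => (n.+1%:R^-1 : rat) *: f)).
by rewrite scalerA mulVf ?pnatr_eq0 // scale1r => ->.
Qed.

Lemma q_homog n : homog (n * sumn a) (q n a).
Proof.
elim/ltn_ind: n => -[|n] IH; first by rewrite q0; exact: homog1.
rewrite q_rec; apply: homogZ; apply: homog_sum => i _.
rewrite /adams_odd; case: ifP => [oi|_]; last by rewrite mul0r; exact: homog0.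
have -> : (n.+1 * sumn a = i.+1 * sumn a + (n - i) * sumn a)%N.
  by rewrite -mulnDl; congr (_ * _)%N; have := ltn_ord i; lia.
apply: homogM; last by apply: IH; rewrite ltnS leq_subr.
by rewrite -sumn_scale; apply: L_homog; apply: all_odd_scale.
Qed.

Lemma q_pqsymQ n : q n a \in pqsymQ.
Proof.
elim/ltn_ind: n => -[|n] IH; first by rewrite q0 rpred1.
rewrite q_rec rpredZ // rpred_sum // => i _; rewrite rpredM //; last first.
  by apply: IH; rewrite ltnS leq_subr.
rewrite /adams_odd; case: ifP => [oi|_]; last by rewrite rpred0.
by apply/pqsymZ_Q/L_pqsymZ/all_odd_scale.
Qed.
End ExpClosed.

(** Integral series in the variables that occur in [v]. Their monomials have at most [nz v] nonzero
    letters, so that multiplication by 2^(nz v) leads into [pow2div]. *)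
Definition int_supp (v : seq nat) : {pred QX} := fun f =>
  `[< forall w, (exists z : int, co f w = z%:~R) /\
        (co f w != 0 -> forall i, nth 0%N w i != 0%N -> nth 0%N v i != 0%N) >].

Lemma int_suppP v f : reflect (forall w, (exists z : int, co f w = z%:~R) /\
        (co f w != 0 -> forall i, nth 0%N w i != 0%N -> nth 0%N v i != 0%N))
  (f \in int_supp v).
Proof. exact: asboolP. Qed.

Lemma splits_nth w d e i : (d, e) \in splits w ->
  nth 0%N w i = (nth 0%N d i + nth 0%N e i)%N.
Proof.
rewrite mem_splits => /and3P[/eqP sd /eqP se /allP H].
case: (ltnP i (size w)) => iw; first by apply/esym/eqP/H; rewrite mem_iota.
by rewrite !nth_default ?sd ?se.
Qed.

Lemma int_supp_subring v : subring_closed (int_supp v).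
Proof.
split.
- apply/int_suppP => w; rewrite co1; split; first by exists (all (pred1 0%N) w)%:R; case: all.
  case: allP => //= w0 _ i wi; case/eqP: (wi).
  case: (ltnP i (size w)) => iw; last by rewrite nth_default.
  exact/eqP/w0/mem_nth.
- move=> f g /int_suppP fv /int_suppP gv; apply/int_suppP => w.
  have [[z fw] fs] := fv w; have [[z' gw] gs] := gv w; rewrite coB; split.
    by exists (z - z'); rewrite fw gw intrB.
  case: (eqVneq (co f w) 0) => [->|/fs //]; rewrite sub0r oppr_eq0; exact: gs.
- move=> f g /int_suppP fv /int_suppP gv; apply/int_suppP => w; rewrite coM; split.
    rewrite big_seq; apply: (big_ind (fun x : rat => exists z : int, x = z%:~R)).
    + by exists 0.
    + by move=> x y [z ->] [z' ->]; exists (z + z'); rewrite intrD.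
    move=> [d e] _; have [[z ->] _] := fv d; have [[z' ->] _] := gv e.
    by exists (z * z'); rewrite intrM.
  move=> nz_sum i wi.
  have : has (fun p => co f p.1 * co g p.2 != 0) (splits w).
    apply: contraNT nz_sum => /hasPn H; rewrite big_seq big1 // => p /H.
    by rewrite negbK => /eqP.
  case/hasP => -[d e] de /=; rewrite mulf_eq0 => /norP[fd ge].
  move: wi; rewrite (splits_nth i de) addn_eq0 negb_and => /orP[di|ei].
    by have [_ /(_ fd)] := fv d; apply.
  by have [_ /(_ ge)] := gv e; apply.
Qed.

HB.instance Definition _ v := GRing.isSubringClosed.Build QX (int_supp v) (int_supp_subring v).

Lemma Xw_int_supp v : Xw v \in int_supp v.
Proof.
apply/int_suppP => w; rewrite /co /=; split; first by exists (wmono w == wmono v)%:R; case: eqP.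
case: (wmono w =P wmono v) => [e _ i|_]; last by rewrite eqxx.
by rewrite -!wmonoE e.
Qed.

Lemma int_supp_pow2div v f : f \in int_supp v -> pow2div (f *+ 2 ^ nz v).
Proof.
move=> /int_suppP fv w; have [[z fw] fs] := fv w; rewrite coMn.
case: (eqVneq (co f w) 0) => [->|/fs H]; first by exists 0; rewrite mul0r mul0rn.
have le : (nz w <= nz v)%N.
  rewrite -!size_strip !strip_pos !size_map; apply: uniq_leq_size.
    by rewrite filter_uniq ?iota_uniq.
  by move=> i; rewrite !mem_pos; apply: H.
exists (z * 2 ^+ (nz v - nz w)); rewrite intrM rmorphXn -mulrA -exprD subnK //.
by rewrite fw -[LHS]mulr_natr natrX.
Qed.

Definition pow2pred : {pred QX} := fun f => `[< pow2div f >].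

Lemma pow2pred_subring : subring_closed pow2pred.
Proof.
split; first exact/asboolP/pow2div1.
- by move=> f g /asboolP pf /asboolP pg; apply/asboolP/pow2div_sub.
- by move=> f g /asboolP pf /asboolP pg; apply/asboolP/pow2divM.
Qed.

HB.instance Definition _ := GRing.isSubringClosed.Build QX pow2pred pow2pred_subring.

(** Every squaring gains a factor 2: (1 + 2^(j+1) h)^2 = 1 + 2^(j+2) (h + 2^j h^2). *)
Lemma expr_pow2 (A : comNzRingType) (S : subringClosed A) (g : A) j : g \in S ->
  exists2 h, h \in S & (1 + g *+ 2) ^+ (2 ^ j) = 1 + h *+ 2 ^ j.+1.
Proof.
move=> gS; elim: j => [|j [h hS IH]]; first by exists g.
exists (h + h ^+ 2 *+ 2 ^ j); first by rewrite rpredD // rpredMn // rpredX.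
rewrite expnSr exprM IH sqrrD expr1n mul1r -addrA; congr (_ + _).
rewrite exprMn_n mulrnDl -!mulrnA -expnSr; congr (_ + _ *+ _).
by rewrite -expnM -expnD; congr (_ ^ _)%N; lia.
Qed.

(** The monomial of [v] occurs 2^(nz v - 1) times in the alphabet. Its factor 1 + 2 g is raised to
    this power, which is 1 + 2^(nz v) h by [expr_pow2], with [h] still in the variables of [v]. *)
Lemma es_pow2div N n a : all odd a -> a != [::] -> pow2div (es (alph N a) n).
Proof.
move=> oa a0; have := @espolyE _ n.+1 (alph N a) n (ltnSn n).
rewrite coef_poly ltnSn => ->; apply/asboolP.
suff : \prod_(u <- alph N a) \poly_(i < n.+1) es1 u i \is a polyOver pow2pred.
  by move/polyOverP; apply.
rewrite /alph big_flatten big_map big_seq; apply: rpred_prod => v.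
rewrite mem_filter => /andP[/andP[/eqP va _] _].
have nv : (0 < nz v)%N by rewrite nz_gt0 // -va sumn_gt0.
rewrite big_nseq -Monoid.iteropE.
pose g : {poly QX} := \poly_(i < n.+1) if i == 0%N then 0 else Xw v ^+ i.
have gv : g \is a polyOver (int_supp v).
  apply/polyOver_poly => i _; case: eqP => _; first exact: rpred0.
  exact/rpredX/Xw_int_supp.
have -> : \poly_(i < n.+1) es1 (Xw v) i = 1 + g *+ 2.
  apply/polyP => i; rewrite coefD coefMn coef1 !coef_poly /es1.
  case: i => [|i]; first by rewrite /= mul0rn addr0.
  by rewrite add0r; case: ifP; rewrite ?mul0rn.
rewrite -[iterop _ _ _ _]/((1 + g *+ 2) ^+ _).
have [h hv ->] := expr_pow2 (nz v).-1 gv; rewrite prednK //.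
rewrite rpredD ?rpred1 //; apply/polyOverP => i; rewrite coefMn.
by apply/asboolP/int_supp_pow2div; move/polyOverP: hv; apply.
Qed.

Lemma q_pqsymZ n a : all odd a -> a != [::] -> q n a \in pqsymZ.
Proof.
move=> oa a0; apply/pqsymZP; split; first exact: q_pqsymQ.
move=> w; have [z zE] := @es_pow2div (size w) n a oa a0 w.
by exists z; rewrite -zE -res_q // co_res drop_size.
Qed.

(** * Scaling by an odd integer *)

Section Norm.
Variables (A : comNzRingType) (d : nat).
Implicit Types (u : A) (us : seq A) (e : nat -> A).

(* The matrix of the multiplication by [z] on [A[z]], seen as a free module of
   rank [d + 1] over [A[z ^ (d + 1)]]. *)
Definition shiftmx : 'M[{poly A}]_d.+1 :=
  \matrix_(i, j) ((i == j.+1 :> nat)%:R + 'X *+ ((i == 0 :> nat) && (j == d :> nat))).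

Lemma shiftmx_row0 : delta_mx 0 0 *m shiftmx = 'X *: delta_mx 0 ord_max :> 'rV_d.+1.
Proof.
rewrite -rowE; apply/rowP => j; rewrite !mxE /= add0r.
by rewrite mulr_natr; congr (_ *+ _); rewrite -val_eqE.
Qed.

Lemma shiftmx_rowS (i : 'I_d.+1) (j : 'I_d.+1) : (i = j.+1 :> nat) ->
  delta_mx 0 i *m shiftmx = delta_mx 0 j :> 'rV_d.+1.
Proof.
move=> ij; rewrite -rowE; apply/rowP => k; rewrite !mxE ij /= mulr0n addr0 eqSS.
by rewrite -val_eqE eq_sym.
Qed.

Lemma shiftmx_rowX (i j : 'I_d.+1) k : (i = j + k :> nat)%N ->
  delta_mx 0 i *m shiftmx ^+ k = delta_mx 0 j :> 'rV_d.+1.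
Proof.
elim: k i => [|k IH] i ij; first by rewrite expr0 mulmx1; congr delta_mx; apply: val_inj; rewrite /= ij addn0.
have kd : (j + k < d.+1)%N by have := ltn_ord i; lia.
rewrite exprS -mulmxE mulmxA (@shiftmx_rowS i (Ordinal kd)) ?IH //.
by rewrite /= ij addnS.
Qed.

Lemma shiftmx_expd : shiftmx ^+ d.+1 = 'X%:M.
Proof.
apply/row_matrixP => i; rewrite !rowE mul_mx_scalar.
have id := leq_ord i.
have dE : d.+1 = (i + (1 + (d - i)))%N by lia.
rewrite [X in shiftmx ^+ X]dE exprD exprD expr1 -!mulmxE !mulmxA (@shiftmx_rowX i ord0 i) //.
rewrite shiftmx_row0 -scalemxAl (@shiftmx_rowX ord_max i) //.
by rewrite /= subnKC.
Qed.

Lemma det_shiftmx u : \det (1%:M - u%:P *: shiftmx) = 1 - (u ^+ d.+1)%:P * 'X.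
Proof.
(* Multiplication by [W] adds u^i times column [i] to the first column, for all [i > 0]. Of that
   column only the top entry 1 - u^(d+1) X remains, and its minor is unitriangular. *)
pose W : 'M[{poly A}]_d.+1 :=
  \matrix_(i, j) (if j == 0 :> nat then (u ^+ i)%:P else (i == j)%:R).
set B := 1%:M - _.
have W1 : \det W = 1.
  rewrite det_trig; last first.
    apply/is_trig_mxP => i j ij; rewrite mxE; have -> : (j == 0 :> nat) = false by lia.
    by rewrite -val_eqE ltn_eqF.
  apply: big1 => i _; rewrite mxE eqxx; case: eqP => // ->.
  by rewrite expr0.
have BW i j : (B *m W) i j =
    if j == 0 :> nat then (1 - (u ^+ d.+1)%:P * 'X) *+ (i == 0 :> nat) else B i j.
  case: ifP => [/eqP j0|j0]; last first.
    rewrite mxE (bigD1 j) //= [W j j]mxE j0 eqxx mulr1 big1 ?addr0 // => k kj.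
    by rewrite [W k j]mxE j0 (negbTE kj) mulr0.
  rewrite mxE; under eq_bigr => k _ do rewrite [W k j]mxE j0 eqxx /= !mxE mulrBl.
  rewrite sumrB (bigD1 i) //= eqxx mul1r big1 ?addr0 => [|k ki]; last first.
    by rewrite eq_sym (negbTE ki) mul0r.
  case: (eqVneq (i : nat) 0%N) => [i0|i0].
    rewrite (bigD1 ord_max) //= i0 !eqxx /= add0r big1 ?addr0 => [|k kd]; last first.
      rewrite -val_eqE /= in kd.
      by rewrite ?i0 /= add0r (negbTE kd) mulr0n mulr0 mul0r.
    rewrite expr0 exprS polyCM; ring.
  have ip : (i.-1 < d.+1)%N by have := ltn_ord i; lia.
  rewrite (bigD1 (Ordinal ip)) //= prednK ?lt0n // eqxx ?(negbTE i0) /= addr0 mulr1.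
  rewrite big1 ?addr0 => [|k ki]; last first.
    have -> : (i == k.+1 :> nat) = false.
      by apply: contraNF ki => /eqP ik; rewrite -val_eqE /= ik.
    by rewrite /= addr0 mulr0 mul0r.
  by rewrite -polyCM -exprS prednK ?lt0n // subrr.
rewrite -[LHS]mulr1 -[X in _ * X = _]W1 -det_mulmx (expand_det_col _ ord0) big_ord_recl BW /= mulr1n.
rewrite big1 ?addr0 => [|i _]; last by rewrite BW /= mulr0n mul0r.
rewrite /cofactor /= expr0 mul1r det_trig ?big1 ?mulr1 // => [i _|].
  rewrite mxE [in LHS]mxE BW /= !mxE eqxx /= /bump /= add1n.
  by rewrite (ltn_eqF (ltnSn _)) /= addr0 mulr0 subr0.
apply/is_trig_mxP => i j ij; rewrite mxE [LHS]mxE BW /= !mxE.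
rewrite (inj_eq lift_inj) /= /bump /= !add1n -val_eqE (ltn_eqF ij).
have -> : (i.+1 == j.+2) = false by lia.
by rewrite /= addr0 mulr0 subr0.
Qed.

Definition normmx J e : 'M[{poly A}]_d.+1 := \sum_(j < J) (e j)%:P *: shiftmx ^+ j.

(** The coefficient of X^n in the norm of the series of [e], where X = z^(d+1). The series may be
    truncated: since [shiftmx ^+ d.+1] is X, the terms from index (d+1)(n+1) on contribute multiples
    of X^(n+1) only. *)
Definition norm_coef n e : A := (\det (normmx (d.+1 * n.+1) e))`_n.

Lemma eqXn_sum N I (s : seq I) (P : pred I) (p q : I -> {poly A}) :
  (forall i, eqXn N (p i) (q i)) -> eqXn N (\sum_(i <- s | P i) p i) (\sum_(i <- s | P i) q i).
Proof. by move=> pq n nN; rewrite !coef_sum; apply: eq_bigr => i _; apply: pq. Qed.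

Lemma eqXn_det N m (B C : 'M[{poly A}]_m) : (forall i j, eqXn N (B i j) (C i j)) ->
  eqXn N (\det B) (\det C).
Proof.
move=> BC; apply: eqXn_sum => s; apply: eqXnM => //; apply: eqXn_prod => i; exact: BC.
Qed.

Lemma eqXn_cancel N (f g h : {poly A}) : h`_0 = 1 -> eqXn N (f * h) (g * h) -> eqXn N f g.
Proof.
move=> h0 fg n; elim/ltn_ind: n => n IH nN; have := fg n nN.
rewrite !coefM !big_ord_recr /= subnn h0 !mulr1.
rewrite (eq_bigr (fun i : 'I_n => g`_i * h`_(n - i))) => [/addrI //|i _].
by rewrite IH // (ltn_trans (ltn_ord i)).
Qed.

(** The norm is multiplicative and takes 1 - u z to 1 - u^(d+1) X and, as d + 1 is odd, 1 + u z to 1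
    + u^(d+1) X. Denominators are cleared before taking norms and cancelled at the end modulo
    X^(n+1). *)
Lemma norm_coef_es n us : ~~ odd d ->
  norm_coef n (es us) = es [seq u ^+ d.+1 | u <- us] n.
Proof.
move=> od; set J := (d.+1 * n.+1)%N.
pose D := \prod_(u <- us) (1 - u%:P * 'X : {poly A}).
pose U := \prod_(u <- us) (1 + u%:P * 'X : {poly A}).
(* Below degree [J] the truncated series times [D] agrees with [U]. The error is a multiple of z^J,
   which becomes X^(n+1) by the choice of [J]. *)
pose r := drop_poly J (espoly J us * D - U).
have pE : espoly J us * D = U + r * 'X^J.
  rewrite -[LHS](addrNK U) addrC; congr (_ + _).
  rewrite -[LHS](poly_take_drop J) -/r [X in X + _](_ : _ = 0) ?add0r //.
  apply/polyP => i; rewrite coef_take_poly coef0; case: ifP => // iJ.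
  by rewrite coefB (espoly_linear us iJ) subrr.
pose ev (p : {poly A}) := horner_mx shiftmx (map_poly polyC p).
have evM p q : ev (p * q) = ev p * ev q by rewrite /ev !rmorphM.
have evD p q : ev (p + q) = ev p + ev q by rewrite /ev !rmorphD.
have ev1 : ev 1 = 1 by rewrite /ev !rmorph1.
have evX k : ev 'X^k = shiftmx ^+ k by rewrite /ev map_polyXn rmorphXn /= horner_mx_X.
have evC c : ev c%:P = (c%:P)%:M by rewrite /ev map_polyC horner_mx_C.
have ev_prod (F : A -> {poly A}) s : ev (\prod_(u <- s) F u) = \prod_(u <- s) ev (F u).
  by rewrite (big_morph ev evM ev1).
have det_prod (F : A -> 'M[{poly A}]_d.+1) s :
    \det (\prod_(u <- s) F u) = \prod_(u <- s) \det (F u).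
  by rewrite (big_morph _ (@det_mulmx _ _) (@det1 _ _)).
have evU u : ev (1 + u%:P * 'X) = 1%:M - (- u)%:P *: shiftmx.
  by rewrite evD ev1 evM evC -['X]expr1 evX expr1 -mulmxE mul_scalar_mx polyCN scaleNr opprK.
have evD' u : ev (1 - u%:P * 'X) = 1%:M - u%:P *: shiftmx.
  by rewrite -mulNr -polyCN evU opprK.
have normE : normmx J (es us) = ev (espoly J us).
  rewrite /espoly poly_def (big_morph ev evD (_ : ev 0 = 0)); last by rewrite /ev !rmorph0.
  by apply: eq_bigr => j _; rewrite -mul_polyC evM evC evX -mulmxE mul_scalar_mx.
have := congr1 (fun p => \det (ev p)) pE; rewrite evM evD det_mulmx -normE.
rewrite /D /U !ev_prod !det_prod.
under eq_bigr => u _ do rewrite evD' det_shiftmx.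
rewrite evM evX exprM shiftmx_expd -rmorphXn /= -mulmxE mul_mx_scalar => E.
have od1 : odd d.+1 by [].
have uE (F : A -> {poly A}) : \prod_(u <- [seq u ^+ d.+1 | u <- us]) F u =
    \prod_(u <- us) F (u ^+ d.+1) by rewrite big_map.
have H : eqXn n.+1 (\det (normmx J (es us)) *
      \prod_(u <- [seq u ^+ d.+1 | u <- us]) (1 - u%:P * 'X))
    (\prod_(u <- [seq u ^+ d.+1 | u <- us]) (1 + u%:P * 'X)).
  rewrite !uE E.
  have -> : \prod_(u <- us) (1 + (u ^+ d.+1)%:P * 'X) =
      \det (\prod_(u <- us) (1%:M - (- u)%:P *: shiftmx)).
    rewrite det_prod; apply: eq_bigr => u _; rewrite det_shiftmx.
    by rewrite exprNn -signr_odd od1 expr1 mulN1r polyCN mulNr opprK.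
  under [X in \det (X + _)]eq_bigr => u _ do rewrite evU.
  apply: eqXn_det => i j k kn; rewrite mxE coefD.
  by rewrite [('X^(n.+1) *: ev r) i j]mxE coefXnM kn addr0.
have h0 : (\prod_(u <- [seq u ^+ d.+1 | u <- us]) (1 - u%:P * 'X))`_0 = 1.
  rewrite -horner_coef0 horner_prod big1 // => u _.
  by rewrite !hornerE ?mulr0 ?subr0.
have := eqXn_cancel h0 (eqXn_trans H (eqXn_sym (@espoly_linear _ _ _))).
move=> /(_ n (ltnSn n)); rewrite coef_poly ltnSn => <-.
by [].
Qed.

Lemma shiftmxX_over (S : subringClosed A) j i k : (shiftmx ^+ j) i k \is a polyOver S.
Proof.
elim: j i k => [|j IH] i k; first by rewrite expr0 mxE rpred_nat.
rewrite exprS mxE rpred_sum // => l _; rewrite rpredM // mxE.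
by rewrite rpredD ?rpred_nat // rpredMn // polyOverX.
Qed.

(** The determinant is an integral polynomial in finitely many [e k]. Closure under an arbitrary
    subring is the form of this fact that generation over Z uses. *)
Lemma norm_coef_over (S : subringClosed A) n e : (forall k, e k \in S) -> norm_coef n e \in S.
Proof.
move=> eS; suff /polyOverP : \det (normmx (d.+1 * n.+1) e) \is a polyOver S by apply.
rewrite /determinant rpred_sum // => s _; rewrite rpredM //.
  by rewrite rpredX // rpredN rpred1.
rewrite rpred_prod // => i _; rewrite summxE rpred_sum // => j _.
by rewrite mxE rpredM ?polyOverC ?shiftmxX_over.
Qed.

End Norm.

Lemma norm_coef_map (A B : comNzRingType) (f : {rmorphism A -> B}) d n e :
  f (norm_coef d n e) = norm_coef d n (f \o e).
Proof.
rewrite /norm_coef -coef_map -det_map_mx.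
suff -> : map_mx (map_poly f) (normmx d (d.+1 * n.+1) e) = normmx d (d.+1 * n.+1) (f \o e) by [].
rewrite /normmx raddf_sum; apply: eq_bigr => j _.
rewrite /= map_mxZ /= map_polyC rmorphXn /=; congr (_ *: _ ^+ _).
by apply/matrixP => i k; rewrite !mxE rmorphD !rmorphMn /= rmorph1 map_polyX.
Qed.

Lemma q_scale d n a : all odd a -> a != [::] -> ~~ odd d ->
  q n (scale_comp d.+1 a) = norm_coef d n (q^~ a).
Proof.
move=> oa a0 od; apply: res_inj => N.
rewrite res_q_scale // -norm_coef_es // norm_coef_map /=; congr norm_coef.
by apply: funext => k /=; rewrite res_q.
Qed.

(** * The symmetric functions q_n *)

Definition unit_word N i : seq nat := [seq (i == j : nat) | j <- iota 0 N].

Lemma sumn_eq1 v : sumn v = 1%N -> exists2 i, (i < size v)%N & v = unit_word (size v) i.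
Proof.
elim: v => //= c v IH; case: c => [|[|c]] //.
  rewrite add0n => /IH[i iv vE]; exists i.+1 => //; rewrite /unit_word /=; congr (_ :: _).
  by rewrite {1}vE (iotaDl 1 0) -map_comp; apply: eq_map => j /=; rewrite eqSS.
rewrite add1n => -[sv]; exists 0%N => //; rewrite /unit_word /=; congr (_ :: _).
rewrite (iotaDl 1 0) -map_comp; elim: v sv {IH} => //= c v IH; case: c => //= sv.
rewrite (iotaDl 1 0) -map_comp /=; congr (_ :: _).
by rewrite {1}IH.
Qed.

Lemma wmono_unit N i : (i < N)%N -> wmono (unit_word N i) = ucm i.
Proof.
move=> iN; apply/eqP/cmP => j; rewrite wmonoE ucmE.
case: (ltnP j N) => jN; first by rewrite (nth_map 0%N) ?size_iota // nth_iota.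
rewrite nth_default ?size_map ?size_iota //; case: eqP => // ij.
by rewrite ij ltnNge jN in iN.
Qed.

Lemma sumn_unit N i : (i < N)%N -> sumn (unit_word N i) = 1%N.
Proof.
move=> iN; rewrite sumnE big_map -val_enum_ord big_map big_enum /=.
rewrite (bigD1 (Ordinal iN)) //= eqxx big1 // => j.
by rewrite -val_eqE /= eq_sym => /negbTE ->.
Qed.

Lemma nz_unit N i : (i < N)%N -> nz (unit_word N i) = 1%N.
Proof.
move=> iN; rewrite -(sumn_unit iN) /nz sumnE big_map count_map -sum1_count big_mkcond.
by apply: eq_bigr => j _ /=; case: (i == j).
Qed.

Lemma coarser1_units N :
  perm_eq [seq v <- words N 1 | coarser v [:: 1%N]] [seq unit_word N i | i <- iota 0 N].
Proof.
apply: uniq_perm; first by rewrite filter_uniq ?words_uniq.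
  rewrite map_inj_in_uniq ?iota_uniq // => i j; rewrite !mem_iota /= => iN jN ij.
  have := congr1 (fun v => wmono v i) ij; rewrite !wmono_unit // !ucmE eqxx.
  by case: eqP.
move=> v; rewrite mem_filter mem_words /coarser /=; apply/idP/mapP.
  move=> /andP[/andP[/eqP/esym/sumn_eq1[i iv vE] _] /andP[/eqP sv _]].
  by exists i; rewrite -sv // mem_iota.
move=> [i]; rewrite mem_iota /= => iN ->; rewrite sumn_unit // eqxx /=.
rewrite size_map size_iota eqxx /=; apply/andP; split.
  by apply/allP => k /psums_le; rewrite sumn_unit // !inE; case: k => [|[]].
by apply/allP => c /mapP[j _ ->]; case: eqP.
Qed.

(** The alphabet of the composition (1) consists of the variables, each taken 2^0 times, so its
    series is the defining product of the q_n. *)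
Lemma qsymE n : qsym n = q n [:: 1%N].
Proof.
apply: fpsP => m; rewrite [LHS]/= -/(mono_size m); set N := mono_size m.
have -> : (\prod_(i < N) ((1 + (xvar i)%:P * 'X) * \poly_(k < n.+1) xvar i ^+ k))`_n =
    es [seq xvar i | i <- iota 0 N] n.
  by rewrite es_geometric big_map -val_enum_ord big_map big_enum /=.
have <- : res N (q n [:: 1%N]) = es [seq xvar i | i <- iota 0 N] n.
  rewrite res_q //; apply: (is_exp_uniq _ (es_is_exp _)); first by rewrite /odd_power_sum.
  apply: eq_is_exp (es_is_exp _) => k; rewrite /odd_power_sum; case: ifP => // ok.
  rewrite sum_alph // (perm_big _ (coarser1_units N)) !big_map.
  rewrite [LHS]big_seq [RHS]big_seq; apply: eq_bigr => i; rewrite mem_iota => /andP[_ iN].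
  by rewrite -Xw_expr /Xw wmono_unit // nz_unit.
have mE := mono_wordK (mono_sizeP (leqnn N)).
rewrite -mE -/(co _ _) -/(co _ _) co_res drop_oversize //.
by rewrite size_map size_iota.
Qed.

(** * Lyndon factorizations and shuffles *)

(** Smaller at a differing letter, not as a prefix; unlike the lexicographic order this survives
    arbitrary continuations of both words. *)
Fixpoint slt (u v : seq nat) : bool :=
  match u, v with
  | a :: u', b :: v' => (a < b)%N || (a == b) && slt u' v'
  | _, _ => false
  end.

Lemma slt_irr u : slt u u = false.
Proof. by elim: u => //= a u ->; rewrite ltnn eqxx. Qed.

Lemma slt_cat u v x y : slt u v -> slt (u ++ x) (v ++ y).
Proof. by elim: u v => [|a u IH] [|b v] //= /orP[->//|/andP[-> /IH ->]]; rewrite orbT. Qed.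

Lemma slt_llt u v : slt u v -> llt u v.
Proof.
elim: u v => [|a u IH] [|b v] //=; rewrite llt_cons.
by case/orP => [->//|/andP[-> /IH ->]]; rewrite orbT.
Qed.

Lemma llt_slt u v : llt u v -> slt u v \/ exists2 s, s != [::] & v = u ++ s.
Proof.
elim: u v => [|a u IH] [|b v] //=; first by move=> _; right; exists (b :: v).
rewrite llt_cons => /orP[ab|/andP[/eqP -> /IH[uv|[s s0 ->]]]].
- by left; rewrite ab.
- by left; rewrite eqxx uv orbT.
- by right; exists s.
Qed.

Lemma slt_lle u v w : slt u v -> lle v w -> slt u w.
Proof.
elim: u v w => [|a u IH] [|b v] [|c w] //=; rewrite lle_cons.
case/orP => [ab|/andP[/eqP -> uv]]; case/orP => [bc|/andP[/eqP <- vw]].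
- by rewrite (ltn_trans ab bc).
- by rewrite ab.
- by rewrite bc.
- by rewrite eqxx (IH _ _ uv vw) orbT.
Qed.

Lemma lle_cat u v : lle u (u ++ v).
Proof. by elim: u => //= a u IH; rewrite lle_cons eqxx IH orbT. Qed.

Lemma lle_cat2l s u v : lle (s ++ u) (s ++ v) = lle u v.
Proof. by elim: s => //= a s IH; rewrite lle_cons ltnn eqxx. Qed.

Lemma llt_irr u : llt u u = false. Proof. by rewrite llt_def eqxx. Qed.

Lemma llt_lle_trans u v w : llt u v -> lle v w -> llt u w. Proof. exact: lt_le_trans. Qed.
Lemma lltW u v : llt u v -> lle u v. Proof. exact: ltW. Qed.

Lemma lyndonP (l : seq nat) : reflect (l != [::] /\
    forall u v : seq nat, l = u ++ v -> u != [::] -> v != [::] -> llt l v) (lyndon l).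
Proof.
apply: (iffP andP) => -[l0 H]; split=> //.
  move=> u v luv u0 v0.
  have := allP H (size u); rewrite mem_iota luv drop_size_cat //; apply.
  rewrite size_cat; case: (u) u0 => // a u' _; case: (v) v0 => // b v' _ /=.
  by rewrite addnS /= ltnS leq_addr.
case: l l0 H => // x l _ H; apply/allP => i; rewrite mem_iota /= add1n ltnS => /andP[i0 il].
apply: (H (take i (x :: l)) (drop i (x :: l))); rewrite ?cat_take_drop // -size_eq0.
  by rewrite size_takel -?lt0n // ltnW.
by rewrite size_drop subn_eq0 -ltnNge.
Qed.

(** The suffix is shorter than [l], so [l] is not a prefix of it and a letter must decide the
    comparison. *)
Lemma lyndon_slt (l u v : seq nat) : lyndon l -> l = u ++ v -> u != [::] -> v != [::] -> slt l v.
Proof.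
move=> /lyndonP[_ H] luv u0 v0; case: (llt_slt (H u v luv u0 v0)) => // -[s _ vs].
have := congr1 size luv; rewrite vs !size_cat => e; exfalso.
by case: (u) u0 e => // a u' _ /=; lia.
Qed.

Lemma lyndon_neq0 (l : seq nat) : lyndon l -> l != [::]. Proof. by case/lyndonP. Qed.

Lemma eq_catr (T : Type) (u v : seq T) : v = u ++ v -> u = [::].
Proof.
move=> /(congr1 size); rewrite size_cat -{1}[size v]add0n => /addIn e.
by apply: size0nil.
Qed.

(** Shared by all products of Lyndon words that are at least [l]; it is all that the shuffle
    arguments have to know about the left-hand word [u]. *)
Definition suffix_ge (u l : seq nat) : Prop :=
  forall a s, u = a ++ s -> s != [::] -> lle l s.

Lemma suffix_ge_cons a u l : suffix_ge (a :: u) l -> suffix_ge u l.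
Proof. by move=> H b s us; apply: (H (a :: b)); rewrite us. Qed.

Lemma flatten_suffix_ge (ls : seq (seq nat)) l : all lyndon ls -> all (lle l) ls ->
  suffix_ge (flatten ls) l.
Proof.
elim: ls => [|x ls IH] /=; first by move=> _ _ [|? ?] [|? ?].
move=> /andP[lx lyn] /andP[xl lel] a s.
case: (leqP (size x) (size a)) => xa e s0.
  move/eqP: e; rewrite -(cat_take_drop (size x) a) -catA eqseq_cat; last by rewrite size_takel.
  by move=> /andP[_ /eqP e]; apply: IH e s0.
have xE : x = a ++ drop (size a) x.
  move/eqP: e; rewrite -{1}(cat_take_drop (size a) x) -catA eqseq_cat; last by rewrite size_takel // ltnW.
  by move=> /andP[/eqP ta _]; rewrite -[X in X ++ _]ta cat_take_drop.
have sE : s = drop (size a) x ++ flatten ls.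
  by move: e; rewrite {1}xE -catA => /eqP; rewrite eqseq_cat // eqxx => /eqP.
rewrite sE; apply: lle_trans (lle_cat _ _); apply: lle_trans xl _.
case: (eqVneq a [::]) => [a0|a0]; first by rewrite a0 drop0 lle_refl.
apply: lltW; have /lyndonP[_ H] := lx; apply: (H a) => //.
by rewrite -size_eq0 size_drop subn_eq0 -ltnNge.
Qed.

Definition lge (x y : seq nat) := lle y x.

Lemma lge_trans : transitive lge. Proof. by move=> y x z yx zy; apply: lle_trans zy yx. Qed.

(** The Chen-Fox-Lyndon factorization, with weakly decreasing factors. *)
Definition cfl (ls : seq (seq nat)) := sorted lge ls && all lyndon ls.

Lemma sorted_rcons_lge ls l : sorted lge (rcons ls l) = sorted lge ls && all (lle l) ls.
Proof.
by rewrite !(sorted_pairwise lge_trans) pairwise_rcons andbC.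
Qed.

Lemma cfl_rcons ls l : cfl (rcons ls l) = [&& cfl ls, lyndon l & all (lle l) ls].
Proof.
rewrite /cfl sorted_rcons_lge all_rcons.
by case: sorted; case: lyndon; case: all; rewrite ?andbF ?andbT.
Qed.

Lemma cfl_suffix_ge ls l : cfl (rcons ls l) -> suffix_ge (flatten (rcons ls l)) l.
Proof.
rewrite cfl_rcons => /and3P[/andP[_ H] lyn le]; apply: flatten_suffix_ge.
  by rewrite all_rcons lyn.
by rewrite all_rcons lle_refl.
Qed.

Lemma flatten_rcons_seq (T : Type) (ls : seq (seq T)) l : flatten (rcons ls l) = flatten ls ++ l.
Proof. by rewrite -cats1 flatten_cat /= cats0. Qed.

(** By [cfl_suffix_ge] the last factor is the least nonempty suffix of the word, hence determined by
    the word. *)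
Lemma cfl_uniq (ls ls' : seq (seq nat)) : cfl ls -> cfl ls' -> flatten ls = flatten ls' -> ls = ls'.
Proof.
elim/last_ind: ls ls' => [|ls l IH] ls'.
  case/lastP: ls' => // ls' l' _; rewrite cfl_rcons flatten_rcons_seq => /and3P[_ /lyndon_neq0].
  by case: l' => // b l' _ _; case: (flatten ls').
case/lastP: ls' => [|ls' l'].
  rewrite cfl_rcons flatten_rcons_seq => /and3P[_ /lyndon_neq0].
  by case: l => // b l _ _; case: (flatten ls).
move=> c c' e; have s := cfl_suffix_ge c; have s' := cfl_suffix_ge c'.
have := c; have := c'; rewrite !cfl_rcons => /and3P[d' lyn' _] /and3P[d lyn _].
have ll' : l = l'.
  apply: lle_anti.
    by apply: s; [rewrite e flatten_rcons_seq|exact: lyndon_neq0].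
  by apply: s'; [rewrite -e flatten_rcons_seq|exact: lyndon_neq0].
move: e; rewrite -ll' !flatten_rcons_seq => /eqP.
rewrite -(can_eq revK) !rev_cat eqseq_cat // eqxx (can_eq revK) => /eqP e.
by rewrite (IH _ d d' e).
Qed.

Lemma min_suffix (w : seq nat) : w != [::] -> exists a l, [/\ w = a ++ l, l != [::] & suffix_ge w l].
Proof.
elim: w => // c w IH _; case: (eqVneq w [::]) => [->|/IH[a [l [wal l0 H]]]].
  exists [::], [:: c]; split=> // -[|x a] s /=; first by move=> <- _; apply: lle_refl.
  by move=> [_]; case: a => [|? ?] //= <-.
case: (boolP (lle l (c :: w))) => le.
  exists (c :: a), l; split=> //; first by rewrite wal.
  move=> [|x b] s /=; first by move=> <-.
  by move=> [_ ws]; apply: H ws.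
exists [::], (c :: w); split=> //.
move=> [|x b] s /=; first by move=> <- _; apply: lle_refl.
move=> [_ ws] s0.
by apply: lle_trans (H _ _ ws s0); have := lle_total l (c :: w); rewrite (negbTE le).
Qed.

Lemma cfl_exists (w : seq nat) : exists2 ls, cfl ls & flatten ls = w.
Proof.
have [n] := ubnP (size w); elim: n w => // n IH w; rewrite ltnS => wn.
case: (eqVneq w [::]) => [->|w0]; first by exists [::].
have [a [l [wal l0 H]]] := min_suffix w0.
have an : (size a < n)%N.
  by apply: leq_trans wn; rewrite wal size_cat -[X in (X < _)%N]addn0 ltn_add2l; case: (l) l0.
have [ls cls fls] := IH a an.
exists (rcons ls l); last by rewrite flatten_rcons_seq fls.
have lyn : lyndon l.
  apply/lyndonP; split=> // u v luv u0 v0; rewrite llt_def; apply/andP; split.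
    by apply: contraNneq u0 => lv; move: luv; rewrite lv => /eq_catr ->.
  by apply: (H (a ++ u)) => //; rewrite wal luv catA.
rewrite cfl_rcons cls lyn /=; case/lastP: ls cls fls => // ls l' cls fls.
have := cls; rewrite cfl_rcons => /and3P[_ lyn' le'].
have l'0 := lyndon_neq0 lyn'.
suff ll' : lle l l'.
  by rewrite all_rcons ll'; apply: sub_all le' => x; apply: lle_trans.
have aE : a = flatten ls ++ l' by rewrite -fls flatten_rcons_seq.
have H1 : lle l (l' ++ l).
  apply: (H (flatten ls)); first by rewrite wal aE catA.
  by case: (l') l'0.
(* If [l' < l] without a differing letter, then [l = l' s]. Cancelling [l'] in [l <= l' l] gives
   [s <= l], and [l] is the least suffix, so [s = l] and [l'] would be empty. *)
case: (boolP (lle l l')) => //; rewrite -lltNle => /llt_slt[sl|[s s0 ls']].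
  by have /slt_llt := slt_cat l [::] sl; rewrite cats0 lltNle H1.
have : lle s l by move: H1; rewrite {1}ls' lle_cat2l.
have : lle l s by apply: (H (a ++ l')) => //; rewrite wal {1}ls' catA.
move=> /lle_anti h /h e; move: ls'; rewrite -e => /eq_catr l'e.
by rewrite l'e in l'0.
Qed.

(** * Shuffles and the greedy merge *)

Fixpoint unshuf (w : seq nat) : seq (seq nat * seq nat) :=
  if w is c :: w' then
    [seq (c :: p.1, p.2) | p <- unshuf w'] ++ [seq (p.1, c :: p.2) | p <- unshuf w']
  else [:: ([::], [::])].

Lemma mem_unshuf_cons c w u v : ((u, v) \in unshuf (c :: w)) =
  (if u is a :: u' then (a == c) && ((u', v) \in unshuf w) else false) ||
  (if v is b :: v' then (b == c) && ((u, v') \in unshuf w) else false).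
Proof.
rewrite /= mem_cat; congr (_ || _).
  apply/mapP/idP => [[[u' v'] H [-> ->]]|]; first by rewrite eqxx.
  by case: u => // a u' /andP[/eqP -> H]; exists (u', v).
apply/mapP/idP => [[[u' v'] H [-> ->]]|]; first by rewrite eqxx.
by case: v => // b v' /andP[/eqP -> H]; exists (u, v').
Qed.

Lemma count_unshuf_cons c w u v : count_mem (u, v) (unshuf (c :: w)) =
  ((if u is a :: u' then (a == c) * count_mem (u', v) (unshuf w) else 0) +
   (if v is b :: v' then (b == c) * count_mem (u, v') (unshuf w) else 0))%N.
Proof.
rewrite /= count_cat !count_map; congr (_ + _)%N.
  case: u => [|a u].
    by rewrite (eq_count (a2 := pred0)) ?count_pred0 // => -[x y] /=; apply/eqP => -[].
  case: (eqVneq a c) => [->|ac]; last first.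
    by rewrite (eq_count (a2 := pred0)) ?count_pred0 // => -[x y] /=; apply/eqP => -[/eqP]; rewrite eq_sym (negbTE ac).
  by rewrite mul1n; apply: eq_count => -[x y] /=; rewrite !xpair_eqE eqseq_cons eqxx.
case: v => [|b v].
  by rewrite (eq_count (a2 := pred0)) ?count_pred0 // => -[x y] /=; apply/eqP => -[].
case: (eqVneq b c) => [->|bc]; last first.
  by rewrite (eq_count (a2 := pred0)) ?count_pred0 // => -[x y] /=; apply/eqP => -[_ /eqP]; rewrite eq_sym (negbTE bc).
by rewrite mul1n; apply: eq_count => -[x y] /=; rewrite !xpair_eqE eqseq_cons eqxx.
Qed.

Lemma unshuf_size w u v : (u, v) \in unshuf w -> (size u + size v = size w)%N.
Proof.
elim: w u v => [|c w IH] u v; first by rewrite inE => /eqP[-> ->].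
rewrite mem_unshuf_cons => /orP[]; [case: u => // a u|case: v => // b v];
  by move=> /andP[_ /IH e]; rewrite /= -e ?addnS.
Qed.

Lemma unshuf_cat u v : (u, v) \in unshuf (u ++ v).
Proof.
elim: u => [|a u IH].
  by elim: v => // b v IH; rewrite mem_unshuf_cons eqxx IH.
by rewrite mem_unshuf_cons eqxx IH.
Qed.

Lemma count_unshuf_nil u w : count_mem (u, [::]) (unshuf w) = (w == u).
Proof.
elim: w u => [|c w IH] u; first by case: u.
rewrite count_unshuf_cons addn0; case: u => // a u.
by rewrite IH eqseq_cons [a == c]eq_sym; case: eqP => // _; case: eqP.
Qed.

Lemma count_nil_unshuf v w : count_mem ([::], v) (unshuf w) = (w == v).
Proof.
elim: w v => [|c w IH] v; first by case: v.
rewrite count_unshuf_cons add0n; case: v => // a v.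
by rewrite IH eqseq_cons [a == c]eq_sym; case: eqP => // _; case: eqP.
Qed.

(* The greedy merge, which takes the next letter from the larger word; it is the
   largest shuffle of the two words. *)
Fixpoint merge_rec n (u v : seq nat) : seq nat :=
  if n is n'.+1 then
    match u, v with
    | [::], _ => v
    | _, [::] => u
    | a :: u', b :: v' => if lle v u then a :: merge_rec n' u' v else b :: merge_rec n' u v'
    end
  else [::].

Definition gmerge u v := merge_rec (size u + size v) u v.

Lemma gmerge_nil v : gmerge [::] v = v.
Proof. by rewrite /gmerge; case: v. Qed.

Lemma gmergel a u v : lle v (a :: u) -> gmerge (a :: u) v = a :: gmerge u v.
Proof.
case: v => [_|b v le]; last by rewrite /gmerge [size (a :: u)]/= addSn /= le.
by rewrite /gmerge /= !addn0; case: u.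
Qed.

Lemma gmerger u b v : llt u (b :: v) -> gmerge u (b :: v) = b :: gmerge u v.
Proof.
rewrite lltNle; case: u => [_|a u le]; first by rewrite !gmerge_nil.
by rewrite /gmerge [size (b :: v)]/= addnS /= (negbTE le).
Qed.

Lemma gmergeC u v : gmerge u v = gmerge v u.
Proof.
have [n] := ubnP (size u + size v)%N; elim: n u v => // n IH u v; rewrite ltnS => le_n.
wlog vu : u v le_n / llt v u.
  move=> W; case: (eqVneq u v) => [->//|uv].
  case: (boolP (lle v u)) => vu; first by apply: W => //; rewrite llt_def eq_sym uv.
  by apply/esym/W; [rewrite addnC|rewrite lltNle].
case: u vu le_n => [|a u] vu le_n; first by rewrite lltNle lle_nil in vu.
by rewrite gmergel ?lltW // gmerger // IH.
Qed.

(** An exchange argument: it is better to put [p] before the smaller word, so that the larger one is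
    available at once. With a single letter for [p] this settles the case of [gmerge_max] in which a
    shuffle takes its first letter from the smaller word and both words start with that letter. *)
Lemma gmerge_shift p u v : lle v u -> lle (gmerge (p ++ u) v) (gmerge u (p ++ v)).
Proof.
have [n] := ubnP (size p + size u + size v)%N.
elim: n p u v => // n IH [|c p] u v; first by move=> _ _; apply: lle_refl.
rewrite ltnS /= => le_n vu.
case: (boolP (lle v (c :: p ++ u))) => vpu.
  rewrite gmergel //; case: (boolP (lle (c :: p ++ v) u)) => pvu; last first.
    rewrite gmerger ?lltNle // lle_cons eqxx orbC /=.
    by rewrite IH //; clear -le_n; lia.
  case: u pvu vu vpu le_n => // a u pvu vu vpu le_n; rewrite gmergel // lle_cons.
  move: pvu; rewrite lle_cons; case: ltngtP => //= ca pvu; subst c.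
  apply: (@lle_trans (gmerge (a :: u) (p ++ v))).
    by rewrite IH //; move: le_n => /=; clear; lia.
  apply: (IH [:: a] u (p ++ v)) => //.
  by move: le_n; rewrite /= size_cat; clear; lia.
case: v vu vpu le_n => [|b v] vu vpu le_n; first by rewrite lle_nil in vpu.
have puv : llt (c :: p ++ u) (b :: v) by rewrite lltNle.
rewrite gmerger //.
have pvu : lle (c :: p ++ b :: v) u.
  case: (boolP (lle _ _)) => //; rewrite -lltNle => upv.
  have := llt_lle_trans puv (lle_trans vu (lltW upv)).
  by rewrite -!cat_cons lltNle lle_cat2l vu.
case: u pvu vu vpu puv le_n => [|a u] pvu vu vpu puv le_n; first by [].
rewrite [X in lle _ X]gmergel // lle_cons; move: vu; rewrite lle_cons.
case: ltngtP => //= -> vu.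
have := IH (c :: rcons p a) u v; rewrite /= !cat_rcons; apply=> //.
by move: le_n; rewrite /= size_rcons; clear; lia.
Qed.

Lemma unshuf_gmerge u v : (u, v) \in unshuf (gmerge u v).
Proof.
have [n] := ubnP (size u + size v)%N; elim: n u v => // n IH u v; rewrite ltnS => le_n.
case: (boolP (lle v u)) => vu.
  case: u vu le_n => [|a u] vu le_n.
    by rewrite gmerge_nil; exact: (unshuf_cat [::]).
  by rewrite gmergel // mem_unshuf_cons eqxx IH.
case: v vu le_n => [|b v] vu le_n; first by rewrite lle_nil in vu.
rewrite gmerger ?lltNle // mem_unshuf_cons eqxx IH ?orbT //.
by move: le_n; rewrite /= addnS.
Qed.

Lemma gmerge_max w u v : (u, v) \in unshuf w -> lle w (gmerge u v).
Proof.
elim: w u v => [|c w IH] u v; first by rewrite lle_nil.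
have half (u' v' : seq nat) : (u', v') \in unshuf w -> lle (c :: w) (gmerge (c :: u') v').
  move=> H; case: (boolP (lle v' (c :: u'))) => vu.
    by rewrite gmergel // lle_cons eqxx IH ?orbT.
  case: v' vu H => [|b v'] vu H; first by rewrite lle_nil in vu.
  rewrite gmerger ?lltNle // lle_cons; move: vu; rewrite -lltNle llt_cons.
  case: ltngtP => //= bc vu; subst b.
  apply: lle_trans (IH _ _ H) _; rewrite gmergeC.
  rewrite [gmerge (c :: u') v']gmergeC.
  exact: (gmerge_shift [:: c] (lltW vu)).
rewrite mem_unshuf_cons => /orP[].
  by case: u => // a u /andP[/eqP -> H]; apply: half.
case: v => // b v /andP[/eqP -> H]; rewrite gmergeC; apply: half.
suff sym w' x y : (x, y) \in unshuf w' -> (y, x) \in unshuf w' by apply: sym.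
elim: w' x y => [|d w' IH'] x y; first by rewrite !inE => /eqP[-> ->].
rewrite !mem_unshuf_cons orbC => /orP[]; [case: y => // e y|case: x => // e x];
  by move=> /andP[-> /IH' ->]; rewrite ?orbT.
Qed.

(** Every remaining suffix of [u] is at least [l], so the greedy choice reads [u] to its end. *)
Lemma gmerge_suffix_ge u l : suffix_ge u l -> gmerge u l = u ++ l.
Proof.
elim: u => [|a u IH] ul; first by rewrite gmerge_nil.
by rewrite gmergel ?IH //; [exact: suffix_ge_cons ul|exact: (ul [::])].
Qed.

(** From the first letter at which [u'] exceeds [u], the remaining letters can be merged in any way.
    Consequently only the largest left-hand word can lead to the largest shuffle. *)
Lemma unshuf_mono w u v u' : (u, v) \in unshuf w -> size u = size u' -> llt u u' ->
  exists2 w', (u', v) \in unshuf w' & llt w w'.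
Proof.
elim: w u v u' => [|c w IH] u v u'.
  by rewrite inE => /eqP[-> ->] /esym/size0nil ->.
rewrite mem_unshuf_cons => /orP[].
  case: u => // a u /andP[/eqP -> H]; case: u' => // b u' [suu'].
  rewrite llt_cons => /orP[cb|/andP[/eqP <- uu']].
    exists (b :: u' ++ v); last by rewrite llt_cons cb.
    by rewrite mem_unshuf_cons eqxx unshuf_cat.
  have [w' H' ww'] := IH _ _ _ H suu' uu'.
  by exists (c :: w'); [rewrite mem_unshuf_cons eqxx H'|rewrite llt_cons eqxx ww' orbT].
case: v => // b v /andP[/eqP -> H] su uu'; have [w' H' ww'] := IH _ _ _ H su uu'.
exists (c :: w'); last by rewrite llt_cons eqxx ww' orbT.
by rewrite mem_unshuf_cons eqxx H' orbT.
Qed.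

(* A shuffle producing [u ++ l] that starts with the first letter of [l] must
   read the whole of [l] before anything in [u]. *)
Lemma count_unshuf_contiguous u l l1 l2 w : lyndon l -> suffix_ge u l -> u != [::] ->
  l = l1 ++ l2 -> l1 != [::] -> u ++ l = l1 ++ w ->
  count_mem (u, l2) (unshuf w) = (u ++ l == l ++ u).
Proof.
move=> lyn; have [n] := ubnP (size u); elim: n u l1 l2 w => // n IHn u l1 l2 w un ul u0.
elim: l2 l1 w => [|d l2 IHl] l1 w lE l10 uw.
  rewrite count_unshuf_nil uw lE cats0; congr nat_of_bool.
  by apply/eqP/eqP => [->|/eqP]; rewrite // eqseq_cat // eqxx => /eqP.
case: w uw => [|c w] uw.
  have := congr1 size uw; rewrite lE !size_cat /= => e; exfalso.
  by case: (u) u0 e => // x y _ /=; clear; lia.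
rewrite count_unshuf_cons.
(* No shuffle takes its next letter from [u]. Otherwise [u = l1 u2], and [gmerge_shift] turns what
   remains to be read into the greedy merge of [u2] with [l] deprived of its first letter. The
   induction hypothesis for [u2] then gives [u2 l = l u2], but [l] is smaller than [u2] at a
   differing letter. *)
have Z : (if u is a :: u' then (a == c) * count_mem (u', d :: l2) (unshuf w) else 0)%N = 0%N.
  clear IHl; case: u u0 un ul uw => // a u _ un ul uw; apply/eqP; rewrite muln_eq0.
  case: (a =P c) => //= ac; rewrite -leqn0 leqNgt -has_count has_pred1; apply/negP => uw'.
  have not_prefix (x y : seq nat) : y != [::] -> ~~ lle (x ++ y) x.
    by move=> y0; rewrite -[x in X in ~~ lle _ X]cats0 lle_cat2l -lltNle; case: (y) y0.
  have l_au : lle l (a :: u) by apply: (ul [::]).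
  have [u2 auE] : exists u2, a :: u = l1 ++ u2.
    case: (leqP (size l1) (size (a :: u))) => sz.
      exists (drop (size l1) (a :: u)); move/eqP: uw.
      rewrite -{1}(cat_take_drop (size l1) (a :: u)) -catA eqseq_cat ?size_takel //.
      by move=> /andP[/eqP e _]; rewrite -[X in X ++ _]e cat_take_drop.
    have l1E : l1 = (a :: u) ++ drop (size (a :: u)) l1.
      move/eqP: uw; rewrite -{1}(cat_take_drop (size (a :: u)) l1) -[(take _ _ ++ _) ++ _]catA.
      rewrite eqseq_cat ?size_takel ?(ltnW sz) // => /andP[/eqP e _].
      by rewrite [X in X ++ _]e cat_take_drop.
    move: l_au; rewrite lE l1E -catA (negbTE (not_prefix _ _ _)) //.
    by case: (drop _ _).
  have u20 : u2 != [::].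
    apply: contraTneq l_au => u20; rewrite auE u20 cats0 lE; exact: not_prefix.
  have : u2 ++ l = c :: w.
    by move: uw; rewrite auE -catA => /eqP; rewrite eqseq_cat // eqxx => /eqP.
  case: u2 u20 auE => // c' u3 _ auE [cc' wE]; subst c'.
  case: l1 l10 lE uw auE => // a' l1 _ lE uw [aa' uE].
  rewrite -aa' ac in lE uw; rewrite ac in l_au ul un.
  have le2 : lle (d :: l2) (c :: u3).
    by move: l_au; rewrite lE uE -!cat_cons lle_cat2l.
  have sl : slt l (c :: u3) by apply: slt_lle le2; apply: lyndon_slt lyn lE _ _.
  have ge2 : suffix_ge (c :: u3) l.
    by move=> x s e; apply: (ul (c :: l1 ++ x)); rewrite uE e /= catA.
  have w_le : lle w (gmerge (c :: u3) (l1 ++ d :: l2)).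
    by apply: lle_trans (gmerge_max uw') _; rewrite uE; apply: gmerge_shift.
  have g_le : lle (gmerge (c :: u3) (l1 ++ d :: l2)) w.
    have : (c :: u3, l) \in unshuf (c :: gmerge (c :: u3) (l1 ++ d :: l2)).
      by rewrite lE mem_unshuf_cons /= eqxx unshuf_gmerge orbT.
    by move=> /gmerge_max; rewrite [gmerge _ l]gmerge_suffix_ge // cat_cons wE lle_cons eqxx ltnn.
  have wg := lle_anti w_le g_le.
  have : count_mem (c :: u3, l1 ++ d :: l2) (unshuf w) = ((c :: u3) ++ l == l ++ c :: u3).
    apply: (IHn _ [:: c]) => //; last by rewrite /= wE.
    rewrite -ltnS; apply: leq_trans un; rewrite uE /= size_cat /=; clear; lia.
  have : (0 < count_mem (c :: u3, (l1 ++ d :: l2)%SEQ) (unshuf w))%N.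
    by rewrite -has_count has_pred1 wg unshuf_gmerge.
  case: eqP => [e|_ h1 h2]; last by rewrite h2 in h1.
  by have := slt_cat (c :: u3) l sl; rewrite -e slt_irr.
rewrite Z add0n; case: (eqVneq d c) => [dc|dc]; last first.
  rewrite mul0n; case: eqP => // ulu; move: uw; rewrite ulu {1}lE -catA => /eqP.
  by rewrite eqseq_cat // eqxx /= eqseq_cons (negbTE dc).
rewrite mul1n; apply: (IHl (rcons l1 d)); first by rewrite cat_rcons.
  by case: (l1).
by rewrite uw dc cat_rcons.
Qed.

(** Counts the nonempty suffixes of [u] that commute with [l]: just before such a suffix, [l] can be
    read as a whole without changing the resulting word [u l]. *)
Fixpoint ncomm (u l : seq nat) : nat :=
  if u is a :: u' then ((u ++ l == l ++ u) + ncomm u' l)%N else 0%N.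

Lemma count_unshuf_ncomm u l : lyndon l -> suffix_ge u l ->
  count_mem (u, l) (unshuf (u ++ l)) = (ncomm u l).+1.
Proof.
move=> lyn; elim: u => [|a u IH] ul; first by rewrite count_nil_unshuf eqxx.
rewrite cat_cons count_unshuf_cons eqxx mul1n IH; last exact: suffix_ge_cons ul.
rewrite addSn addnC; congr (_ + _).+1.
case: l lyn ul {IH} => [|b l] lyn ul; first by have := lyndon_neq0 lyn.
case: (eqVneq b a) => [ba|ba].
  rewrite mul1n; apply: (count_unshuf_contiguous (l1 := [:: b])) ul _ _ _ _ => //.
  by rewrite ba.
by rewrite mul0n /= eqseq_cons eq_sym (negbTE ba).
Qed.

(** No proper nonempty suffix of [l] commutes with [l], since [l] is smaller than it at a differing
    letter; so the suffix [l] itself is the only new one. The longer suffixes commute exactly if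
    they do so without the final [l]. *)
Lemma ncomm_cat u l : lyndon l -> ncomm (u ++ l) l = (ncomm u l).+1.
Proof.
move=> lyn; elim: u => [|a u IH] /=; last first.
  rewrite IH addnS -cat_cons -[l ++ a :: u ++ l]/(l ++ ((a :: u) ++ l)) [l ++ _ ++ _]catA.
  by rewrite -cat_cons -(can_eq revK) !rev_cat eqseq_cat // eqxx /= -!rev_cat (can_eq revK).
suff H s : (exists2 t, t != [::] & l = t ++ s) -> ncomm s l = 0%N.
  case: l lyn H => [|b l] lyn H; first by have := lyndon_neq0 lyn.
  by rewrite /= eqxx H //; exists [:: b].
elim: s => // c s IH [t t0 lE] /=; rewrite IH ?addn0; last first.
  by exists (rcons t c); rewrite ?cat_rcons //; case: (t).
case: eqP => // e; have := lyndon_slt lyn lE t0 isT.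
by move=> /(slt_cat (c :: s) l); rewrite -e slt_irr.
Qed.

(** A nonempty suffix [s] with [s l = l s] is a proper prefix of [l] or starts with [l], and in the
    second case induction leaves [s = l]. Either way [y <= s <= l], against [l < y]. *)
Lemma ncomm_gt u l y : suffix_ge u y -> llt l y -> l != [::] -> ncomm u l = 0%N.
Proof.
move=> uy ly l0; suff H s : (exists t, u = t ++ s) -> s ++ l = l ++ s -> s = [::].
  elim: u uy H => // a u IH uy H /=; rewrite IH; last 1 first.
  - by move=> s [t ut]; apply: H; exists (a :: t); rewrite ut.
  - rewrite addn0; case: eqP => // e; by have := H (a :: u) (ex_intro _ [::] erefl) e.
  exact: suffix_ge_cons uy.
have [n] := ubnP (size s); elim: n s => // n IH s; rewrite ltnS => sn [t ut] e.
apply/eqP; apply: contraTT ly => s0; rewrite lltNle negbK.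
have ys := uy _ _ ut s0.
case: (leqP (size l) (size s)) => sz.
  have sE : s = l ++ drop (size l) s.
    move/eqP: e; rewrite -{1}(cat_take_drop (size l) s) -catA eqseq_cat ?size_takel //.
    by move=> /andP[/eqP e' _]; rewrite -[X in X ++ _]e' cat_take_drop.
  set s1 := drop _ _ in sE.
  have s1n : s1 = [::].
    apply: IH.
    - apply: leq_trans sn; rewrite sE size_cat; case: (l) l0 => // x y' _ /=; clear; lia.
    - by exists (t ++ l); rewrite ut {1}sE catA.
    - by move/eqP: e; rewrite sE -catA eqseq_cat // eqxx => /eqP.
  by move: ys; rewrite sE s1n cats0.
have lE : l = s ++ drop (size s) l.
  move/eqP: e; rewrite -{2}(cat_take_drop (size s) l) -[(take _ _ ++ _) ++ _]catA.
  rewrite eqseq_cat ?size_takel ?(ltnW sz) // => /andP[/eqP e' _].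
  by rewrite [X in X ++ _]e' cat_take_drop.
by apply: lle_trans ys _; rewrite lE lle_cat.
Qed.

(** Each final factor [l] adds one commuting suffix, by [ncomm_cat]; as soon as a larger factor
    comes last, none is left, by [ncomm_gt]. *)
Lemma ncomm_flatten ls l : cfl (rcons ls l) -> ncomm (flatten ls) l = count_mem l ls.
Proof.
elim/last_ind: ls => [|ls y IH] //; rewrite cfl_rcons => /and3P[cy lyn].
rewrite all_rcons => /andP[ly le]; have := cy; rewrite cfl_rcons => /and3P[cls lyny yle].
rewrite -cats1 count_cat /= addn0 flatten_cat /= cats0.
case: (eqVneq y l) => [yl|yl].
  rewrite yl ncomm_cat // IH ?addn1 //.
  by rewrite -yl.
rewrite addn0 (count_memPn _) ?(@ncomm_gt _ _ y) //.
- by have := cfl_suffix_ge cy; rewrite flatten_rcons_seq.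
- by rewrite llt_def eq_sym yl.
- exact: lyndon_neq0.
apply/negP => /(allP yle) yl'; case/eqP: yl; exact: lle_anti.
Qed.

Fixpoint shuffles_rec (ls : seq (seq nat)) (w : seq nat) : nat :=
  if ls is l :: ls' then
    (\sum_(p <- unshuf w | p.2 == l) shuffles_rec ls' p.1)%N
  else (w == [::]).

(* The number of ways to obtain [w] as a shuffle of the words in [ls]. *)
Definition shuffles ls w := shuffles_rec (rev ls) w.

Lemma shuffles_rcons ls l w :
  shuffles (rcons ls l) w = (\sum_(p <- unshuf w | p.2 == l) shuffles ls p.1)%N.
Proof. by rewrite /shuffles rev_rcons. Qed.

Lemma shuffles_size ls w : shuffles ls w != 0%N -> size w = size (flatten ls).
Proof.
elim/last_ind: ls w => [|ls l IH] w; first by rewrite /shuffles /=; case: (w =P [::]) => [->|].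
rewrite shuffles_rcons flatten_rcons_seq size_cat sum_nat_seq_neq0.
move=> /hasP[[u v] uv /= /andP[/eqP vl /IH <-]].
by rewrite -(unshuf_size uv) vl.
Qed.

Lemma shuffles_max ls w : cfl ls -> shuffles ls w != 0%N -> lle w (flatten ls).
Proof.
elim/last_ind: ls w => [|ls l IH] w; first by rewrite /shuffles /=; case: (w =P [::]) => [->|].
move=> c; have := c; rewrite cfl_rcons => /and3P[cls lyn le].
rewrite shuffles_rcons flatten_rcons_seq sum_nat_seq_neq0.
move=> /hasP[[u v] uv /= /andP[/eqP vl sh]]; subst v.
have ge : suffix_ge (flatten ls) l.
  by apply: flatten_suffix_ge => //; case/andP: cls.
have gE := gmerge_suffix_ge ge.
case: (eqVneq u (flatten ls)) => [uE|ne]; first by rewrite -gE -uE; apply: gmerge_max.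
have ult : llt u (flatten ls) by rewrite llt_def ne IH.
have [w' uv' ww'] := unshuf_mono uv (shuffles_size sh) ult.
by apply: lle_trans (lltW ww') _; rewrite -gE; apply: gmerge_max.
Qed.

(** A left-hand word below [flatten ls] only leads to words below the top one, by [unshuf_mono]. So
    one counts the ways to extract [l] from [flatten ls ++ l], which are one more than the earlier
    copies of [l]. *)
Lemma shuffles_flatten ls l : cfl (rcons ls l) ->
  shuffles (rcons ls l) (flatten (rcons ls l)) =
  (shuffles ls (flatten ls) * (count_mem l ls).+1)%N.
Proof.
move=> c; have := c; rewrite cfl_rcons => /and3P[cls lyn le].
have ge : suffix_ge (flatten ls) l.
  by apply: flatten_suffix_ge => //; case/andP: cls.
rewrite -(ncomm_flatten c) -(count_unshuf_ncomm lyn ge) shuffles_rcons flatten_rcons_seq.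
rewrite mulnC -sum1_count big_distrl /= [RHS]big_mkcond [LHS]big_mkcond /=.
rewrite big_seq [RHS]big_seq; apply: eq_bigr => -[u v] uv /=.
case: eqP => [vl|nvl]; last by case: eqP => // -[_ /nvl].
subst v; case: eqP => [[->]|ne]; first by rewrite mul1n.
apply/eqP/negPn/negP => sh.
have ult : llt u (flatten ls).
  by rewrite llt_def shuffles_max // andbT; apply: contra_notN ne => /eqP ->.
have [w' uv' ww'] := unshuf_mono uv (shuffles_size sh) ult.
have := gmerge_max uv'; rewrite (gmerge_suffix_ge ge) => w'le.
by have := llt_lle_trans ww' w'le; rewrite llt_irr.
Qed.

(** * Top coefficients *)

(** A filtration by the number of nonzero letters: [short a.+1] allows at most [a] of them, and
    [shortM] makes these bounds add up in products. *)
Definition short a (f : QX) := forall w, (a <= nz w)%N -> co f w = 0.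

Lemma shortM a b f g : short a.+1 f -> short b g -> short (a + b) (f * g).
Proof.
move=> sf sg w aw; rewrite coM big_seq big1 // => -[d e] /splits_nz /= le.
case: (ltnP a (nz d)) => ad; first by rewrite sf // mul0r.
by rewrite sg ?mulr0 //; lia.
Qed.

Lemma shortW a b f : (a <= b)%N -> short a f -> short b f.
Proof. by move=> ab sf w bw; apply: sf; apply: leq_trans ab bw. Qed.

Lemma shortD a f g : short a f -> short a g -> short a (f + g).
Proof. by move=> sf sg w aw; rewrite coD sf ?sg ?addr0. Qed.

Lemma shortZ a c f : short a f -> short a (c *: f).
Proof. by move=> sf w aw; rewrite coZ sf ?mulr0. Qed.

Lemma short_sum a I (s : seq I) (P : pred I) F : (forall i, P i -> short a (F i)) ->
  short a (\sum_(i <- s | P i) F i).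
Proof.
by move=> H; apply: (big_ind (short a)) => [w _|f g|i Pi]; [rewrite co0|exact: shortD|exact: H].
Qed.

Lemma short1 : short 1 1.
Proof.
move=> w w1; rewrite co1 (_ : all _ _ = false) //.
by elim: w w1 => //= c w IH; rewrite /nz /=; case: c.
Qed.

(** A letter divided between both sides would be counted twice among the nonzero letters, and such
    terms vanish. So every letter goes entirely to one side, and the zeros left on the other side
    are stripped. *)
Lemma big_splits_unshuf w (G : seq nat -> seq nat -> rat) : is_comp w ->
  (forall d e, G d e = G (strip d) (strip e)) ->
  (forall d e, (size w < nz d + nz e)%N -> G d e = 0) ->
  \sum_(p <- splits w) G p.1 p.2 = \sum_(p <- unshuf w) G p.1 p.2.
Proof.
elim: w G => [|c w IH] G; first by rewrite !big_seq1.
move=> /andP[c0 cw] Gs G0; rewrite big_splits_cons /= big_cat !big_map [RHS]addrC /=.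
case: c c0 Gs G0 => // c _ Gs G0.
have nzc k s : nz (k :: s) = ((k != 0) + nz s)%N by [].
rewrite big_ord_recl big_ord_recr /=.
rewrite [X in _ + (X + _)]big1 ?add0r; last first.
  move=> i _; rewrite big_seq big1 // => -[d e] /splits_nz /= le.
  have ic := ltn_ord i.
  have sw : nz w = size w by rewrite -size_strip strip_comp.
  have b0 : (bump 0 i != 0)%N by [].
  have cb : (c.+1 - bump 0 i != 0)%N by rewrite /bump /=; lia.
  by apply: G0; rewrite !nzc b0 cb /=; lia.
rewrite /bump /= add1n subnn; congr (_ + _).
  rewrite -(IH (fun d e => G d (c.+1 :: e))) //.
  - by apply: eq_bigr => p _; rewrite Gs [RHS]Gs.
  - move=> d e le; apply: G0; rewrite nzc /=; lia.
rewrite -(IH (fun d e => G (c.+1 :: d) e)) //.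
- by apply: eq_bigr => p _; rewrite Gs [RHS]Gs.
- move=> d e le; apply: G0; rewrite nzc /=; lia.
Qed.

Lemma co_mul_top f g a b w : f \in pqsymQ -> g \in pqsymQ ->
  short a.+1 f -> short b.+1 g -> is_comp w -> size w = (a + b)%N ->
  co (f * g) w = \sum_(p <- unshuf w) co f p.1 * co g p.2.
Proof.
move=> fQ gQ sf sg cw sw; rewrite coM.
apply: (big_splits_unshuf (G := fun d e => co f d * co g e)) => // d e.
  by rewrite !co_strip.
rewrite sw => le; case: (ltnP a (nz d)) => ad; first by rewrite sf ?mul0r.
by rewrite sg ?mulr0 //; lia.
Qed.

Lemma L_short a : all odd a -> short (size a).+1 (L a).
Proof.
move=> oa w aw; rewrite co_L //; case: ifP => // /coarser_nz[le _].
by move: le; rewrite (all_odd_nz oa) leqNgt aw.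
Qed.

Lemma unshuf_comp w u v : is_comp w -> (u, v) \in unshuf w -> is_comp u /\ is_comp v.
Proof.
elim: w u v => [|c w IH] u v; first by rewrite inE => _ /eqP[-> ->].
move=> /andP[c0 cw]; rewrite mem_unshuf_cons => /orP[].
  by case: u => // a u /andP[/eqP -> /(IH _ _ cw)[cu cv]]; split=> //; apply/andP.
by case: v => // b v /andP[/eqP -> /(IH _ _ cw)[cu cv]]; split=> //; apply/andP.
Qed.

Lemma nz_comp w : is_comp w -> nz w = size w.
Proof. by move=> cw; rewrite -size_strip strip_comp. Qed.

Lemma L_pqsymQ a : all odd a -> L a \in pqsymQ.
Proof. by move=> oa; apply/pqsymZ_Q/L_pqsymZ. Qed.

Lemma L_prod_pqsymQ ls : all (all odd) ls -> \prod_(l <- ls) L l \in pqsymQ.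
Proof.
by move=> ols; rewrite big_seq; apply: rpred_prod => l /(allP ols) ol; apply: L_pqsymQ.
Qed.

Lemma L_prod_short ls : all (all odd) ls ->
  short (size (flatten ls)).+1 (\prod_(l <- ls) L l).
Proof.
elim: ls => [|l ls IH] /=; first by rewrite big_nil => _; exact: short1.
move=> /andP[ol ols]; rewrite big_cons size_cat -addnS.
exact: shortM (L_short ol) (IH ols).
Qed.

(** Among words with as many letters as [l], the series [L l] is supported at [l] alone, so that
    multiplying by it extracts [l] from the shuffle. *)
Lemma co_L_prod ls w : all (all odd) ls -> is_comp w -> size w = size (flatten ls) ->
  co (\prod_(l <- ls) L l) w = (shuffles ls w)%:R * 2 ^+ size w.
Proof.
elim/last_ind: ls w => [|ls l IH] w.
  by rewrite big_nil => _ _ /size0nil ->; rewrite co1 /shuffles /= mulr1.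
rewrite all_rcons => /andP[ol ols] cw; rewrite flatten_rcons_seq size_cat => sw.
rewrite -cats1 big_cat big_seq1.
rewrite (co_mul_top _ _ (L_prod_short ols) (L_short ol) cw sw) ?L_prod_pqsymQ ?L_pqsymQ //.
rewrite cats1 shuffles_rcons natr_sum mulr_suml [RHS]big_mkcond /=.
rewrite big_seq [RHS]big_seq; apply: eq_bigr => -[u v] uv /=.
have [cu cv] := unshuf_comp cw uv; have suv := unshuf_size uv.
case: eqP => [vl|vl].
  subst v; rewrite IH //; last by move: suv; rewrite sw => /addIn.
  by rewrite L_self // -mulrA -exprD suv.
case: (ltngtP (size v) (size l)) => svl.
- rewrite (L_prod_short ols) ?mul0r // nz_comp //.
  by rewrite -(ltn_add2r (size v)) suv sw ltn_add2l.
- by rewrite (L_short ol) ?mulr0 // nz_comp.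
rewrite co_L //; case: ifP => [/coarser_nz[_]|]; last by rewrite mulr0.
have cl := odd_is_comp ol.
by rewrite (nz_comp cv) (nz_comp cl) (strip_comp cv) (strip_comp cl) => /(_ svl).
Qed.

Section QTop.
Variable a : seq nat.
Hypotheses (oa : all odd a) (a0 : a != [::]).

Lemma scale_short i : odd i -> short (size a).+1 (L (scale_comp i a)).
Proof.
by move=> oi; have := L_short (all_odd_scale oi oa); rewrite size_map.
Qed.

Lemma q_short n : short (n * size a).+1 (q n a).
Proof.
elim/ltn_ind: n => -[|n] IH; first by rewrite q0; exact: short1.
rewrite (q_rec oa a0); apply: shortZ; apply: short_sum => i _; rewrite /adams_odd.
case: ifP => [oi|_]; last by rewrite mul0r => w _; rewrite co0.
have := shortM (scale_short oi) (IH (n - i)%N (leq_subr _ _)); apply: shortW.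
rewrite addnS ltnS mulSn leq_add2l leq_mul2r leq_subr; exact: orbT.
Qed.

(** In the recursion for q_(n+1)(a) only the term with [L a] reaches the maximal number of letters:
    [L (k a)] has no more letters than [L a] but lowers the index by [k]. *)
Lemma q_top n : exists2 h, short (n * size a) h &
  (n`!%:R : rat) *: q n a = L a ^+ n + h.
Proof.
elim: n => [|n [h sh IH]].
  by exists 0; [move=> w _; rewrite co0|rewrite q0 scale1r addr0].
exists (L a * h + (n`!%:R : rat) *: \sum_(i < n) adams_odd a i.+2 * q (n - i.+1) a).
  apply: shortD; first by rewrite mulSn; apply: shortM => //; apply: L_short.
  apply: shortZ; apply: short_sum => i _; rewrite /adams_odd.
  case: ifP => [oi|_]; last by rewrite mul0r => w _; rewrite co0.
  apply: shortW (shortM (scale_short oi) (@q_short (n - i.+1)%N)).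
  rewrite addnS -mulSn -subSn ?ltn_ord // subSS.
  have sa : (0 < size a)%N by case: (a) a0.
  rewrite ltn_pmul2r // ltnS; exact: leq_subr.
have fE : (n.+1)`!%:R / n.+1%:R = n`!%:R :> rat.
  by rewrite factS mulnC natrM mulfK // pnatr_eq0.
rewrite (q_rec oa a0) scalerA fE.
rewrite big_ord_recl subn0 /adams_odd /= scale_comp1 scalerDr scalerAr IH.
by rewrite mulrDr exprS addrA.
Qed.
End QTop.

Definition qprod (ls : seq (seq nat)) : QX := \prod_(b <- undup ls) q (count_mem b ls) b.
Definition fact_mult (ls : seq (seq nat)) : nat := \prod_(b <- undup ls) (count_mem b ls)`!.

Lemma fact_mult_rcons ls l : fact_mult (rcons ls l) = (fact_mult ls * (count_mem l ls).+1)%N.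
Proof.
have E (s : seq (seq nat)) : uniq s -> {subset ls <= s} ->
    fact_mult ls = (\prod_(b <- s) (count_mem b ls)`!)%N.
  move=> us ss; rewrite /fact_mult [RHS](bigID (mem ls)) /= [X in (_ * X)%N]big1 ?muln1; last first.
    by move=> b /count_memPn ->.
  rewrite -[RHS]big_filter; apply: perm_big; apply: uniq_perm; rewrite ?undup_uniq ?filter_uniq //.
  by move=> b; rewrite mem_undup mem_filter; case: (boolP (b \in ls)) => //= /ss ->.
have ss : {subset ls <= undup (rcons ls l)}.
  by move=> b bl; rewrite mem_undup mem_rcons inE bl orbT.
rewrite (E _ (undup_uniq _) ss) /fact_mult.
have lu : l \in undup (rcons ls l) by rewrite mem_undup mem_rcons inE eqxx.
rewrite !(bigD1_seq l) ?undup_uniq //= mulnAC; congr (_ * _)%N.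
  by rewrite -cats1 count_cat /= eqxx addn1 factS mulnC.
by apply: eq_bigr => b bl; rewrite -cats1 count_cat /= eq_sym (negbTE bl) !addn0.
Qed.

Lemma shuffles_cfl ls : cfl ls -> shuffles ls (flatten ls) = fact_mult ls.
Proof.
elim/last_ind: ls => [|ls l IH] c; first by rewrite /fact_mult big_nil /shuffles.
by rewrite shuffles_flatten // fact_mult_rcons IH //; move: c; rewrite cfl_rcons => /and3P[].
Qed.

Lemma qprod_top ls : all (all odd) ls -> [::] \notin ls ->
  exists2 h, short (size (flatten ls)) h &
    ((fact_mult ls)%:R : rat) *: qprod ls = \prod_(l <- ls) L l + h.
Proof.
move=> ols nls.
have H (s : seq (seq nat)) (m : seq nat -> nat) : all (all odd) s -> [::] \notin s ->
  exists2 h, short (\sum_(b <- s) m b * size b)%N h &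
  ((\prod_(b <- s) (m b)`!)%N%:R : rat) *: (\prod_(b <- s) q (m b) b) =
    \prod_(b <- s) L b ^+ m b + h.
  elim: s => [|b s IH] /=; first by exists 0; rewrite ?big_nil ?scale1r ?addr0.
  rewrite inE negb_or eq_sym => /andP[ob os] /andP[b0 ns].
  have [h sh hE] := IH os ns; have [h' sh' hE'] := q_top ob b0 (m b).
  have Lm : short (m b * size b).+1 (L b ^+ m b).
    have -> : L b ^+ m b = \prod_(l <- nseq (m b) b) L l.
      by rewrite big_nseq -Monoid.iteropE.
    have -> : (m b * size b)%N = size (flatten (nseq (m b) b)).
      by rewrite size_flatten /shape map_nseq sumn_nseq mulnC.
    by apply: L_prod_short; rewrite all_nseq ob orbT.
  have sQ : short (\sum_(b <- s) m b * size b).+1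
      (((\prod_(b <- s) (m b)`!)%N%:R : rat) *: (\prod_(b <- s) q (m b) b)).
    apply: shortZ; elim: (s) os ns => [|c s' IHs]; first by rewrite !big_nil => _ _; exact: short1.
    rewrite /= inE negb_or eq_sym => /andP[oc os'] /andP[c0 ns']; rewrite !big_cons -addnS.
    by apply: shortM; [exact: q_short|exact: IHs].
  exists (L b ^+ m b * h + h' * (((\prod_(b <- s) (m b)`!)%N%:R : rat) *: (\prod_(b <- s) q (m b) b))).
    rewrite big_cons; apply: shortD; first exact: shortM.
    rewrite mulrC addnC; apply: shortM => //.
  rewrite !big_cons natrM -scalerA.
  rewrite [X in _ *: X = _]scalerAr [LHS]scalerAl hE' mulrDl {1}hE mulrDr.
  by rewrite addrA.
have uls b : b \in undup ls -> b \in ls by rewrite mem_undup.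
case: (H (undup ls) (fun b => count_mem b ls)).
- by apply/allP => b /uls /(allP ols).
- by apply: contra nls; apply: uls.
move=> h sh hE; exists h; last first.
  rewrite hE; congr (_ + _); rewrite -[RHS]big_undup_iterop_count.
  by apply: eq_bigr.
suff -> : size (flatten ls) = (\sum_(b <- undup ls) count_mem b ls * size b)%N by [].
rewrite size_flatten sumnE big_map -[LHS]big_undup_iterop_count.
apply: eq_bigr => b _; rewrite Monoid.iteropE iter_addn_0 mulnC //.
Qed.

Definition word_cfl (w : seq nat) : seq (seq nat) := s2val (cid2 (cfl_exists w)).

Lemma word_cflP w : cfl (word_cfl w) /\ flatten (word_cfl w) = w.
Proof. by rewrite /word_cfl; case: (cid2 _). Qed.

Lemma cfl_neq0 ls : cfl ls -> [::] \notin ls.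
Proof. by case/andP => _ /allP H; apply/negP => /H /lyndon_neq0. Qed.

Lemma all_flatten (T : Type) (p : pred T) (ls : seq (seq T)) :
  all p (flatten ls) = all (all p) ls.
Proof. by elim: ls => //= l ls IH; rewrite all_cat IH. Qed.

Definition qword (w : seq nat) : QX := qprod (word_cfl w).

Section QWord.
Variable w : seq nat.
Hypothesis ow : all odd w.

Let ols : all (all odd) (word_cfl w).
Proof. by rewrite -all_flatten; have [_ ->] := word_cflP w. Qed.

Lemma mem_word_cfl b : b \in word_cfl w -> [/\ lyndon b, all odd b & b != [::]].
Proof.
have [/andP[_ /allP H] _] := word_cflP w => bw; have lb := H _ bw.
by split=> //; [exact: (allP ols)|exact: lyndon_neq0].
Qed.

Lemma qword_pqsymZ : qword w \in pqsymZ.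
Proof.
rewrite /qword /qprod big_seq; apply: rpred_prod => b; rewrite mem_undup.
by move=> /mem_word_cfl[_ ob b0]; apply: q_pqsymZ.
Qed.

Lemma qword_homog : homog (sumn w) (qword w).
Proof.
rewrite /qword /qprod.
have -> : sumn w = (\sum_(b <- undup (word_cfl w)) count_mem b (word_cfl w) * sumn b)%N.
  have [_ {1}<-] := word_cflP w.
  rewrite sumn_flatten sumnE big_map -[LHS]big_undup_iterop_count.
  by apply: eq_bigr => b _; rewrite Monoid.iteropE iter_addn_0 mulnC.
rewrite [X in homog X _]big_seq [X in homog _ X]big_seq.
apply: (big_ind2 homog) => [|N f N' g|b]; [exact: homog1|exact: homogM|].
rewrite mem_undup => /mem_word_cfl[_ ob b0]; exact: q_homog.
Qed.

Lemma co_qword v : is_comp v -> (size w <= size v)%N ->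
  (fact_mult (word_cfl w))%:R * co (qword w) v = co (\prod_(l <- word_cfl w) L l) v.
Proof.
move=> cv le; have [c fw] := word_cflP w.
have [h sh hE] := qprod_top ols (cfl_neq0 c).
rewrite -coZ hE coD sh ?addr0 // fw nz_comp //.
Qed.

Lemma fact_mult_neq0 ls : (fact_mult ls)%:R != 0 :> rat.
Proof.
rewrite pnatr_eq0 -lt0n /fact_mult; apply: (big_ind (fun n => 0 < n)%N) => // [m n|b _].
  by rewrite muln_gt0 => -> ->.
exact: fact_gt0.
Qed.

(** The factorials in [qprod_top] are the number of shuffles in [shuffles_cfl]; they cancel and
    leave the power of 2. *)
Lemma qword_self : co (qword w) w = 2 ^+ size w.
Proof.
have [c fw] := word_cflP w; apply: (mulfI (fact_mult_neq0 (word_cfl w))).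
rewrite co_qword ?odd_is_comp // co_L_prod ?fw ?odd_is_comp //.
by have := shuffles_cfl c; rewrite fw => ->.
Qed.

Lemma qword_rle v : all odd v -> co (qword w) v != 0 -> rle v w.
Proof.
move=> ov nzv; have [c fw] := word_cflP w; have cv := odd_is_comp ov.
rewrite /rle; case: ltngtP => //= sz; last first.
  have : (fact_mult (word_cfl w))%:R * co (qword w) v != 0.
    by rewrite mulf_neq0 ?fact_mult_neq0.
  rewrite co_qword ?sz // co_L_prod ?fw // => H.
  rewrite -fw; apply: shuffles_max => //.
  by apply: contraNneq H => ->; rewrite mul0r.
have : (fact_mult (word_cfl w))%:R * co (qword w) v != 0.
  by rewrite mulf_neq0 ?fact_mult_neq0.
rewrite co_qword ?(ltnW sz) // L_prod_short ?eqxx // fw nz_comp //.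
Qed.

End QWord.

(** * Generation *)

Section Meval.
Variables (I : choiceType) (A : comNzRingType) (b : I -> A).
Implicit Types m : {cmonom I}.

Lemma mevalEw m (d : {fset I}) : (finsupp m `<=` d)%fset ->
  meval b m = \prod_(i <- d) b i ^+ m i.
Proof.
move=> md; rewrite /meval; apply: big_fset_incl => // i _ im.
by move: im; rewrite -cmE_eq0 => /eqP ->.
Qed.

Lemma meval_mmorphism : mmorphism (meval b).
Proof.
split=> [m m'|]; last by rewrite /meval mdom1 big_seq_fset0.
rewrite !(@mevalEw _ (finsupp m `|` finsupp m')%fset) ?fsubsetUl ?fsubsetUr ?mdomD //.
by rewrite -big_split; apply: eq_bigr => i _; rewrite cmM exprD.
Qed.

HB.instance Definition _ := monalg.isMultiplicative.Build {cmonom I} A (meval b) meval_mmorphism.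

Lemma meval_ucm i : meval b (ucm i) = b i.
Proof. by rewrite /meval mdomU big_seq_fset1 cmUU. Qed.
End Meval.

HB.instance Definition _ (I : choiceType) (A : comNzRingType) (b : I -> A) :=
  GRing.RMorphism.copy (evalZ b) (mmap intr (meval b)).
HB.instance Definition _ (I : choiceType) (A : comAlgType rat) (b : I -> A) :=
  GRing.RMorphism.copy (evalQ b) (mmap (in_alg A) (meval b)).

Lemma evalZU (I : choiceType) (A : comNzRingType) (b : I -> A) z m :
  evalZ b << z *g m >> = meval b m *~ z.
Proof. by rewrite /evalZ mmapU mulrzl. Qed.

Lemma evalQU (I : choiceType) (A : comAlgType rat) (b : I -> A) c m :
  evalQ b << c *g m >> = c *: meval b m.
Proof. by rewrite /evalQ mmapU /= mulr_algl. Qed.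

Definition imageZ (I : choiceType) (b : I -> QX) : {pred QX} :=
  fun f => `[< exists p, evalZ b p = f >].
Definition imageQ (I : choiceType) (b : I -> QX) : {pred QX} :=
  fun f => `[< exists p, evalQ b p = f >].

Lemma imageZ_subring (I : choiceType) (b : I -> QX) : subring_closed (imageZ b).
Proof.
split; first by apply/asboolP; exists 1; rewrite rmorph1.
- by move=> _ _ /asboolP[p <-] /asboolP[r <-]; apply/asboolP; exists (p - r); rewrite rmorphB.
- by move=> _ _ /asboolP[p <-] /asboolP[r <-]; apply/asboolP; exists (p * r); rewrite rmorphM.
Qed.

HB.instance Definition _ (I : choiceType) (b : I -> QX) :=
  GRing.isSubringClosed.Build QX (imageZ b) (imageZ_subring b).

Lemma imageQ_subalg (I : choiceType) (b : I -> QX) : subalg_closed (imageQ b).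
Proof.
split; first by apply/asboolP; exists 1; rewrite rmorph1.
- move=> c _ _ /asboolP[p <-] /asboolP[r <-]; apply/asboolP.
  exists (c%:MP * p + r); rewrite rmorphD rmorphM [X in X * _]evalQU.
  by rewrite mmorph1 -scalerAl mul1r.
- by move=> _ _ /asboolP[p <-] /asboolP[r <-]; apply/asboolP; exists (p * r); rewrite rmorphM.
Qed.

HB.instance Definition _ (I : choiceType) (b : I -> QX) :=
  GRing.isSubalgClosed.Build rat QX (imageQ b) (imageQ_subalg b).

Lemma imageZ_gen (I : choiceType) (b : I -> QX) i : b i \in imageZ b.
Proof. by apply/asboolP; exists << ucm i >>; rewrite evalZU mulr1z meval_ucm. Qed.

Lemma imageQ_gen (I : choiceType) (b : I -> QX) i : b i \in imageQ b.
Proof. by apply/asboolP; exists << ucm i >>; rewrite evalQU scale1r meval_ucm. Qed.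

Lemma lyndon_scale d a : (0 < d)%N -> lyndon (scale_comp d a) = lyndon a.
Proof.
move=> d0; have lltE u v : llt (scale_comp d u) (scale_comp d v) = llt u v.
  elim: u v => [|x u IH] [|y v] //=.
  by rewrite !llt_cons IH ltn_pmul2l // eqn_pmul2l.
rewrite /lyndon -!size_eq0 size_map; congr (_ && _); apply: eq_all => i.
by rewrite -map_drop; apply: lltE.
Qed.

Lemma biggcd_dvd (w : seq nat) c : c \in w -> (\big[gcdn/0]_(i <- w) i %| c)%N.
Proof.
elim: w => // x w IH; rewrite inE big_cons => /orP[/eqP ->|/IH H]; first exact: dvdn_gcdl.
exact: dvdn_trans (dvdn_gcdr _ _) H.
Qed.

Lemma biggcd_scale d w : (\big[gcdn/0]_(i <- scale_comp d w) i = d * \big[gcdn/0]_(i <- w) i)%N.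
Proof.
rewrite big_map; elim: w => [|x w IH]; first by rewrite !big_nil muln0.
by rewrite !big_cons IH muln_gcdr.
Qed.

Lemma eLYN_scale b : lyndon b -> all odd b -> exists a d, [/\ is_eLYNo a, odd d & b = scale_comp d a].
Proof.
move=> lb ob; pose d := \big[gcdn/0]_(i <- b) i.
have b0 := lyndon_neq0 lb; pose a := [seq (c %/ d)%N | c <- b].
have ba : b = scale_comp d a.
  rewrite /a /scale_comp -map_comp -[LHS]map_id; apply/eq_in_map => c cb /=.
  by rewrite mulnC divnK // biggcd_dvd.
have od : odd d.
  have [c cb] : exists c, c \in b by case: (b) b0 => // c b' _; exists c; rewrite inE eqxx.
  have [k ck] := dvdnP (biggcd_dvd cb).
  by have := allP ob c cb; rewrite ck oddM => /andP[].
have d0 : (0 < d)%N by case: (d) od.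
exists a, d; split=> //; apply/and3P; split.
- by rewrite -(lyndon_scale a d0) -ba.
- by rewrite /elementary -(eqn_pmul2l d0) -biggcd_scale -ba muln1.
by move: ob; rewrite ba all_map; apply: sub_all => c /=; rewrite oddM od.
Qed.

Lemma eLYNoP (a : eLYNo) : [/\ lyndon (val a), elementary (val a), all odd (val a) & val a != [::]].
Proof. by have /and3P[l e o] := valP a; split=> //; apply: lyndon_neq0. Qed.

Lemma imageZ_q (a : eLYNo) n : q n (val a) \in imageZ qgen.
Proof.
case: n => [|n]; first by rewrite q0 rpred1.
exact: (imageZ_gen qgen (a, exist _ n.+1 isT : posnat)).
Qed.

(** Dividing by the gcd of the letters gives [b = d a] with [a] elementary and [d] odd, and
    [q_scale] expresses q_n(b) through the q_k(a). *)
Lemma imageZ_q_lyndon n b : lyndon b -> all odd b -> q n b \in imageZ qgen.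
Proof.
move=> lb ob; have [a [d [ea od ->]]] := eLYN_scale lb ob.
have [_ _ oa a0] := eLYNoP (exist _ a ea : eLYNo).
case: d od => // d od; rewrite q_scale //.
by apply: norm_coef_over => k; apply: (imageZ_q (exist _ a ea : eLYNo)).
Qed.

Lemma imageZE : imageZ qgen =i pqsymZ.
Proof.
move=> f; apply/idP/idP => [/asboolP[p <-]|fZ].
  rewrite /evalZ mmapE rpred_sum // => m _; rewrite rpredM ?rpred_int //.
  rewrite rpred_prod // => -[a n] _; rewrite rpredX //.
  by have [_ _ oa a0] := eLYNoP a; apply: q_pqsymZ.
have [s [so ->]] := pqsymZ_span qword_pqsymZ (fun w ow => homog_wbound (qword_homog ow)) qword_self (fun w v ow => qword_rle ow (v:=v)) fZ.
rewrite big_seq rpred_sum // => -[z w] /so /= ow; rewrite rpredMz //.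
rewrite /qword /qprod big_seq rpred_prod // => b; rewrite mem_undup => /(mem_word_cfl ow)[lb ob _].
exact: imageZ_q_lyndon.
Qed.

Lemma range_evalZ (I : choiceType) (b : I -> QX) : range (evalZ b) = [set` imageZ b].
Proof.
apply/seteqP; split=> f /=; first by case=> p _ <-; apply/asboolP; exists p.
by move=> /asboolP[p <-]; exists p.
Qed.

Lemma range_evalQ (I : choiceType) (b : I -> QX) : range (evalQ b) = [set` imageQ b].
Proof.
apply/seteqP; split=> f /=; first by case=> p _ <-; apply/asboolP; exists p.
by move=> /asboolP[p <-]; exists p.
Qed.

Theorem range_evalZ_qgen : range (evalZ qgen) = PQSym.
Proof.
by rewrite range_evalZ PQSymE; apply/seteqP; split=> f /=; rewrite imageZE.
Qed.

(* The relation of weight [n], [n] even, expresses [q n a] rationally. *)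
Lemma q_even_image (S : subalgClosed QX) a : all odd a -> a != [::] ->
  (forall n, odd n -> q n a \in S) -> forall n, q n a \in S.
Proof.
move=> oa a0 H; elim/ltn_ind => -[|n] IH; first by rewrite q0 rpred1.
case: (boolP (odd n.+1)) => on; first exact: H.
have := q_relation oa a0 (ltn0Sn n).
rewrite big_ord_recl big_ord_recr /= /bump /= add1n subnn subn0 !q0 expr0 !mul1r mulr1.
rewrite -signr_odd (negbTE on) expr0 mul1r; set T := \sum_(_ < _) _ => e.
have -> : q n.+1 a = - (2^-1 : rat) *: T.
  have : (2 : rat) *: q n.+1 a = - T.
    by rewrite scaler_nat mulr2n; apply/eqP; rewrite -addr_eq0 -[X in _ == X]e addrAC addrA.
  move=> /(congr1 (fun f => (2^-1 : rat) *: f)); rewrite scalerA mulVf // scale1r => ->.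
  by rewrite scalerN scaleNr.
rewrite rpredZ // rpred_sum // => i _; have il := ltn_ord i.
apply: rpredM; last by apply: IH; rewrite /bump /=; lia.
apply: rpredM; last by apply: IH; rewrite /bump /=; lia.
have m1 : -1 \in S by rewrite -scaleN1r rpredZ ?rpred1.
by apply: rpredX; exact: m1.
Qed.

(** * Counting and independence *)

(* In each weight, the members of the family span the independent [L w], and by
   [phi] there are at most as many of them. *)
Lemma weight_free (I : choiceType) (b : I -> QX) (phi : I -> seq nat) :
  (forall i, b i \in pqsymQ) -> (forall i, homog (sumn (phi i)) (b i)) ->
  (forall i, all odd (phi i)) -> injective phi ->
  (forall w, all odd w -> exists t : seq (rat * I), L w = \sum_(e <- t) e.1 *: b e.2) ->
  forall (s : seq I) (c : I -> rat), uniq s -> \sum_(i <- s) c i *: b i = 0 ->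
  forall i, i \in s -> c i = 0.
Proof.
move=> bQ bh bo phi_inj Lb s c us s0 i0 i0s.
pose N := sumn (phi i0).
pose W := undup [seq w <- odd_words N | sumn w == N].
have memW w : (w \in W) = all odd w && (sumn w == N).
  rewrite mem_undup mem_filter mem_odd_words; case: (sumn w =P N) => [->|]; rewrite ?leqnn ?andbT ?andbF //.
(* A partial inverse of [phi]. It yields the list [Is] of all indices of weight [N], no longer than
   the list [W] of odd words of that weight. *)
pose inv w : option I := if pselect (exists i, phi i = w) is left H then Some (projT1 (cid H)) else None.
have invK i : inv (phi i) = Some i.
  rewrite /inv; case: pselect => [H|[]]; last by exists i.
  by congr Some; apply: phi_inj; case: (cid H).
have invP w i : inv w = Some i -> phi i = w.
  by rewrite /inv; case: pselect => // H [<-]; case: (cid H).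
pose Is := pmap inv W.
have memI i : (i \in Is) = (sumn (phi i) == N).
  rewrite mem_pmap; apply/mapP/idP => [[w wW /esym/invP ->]|iN]; first by move: wW; rewrite memW => /andP[].
  by exists (phi i) => //; rewrite memW bo iN.
have uI : uniq Is.
  apply: (@map_uniq _ _ phi); rewrite (_ : map phi Is = [seq w <- W | inv w]).
    by rewrite filter_uniq ?undup_uniq.
  rewrite /Is; elim: (W) => //= w W' IH; case E: (inv w) => [i|] //=.
  by rewrite IH (invP _ _ E).
have sI : (size Is <= size W)%N by rewrite size_pmap count_size.
set k := size Is in sI *; set n := size W in sI *.
pose w0 : seq nat := [::].
pose wj (j : 'I_n) := nth [::] W j.
pose ii (i : 'I_k) := nth i0 Is i.
have iiI (i : 'I_k) : ii i \in Is by rewrite mem_nth.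
have wjW (j : 'I_n) : wj j \in W by rewrite mem_nth.
have wjo j : all odd (wj j) by have := wjW j; rewrite memW => /andP[].
have wjN j : sumn (wj j) = N by have := wjW j; rewrite memW => /andP[_ /eqP].
pose B : 'M[rat]_(k, n) := \matrix_(i, j) co (b (ii i)) (wj j).
pose Lm : 'M[rat]_n := \matrix_(i, j) co (L (wj i)) (wj j).
have sum_ii (F : I -> rat) : \sum_(i <- Is) F i = \sum_(i < k) F (ii i).
  by rewrite (big_nth i0) big_mkord.
have homog0w i j : i \notin Is -> co (b i) (wj j) = 0.
  rewrite memI => iN; apply/eqP; apply: contraNT iN => /bh <-.
  by rewrite wjN.
have [t tE] := choice (fun w : {w : seq nat | all odd w} => Lb (val w) (valP w)).
pose tt i := t (exist _ (wj i) (wjo i)).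
pose A : 'M[rat]_(n, k) := \matrix_(i, j) \sum_(e <- tt i | e.2 == ii j) e.1.
have LAB : Lm = A *m B.
  apply/matrixP => i j; rewrite !mxE (tE (exist _ (wj i) (wjo i))) co_sum -/(tt i).
  under [RHS]eq_bigr => l _ do rewrite !mxE mulr_suml.
  rewrite -(sum_ii (fun x => \sum_(e <- tt i | e.2 == x) e.1 * co (b x) (wj j))).
  rewrite (exchange_big_dep xpredT) //=; apply: eq_bigr => e _; rewrite coZ.
  case: (boolP (e.2 \in Is)) => eI; last first.
    rewrite homog0w // mulr0 big_seq_cond big1 // => x /andP[xI /eqP ex].
    by rewrite ex xI in eI.
  rewrite big_mkcond (bigD1_seq e.2) //= eqxx big1 ?addr0 // => x.
  by rewrite eq_sym => /negbTE ->.
have L_full : row_free Lm.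
  apply/row_freeP; apply/row_freeP; rewrite -kermx_eq0; apply/rowV0P => y /sub_kermxP yL.
  apply/rowP => j; rewrite mxE.
  pose cy w : rat := if insub (index w W) is Some j then y 0 j else 0.
  have cyE j' : cy (wj j') = y 0 j'.
    rewrite /cy index_uniq ?undup_uniq ?ltn_ord //.
    by rewrite valK.
  rewrite -cyE; apply: (@L_free_rat W) (wjW j); first exact: undup_uniq.
    by apply/allP => w; rewrite memW => /andP[].
  apply: pqsymQ_eq0.
    rewrite big_seq; apply: rpred_sum => w; rewrite memW => /andP[ow _].
    by apply: rpredZ; apply: L_pqsymQ.
  move=> w ow; rewrite co_sum; case: (boolP (w \in W)) => wW; last first.
    rewrite big_seq big1 // => v; rewrite memW => /andP[ov /eqP vN].
    rewrite coZ; apply/eqP; rewrite mulf_eq0; apply/orP; right.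
    apply: contraNT wW => /(L_homog ov) wv; by rewrite memW ow wv vN eqxx.
  have iw : (index w W < n)%N by rewrite index_mem.
  have := congr1 (fun M : 'rV_n => M 0 (Ordinal iw)) yL; rewrite !mxE => yL0; rewrite -[RHS]yL0.
  rewrite (big_nth [::]) big_mkord; apply: eq_bigr => i _.
  by rewrite coZ cyE mxE /wj /= nth_index.
(* Since [Lm = A *m B] has full rank [n], the rank of [B] is at least [n], which in turn is at least
   its number [k] of rows. *)
have rB : row_free B.
  rewrite /row_free eqn_leq rank_leq_row /=; apply: (leq_trans sI).
  have := mxrankM_maxr A B; rewrite -LAB; apply: leq_trans.
  by rewrite (eqP L_full).
pose y : 'rV[rat]_k := \row_j (if ii j \in s then c (ii j) else 0).
have yB : y *m B = 0.
  apply/rowP => j; rewrite !mxE.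
  have := congr1 (fun f => co f (wj j)) s0; rewrite co0 co_sum => cs0; rewrite -[RHS]cs0.
  under eq_bigr => l _ do rewrite !mxE.
  rewrite -(sum_ii (fun x => (if x \in s then c x else 0) * co (b x) (wj j))).
  rewrite [RHS](bigID (mem Is)) /= [X in _ = _ + X]big1 ?addr0; last first.
    by move=> x xI; rewrite coZ homog0w // mulr0.
  rewrite [LHS](bigID (mem s)) /= [X in _ + X = _]big1 ?addr0; last first.
    by move=> x /negbTE ->; rewrite mul0r.
  under eq_bigr => x xs do rewrite xs.
  under [RHS]eq_bigr => x _ do rewrite coZ.
  rewrite -[LHS]big_filter -[RHS]big_filter.
  by apply: perm_big; apply: uniq_perm; rewrite ?filter_uniq // => x; rewrite !mem_filter andbC.
have y0 : y = 0 by apply: (row_free_inj rB); rewrite yB mul0mx.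
have i0I : i0 \in Is by rewrite memI.
have ik : (index i0 Is < k)%N by rewrite index_mem.
have := congr1 (fun M : 'rV_k => M 0 (Ordinal ik)) y0.
by rewrite !mxE /ii /= nth_index // i0s.
Qed.

(** * Monomials in the generators of odd index *)

Notation gidx := (eLYNo * oddnat)%type.
Definition gword (x : gidx) : seq nat := scale_comp (val x.2) (val x.1).

(** As [a] is elementary, [d] is the gcd of the letters of [d a]. *)
Lemma gword_inj : injective gword.
Proof.
move=> [a d] [a' d'] e.
have [_ /eqP ea _ _] := eLYNoP a; have [_ /eqP ea' _ _] := eLYNoP a'.
have d0 (d1 : oddnat) : (0 < val d1)%N by case: d1 => -[].
have dd : val d = val d'.
  by have := congr1 (fun w : seq nat => \big[gcdn/0]_(i <- w) i)%N e; rewrite /= !biggcd_scale ea ea' !muln1.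
congr (_, _); last exact: val_inj.
apply: val_inj; move: e; rewrite /gword /= dd; apply: inj_map => x y /eqP.
by rewrite eqn_pmul2l // => /eqP.
Qed.

Lemma gword_lyndon x : lyndon (gword x).
Proof.
case: x => a d; have [la _ _ _] := eLYNoP a; rewrite lyndon_scale //.
by case: d => -[].
Qed.

Lemma gword_odd x : all odd (gword x).
Proof. by case: x => a d; have [_ _ oa _] := eLYNoP a; apply: all_odd_scale => //; apply: (valP d). Qed.

Definition cmlist (I : choiceType) (m : {cmonom I}) : seq I :=
  flatten [seq nseq (m x) x | x <- finsupp m].

Lemma count_cmlist (I : choiceType) (m : {cmonom I}) x : count_mem x (cmlist m) = m x.
Proof.
rewrite count_flatten sumnE !big_map.
under eq_bigr => y _ do rewrite count_nseq /=.
case: (boolP (x \in finsupp m)) => xm; last first.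
  rewrite big_seq big1 => [|y ym].
    by apply/esym/eqP; rewrite cmE_eq0.
  by case: eqP => // yx; rewrite -yx ym in xm.
rewrite (bigD1_seq x) ?fset_uniq //= eqxx mul1n big1 ?addn0 // => y /negbTE ->.
by rewrite mul0n.
Qed.

Definition gfactors (m : {cmonom gidx}) : seq (seq nat) := map gword (cmlist m).

(** The word whose Lyndon factors are the generators in [m], with their exponents as multiplicities;
    that [m] can be recovered is the uniqueness of the Chen-Fox-Lyndon factorization. *)
Definition gconcat (m : {cmonom gidx}) : seq nat := flatten (sort lge (gfactors m)).

Lemma mem_gfactors m b : b \in gfactors m -> exists x, b = gword x.
Proof. by move=> /mapP[x _ ->]; exists x. Qed.

Lemma gconcat_cfl m : cfl (sort lge (gfactors m)).
Proof.
apply/andP; split.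
  by apply: sort_sorted => u v; rewrite /lge lle_total.
rewrite all_sort; apply/allP => b /mem_gfactors[x ->]; exact: gword_lyndon.
Qed.

Lemma gconcat_odd m : all odd (gconcat m).
Proof.
rewrite all_flatten all_sort; apply/allP => b /mem_gfactors[x ->]; exact: gword_odd.
Qed.

Lemma count_gfactors (m : {cmonom gidx}) x : count_mem (gword x) (gfactors m) = m x.
Proof.
by rewrite -[RHS]count_cmlist count_map; apply: eq_count => y /=; rewrite (inj_eq gword_inj).
Qed.

Lemma gconcat_inj : injective gconcat.
Proof.
move=> m m' /(cfl_uniq (gconcat_cfl m) (gconcat_cfl m')) e.
apply/eqP/cmP => x; rewrite -!count_gfactors.
by rewrite -(count_sort lge) e count_sort.
Qed.

Definition gweight (m : {cmonom gidx}) : nat := (\sum_(x <- finsupp m) m x * sumn (gword x))%N.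

Lemma sumn_gconcat m : sumn (gconcat m) = gweight m.
Proof.
rewrite sumn_flatten sumnE big_map.
have -> : (\sum_(w <- sort lge (gfactors m)) sumn w = \sum_(w <- gfactors m) sumn w)%N.
  by apply: perm_big; rewrite perm_sort.
rewrite big_map big_flatten big_map; apply: eq_bigr => x _.
by rewrite big_nseq iter_addn_0 mulnC.
Qed.

Lemma qodd_homog x : homog (sumn (gword x)) (qodd x).
Proof.
case: x => a d; have [_ _ oa a0] := eLYNoP a.
rewrite /gword sumn_scale; exact: q_homog.
Qed.

Lemma meval_qodd_homog m : homog (gweight m) (meval qodd m).
Proof.
rewrite /gweight /meval; apply: (big_ind2 homog) => [|N f N' g|x _].
- exact: homog1.
- exact: homogM.
- by apply: homogX; apply: qodd_homog.
Qed.

Lemma qodd_pqsymQ x : qodd x \in pqsymQ.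
Proof. by case: x => a d; have [_ _ oa a0] := eLYNoP a; apply: q_pqsymQ. Qed.

Lemma meval_qodd_pqsymQ m : meval qodd m \in pqsymQ.
Proof. by rewrite /meval rpred_prod // => x _; rewrite rpredX ?qodd_pqsymQ. Qed.

Lemma imageQ_qodd_q (a : eLYNo) n : q n (val a) \in imageQ qodd.
Proof.
have [_ _ oa a0] := eLYNoP a; apply: q_even_image => // k ok.
exact: (imageQ_gen qodd (a, exist _ k ok : oddnat)).
Qed.

Lemma evalQE (I : choiceType) (b : I -> QX) p :
  evalQ b p = \sum_(m <- msupp p) p@_m *: meval b m.
Proof. by rewrite /evalQ mmapE; apply: eq_bigr => m _; rewrite /= mulr_algl. Qed.

Lemma imageZ_imageQ f : f \in imageZ qgen -> f \in imageQ qodd.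
Proof.
move=> /asboolP[p <-]; rewrite /evalZ mmapE rpred_sum // => m _.
rewrite mulrzl scale_intr rpredZ // rpred_prod // => -[a n] _.
by rewrite rpredX //; apply: imageQ_qodd_q.
Qed.

Lemma L_imageZ w : all odd w -> L w \in imageZ qgen.
Proof. by move=> ow; rewrite imageZE L_pqsymZ. Qed.

Lemma meval_qodd_free (s : seq {cmonom gidx}) (c : {cmonom gidx} -> rat) : uniq s ->
  \sum_(m <- s) c m *: meval qodd m = 0 -> forall m, m \in s -> c m = 0.
Proof.
apply: (@weight_free _ _ gconcat) => [m|m|m||w ow].
- exact: meval_qodd_pqsymQ.
- by rewrite sumn_gconcat; apply: meval_qodd_homog.
- exact: gconcat_odd.
- exact: gconcat_inj.
have /asboolP[p pE] := imageZ_imageQ (L_imageZ ow).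
exists [seq (p@_m, m) | m <- msupp p]; rewrite big_map /= -pE evalQE.
by [].
Qed.

Lemma evalQ_qodd_inj : injective (evalQ qodd).
Proof.
move=> p r pr; apply/eqP; rewrite -subr_eq0; apply/eqP/malgP => m; rewrite mcoeff0.
have : evalQ qodd (p - r) = 0 by rewrite rmorphB /= pr subrr.
rewrite evalQE => /(meval_qodd_free (fset_uniq _)) H.
by case: (boolP (m \in msupp (p - r))) => [/H //|/mcoeff_outdom].
Qed.

Lemma poly_basis_qodd : poly_basis PQSymQ qodd.
Proof.
split; first exact: evalQ_qodd_inj.
rewrite range_evalQ; apply/seteqP; split=> f /=.
  move=> /asboolP[p <-]; rewrite evalQE; exists [seq (p@_m, meval qodd m) | m <- msupp p].
  split; last by rewrite big_map.
  move=> _ /mapP[m _ ->] /=; rewrite PQSymE /= /meval rpred_prod // => -[a d] _.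
  have [_ _ oa a0] := eLYNoP a.
  by rewrite rpredX // q_pqsymZ.
move=> [s [sP ->]]; rewrite big_seq rpred_sum // => p /sP; rewrite PQSymE /= => pZ.
by rewrite rpredZ // imageZ_imageQ // imageZE.
Qed.

(** * Glaisher's bijection *)

Lemma odd_pow2sum (s : seq nat) : uniq s -> odd (\sum_(k <- s) 2 ^ k)%N = (0%N \in s).
Proof.
elim: s => [|k s IH] /=; first by rewrite big_nil.
move=> /andP[ks us]; rewrite big_cons oddD oddX IH // inE orbF eq_sym.
by case: k ks => [|k] ks /=; first by rewrite (negbTE ks).
Qed.

Lemma pow2sum_bit k (s : seq nat) : uniq s ->
  odd ((\sum_(j <- s) 2 ^ j) %/ 2 ^ k)%N = (k \in s).
Proof.
elim: k s => [|k IH] s us; first by rewrite divn1 odd_pow2sum.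
pose t := [seq j.-1 | j <- s & (0 < j)%N].
have ut : uniq t.
  rewrite map_inj_in_uniq ?filter_uniq // => -[|x] [|y]; rewrite !mem_filter //= => _ _ ->.
  by [].
have e : (\sum_(j <- s) 2 ^ j = (0%N \in s) + 2 * \sum_(j <- t) 2 ^ j)%N.
  rewrite (bigID (fun j => 0 < j)%N) /= addnC; congr (_ + _)%N.
    transitivity (count_mem 0%N s); last by rewrite count_uniq_mem.
    rewrite -sum1_count; apply: eq_big => j; first by rewrite -eqn0Ngt.
    by rewrite -eqn0Ngt => /eqP ->.
  rewrite big_map big_filter big_distrr /=; apply: eq_bigr => -[|j] //= _.
  by rewrite expnS.
have -> : ((\sum_(j <- s) 2 ^ j) %/ 2 ^ k.+1 = (\sum_(j <- t) 2 ^ j) %/ 2 ^ k)%N.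
  rewrite expnS divnMA e; congr (_ %/ _)%N.
  by case: (0%N \in s); lia.
rewrite IH //; apply/mapP/idP => [[j]|ks].
  by rewrite mem_filter => /andP[]; case: j => // j _ js ->.
by exists k.+1; rewrite ?mem_filter.
Qed.

Definition odd_part (n : nat) : nat := n`_(2%N : nat_pred)^'%N.

Lemma odd_part_odd n : odd (odd_part n).
Proof. by rewrite odd_2'nat part_pnat. Qed.

Definition oddpart (n : posnat) : oddnat := exist _ (odd_part (val n)) (odd_part_odd _).

Lemma oddpartE n : val n = (2 ^ logn 2 (val n) * val (oddpart n))%N.
Proof. by rewrite /= /odd_part -p_part partnC // (valP n). Qed.

(* Glaisher: the part [2^k d], [d] odd, becomes [2^k] parts [d]. *)
Definition glaisher_idx (x : qindex) : gidx := (x.1, oddpart x.2).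
Definition glaisher (s : seq qindex) : {cmonom gidx} :=
  \big[mmul/mone]_(x <- s) expcmn (ucm (glaisher_idx x)) (2 ^ logn 2 (val x.2))%N.

Definition glaisher_exps (s : seq qindex) (y : gidx) : seq nat :=
  [seq logn 2 (val x.2) | x <- s & glaisher_idx x == y].

Lemma glaisherE s y : glaisher s y = (\sum_(k <- glaisher_exps s y) 2 ^ k)%N.
Proof.
rewrite /glaisher cm_big big_map big_filter [RHS]big_mkcond; apply: eq_bigr => x _.
by rewrite expcmnE ucmE; case: (glaisher_idx x == y); rewrite ?muln1 ?muln0.
Qed.

Lemma glaisher_logn_inj (x x' : qindex) : glaisher_idx x = glaisher_idx x' ->
  logn 2 (val x.2) = logn 2 (val x'.2) -> x = x'.
Proof.
case: x x' => [a n] [a' n'] /= [-> /= e] le; congr (_, _).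
by apply: val_inj; rewrite (oddpartE n) (oddpartE n') le /= e.
Qed.

Lemma glaisher_exps_uniq s y : uniq s -> uniq (glaisher_exps s y).
Proof.
move=> us; rewrite map_inj_in_uniq ?filter_uniq // => x x'.
rewrite !mem_filter => /andP[/eqP <- _] /andP[/eqP e _].
by apply: glaisher_logn_inj; rewrite e.
Qed.

Lemma mem_glaisher_exps s x :
  (logn 2 (val x.2) \in glaisher_exps s (glaisher_idx x)) = (x \in s).
Proof.
apply/mapP/idP => [[x']|xs]; last by exists x; rewrite // mem_filter eqxx.
rewrite mem_filter => /andP[/eqP e x's] le.
by rewrite (glaisher_logn_inj (esym e) le).
Qed.

(** The exponent of [(a, d)] in [glaisher s] is the sum of the 2^k over the parts 2^k d that [s] has
    at [a]. These are distinct, so the binary digits of the exponent give them back. *)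
Lemma glaisher_inj s t : uniq s -> uniq t -> glaisher s = glaisher t -> s =i t.
Proof.
move=> us ut e x; rewrite -!mem_glaisher_exps.
rewrite -(pow2sum_bit _ (glaisher_exps_uniq _ us)) -(pow2sum_bit _ (glaisher_exps_uniq _ ut)).
by rewrite -!glaisherE e.
Qed.

Lemma gweightEw (m : {cmonom gidx}) (d : {fset gidx}) : (finsupp m `<=` d)%fset ->
  gweight m = (\sum_(x <- d) m x * sumn (gword x))%N.
Proof.
move=> md; apply: big_fset_incl => // x _ xm.
by move: xm; rewrite -cmE_eq0 => /eqP ->.
Qed.

Lemma gweightM (m m' : {cmonom gidx}) : gweight (mmul m m') = (gweight m + gweight m')%N.
Proof.
rewrite !(@gweightEw _ (finsupp m `|` finsupp m')%fset) ?fsubsetUl ?fsubsetUr ?mdomD //.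
by rewrite -big_split; apply: eq_bigr => i _; rewrite cmM mulnDl.
Qed.

Lemma gweight_glaisher s :
  gweight (glaisher s) = (\sum_(x <- s) val x.2 * sumn (val x.1))%N.
Proof.
rewrite /glaisher; elim: s => [|x s IH].
  by rewrite !big_nil /gweight mdom1 big_seq_fset0.
rewrite !big_cons gweightM IH; congr (_ + _)%N.
rewrite (@gweightEw _ [fset glaisher_idx x]%fset); last first.
  apply/fsubsetP => y; rewrite -cmE_neq0 expcmnE ucmE.
  by case: (glaisher_idx x =P y) => [->|_]; rewrite ?muln0 // inE.
rewrite big_seq_fset1 expcmnE ucmE eqxx muln1 sumn_scale mulnA /=.
by rewrite -oddpartE.
Qed.

(** The generators in the product [qfam l]. Strictness of the partitions means that none is
    repeated, so families correspond to duplicate-free lists up to order. *)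
Definition splist (l : spfam) : seq qindex :=
  [seq (a, n) | a <- (finsupp l : seq eLYNo), n <- pmap insub (val (l a))].

Lemma strict_uniq (l : strict_part) : uniq (val l).
Proof.
have /andP[sl _] := valP l.
by apply: sorted_uniq sl => [y x z xy yz|x]; [exact: (ltn_trans yz xy)|exact: ltnn].
Qed.

Lemma strict_gt0 (l : strict_part) n : n \in val l -> (0 < n)%N.
Proof. by have /andP[_ /allP] := valP l; apply. Qed.

Lemma mem_splist l x : (x \in splist l) = (val x.2 \in val (l x.1)).
Proof.
case: x => a n /=; apply/allpairsPdep/idP => [[a' [n' [_ n'l [-> ->]]]]|nl].
  by move: n'l; rewrite mem_pmap_sub.
exists a, n; split=> //; last by rewrite mem_pmap_sub.
by rewrite mem_finsupp; apply: contraTneq nl => ->.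
Qed.

Lemma splist_uniq l : uniq (splist l).
Proof.
apply: allpairs_uniq_dep => [|a _|[a n] [a' n'] _ _ /= [-> ->] //].
  exact: fset_uniq.
by apply: pmap_sub_uniq; apply: strict_uniq.
Qed.

Lemma splist_inj l l' : splist l =i splist l' -> l = l'.
Proof.
move=> e; apply/fsfunP => a; apply: val_inj.
have /andP[sl _] := valP (l a); have /andP[sl' _] := valP (l' a).
apply: (irr_sorted_eq _ _ sl sl') => [y x z xy yz|x|k].
- exact: (ltn_trans yz xy).
- exact: ltnn.
case: (posnP k) => [->|k0].
  by apply/idP/idP => /strict_gt0.
by have := e (a, exist _ k k0 : posnat); rewrite !mem_splist.
Qed.

Lemma splist_surj s : uniq s -> exists l, perm_eq (splist l) s.
Proof.
move=> us; pose g a := sort geq [seq val x.2 | x <- s & x.1 == a].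
have gP a : is_strict_part (g a).
  apply/andP; split; last first.
    by rewrite all_sort all_map; apply/allP => x _ /=; apply: (valP x.2).
  rewrite gtn_sorted_uniq_geq sort_uniq sort_sorted ?andbT; last by move=> x y; apply: leq_total.
  rewrite map_inj_in_uniq ?filter_uniq // => -[b n] [b' n'].
  by rewrite !mem_filter /= => /andP[/eqP -> _] /andP[/eqP -> _] /val_inj ->.
pose l : spfam := [fsfun a in [fset x.1 | x in s]%fset => (exist _ (g a) (gP a) : strict_part) | strict_part0].
exists l; apply: uniq_perm => //; first exact: splist_uniq.
move=> [a n]; rewrite mem_splist fsfunE; case: ifP => aS /=.
  rewrite mem_sort; apply/mapP/idP => [[[b m]]|ans]; last first.
    by exists (a, n); rewrite ?mem_filter ?eqxx.
  by rewrite mem_filter /= => /andP[/eqP -> ms] /val_inj ->.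
symmetry; apply: contraFF aS => ans; apply/imfsetP; by exists (a, n).
Qed.

Lemma qfamE l : qfam l = \prod_(x <- splist l) qgen x.
Proof.
rewrite /qfam /splist big_allpairs_dep; apply: eq_bigr => a _.
rewrite /q_part -(big_map val xpredT (fun i => q i (val a))); congr bigop.
rewrite (pmap_filter (@insubK _ _ _)).
by apply/esym/all_filterP/allP => n /strict_gt0 n0; rewrite /= insubT.
Qed.

Lemma splist_homog l : homog (gweight (glaisher (splist l))) (qfam l).
Proof.
rewrite gweight_glaisher qfamE; elim: (splist l) => [|x s IH].
  by rewrite !big_nil; exact: homog1.
rewrite !big_cons; apply: homogM IH; have [_ _ oa a0] := eLYNoP x.1.
exact: q_homog.
Qed.

Lemma qgen_pqsymZ x : qgen x \in pqsymZ.
Proof. by case: x => a n; have [_ _ oa a0] := eLYNoP a; apply: q_pqsymZ. Qed.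

Lemma qfam_pqsymZ l : qfam l \in pqsymZ.
Proof. by rewrite qfamE rpred_prod // => x _; apply: qgen_pqsymZ. Qed.

(** * Straightening modulo the relations *)

Section IdealGen.
Variables (A : comNzRingType) (G : set A).

Lemma ideal_gen0 : ideal_gen G 0.
Proof. by exists [::]; rewrite big_nil. Qed.

Lemma ideal_genM x f : G f -> ideal_gen G (x * f).
Proof. by move=> Gf; exists [:: (x, f)]; rewrite big_seq1; split=> // p /[!inE] /eqP ->. Qed.

Lemma ideal_genD f g : ideal_gen G f -> ideal_gen G g -> ideal_gen G (f + g).
Proof.
move=> [s [sG ->]] [t [tG ->]]; exists (s ++ t); rewrite big_cat; split=> // p.
by rewrite mem_cat => /orP[/sG|/tG].
Qed.

Lemma ideal_genMz f z : ideal_gen G f -> ideal_gen G (f *~ z).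
Proof.
move=> [s [sG ->]]; exists [seq (p.1 *~ z, p.2) | p <- s]; split=> [_ /mapP[p /sG ps ->] //|].
by rewrite big_map mulrz_suml; apply: eq_bigr => p _; rewrite mulrzAl.
Qed.
End IdealGen.

Lemma lincombD (T : choiceType) (c1 c2 : {fsfun T -> int with 0}) z :
  exists c : {fsfun T -> int with 0}, forall (A : zmodType) (b : T -> A),
    lincomb b c = lincomb b c1 + lincomb b c2 *~ z.
Proof.
pose S := (finsupp c1 `|` finsupp c2)%fset.
exists [fsfun t in S => c1 t + c2 t * z] => A b.
rewrite !(@lincombEw _ _ _ _ S) ?fset_uniq //.
- rewrite mulrz_suml -big_split big_seq [RHS]big_seq; apply: eq_bigr => t tS.
  by rewrite fsfunE tS mulrzDr mulrzA.
- by move=> t tc; rewrite /= inE tc orbT.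
- by move=> t tc; rewrite /= inE tc.
- by move=> t; rewrite mem_finsupp fsfunE; case: ifP; rewrite ?eqxx.
Qed.

Section Straightening.

Let qrels := [set p | exists a n, (0 < n)%N /\ p = qrel a n].

Definition Yprod (s : seq qindex) : polyZ qindex := \prod_(x <- s) << ucm x >>.
Definition Ystrict (l : spfam) := Yprod (splist l).

Definition Ylist (a : eLYNo) (n : nat) : seq qindex :=
  if insub n is Some k then [:: (a, k)] else [::].

Lemma YE a n : Y a n = Yprod (Ylist a n).
Proof. by rewrite /Y /Ylist; case: insub => [k|]; rewrite /Yprod ?big_seq1 ?big_nil. Qed.

Lemma Yprod_cat s t : Yprod (s ++ t) = Yprod s * Yprod t.
Proof. exact: big_cat. Qed.

Definition straight f := exists c, ideal_gen qrels (f - lincomb Ystrict c).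

Lemma straightD f g z : straight f -> straight g -> straight (f + g *~ z).
Proof.
move=> [c cJ] [d dJ]; have [e eE] := lincombD c d z; exists e.
rewrite eE opprD addrACA -mulrzBl; exact: (ideal_genD cJ (ideal_genMz z dJ)).
Qed.

Lemma straight0 : straight 0.
Proof. by exists [fsfun]; rewrite /lincomb finsupp0 big_seq_fset0 subrr; apply: ideal_gen0. Qed.

Lemma straight_congr f g : ideal_gen qrels (f - g) -> straight g -> straight f.
Proof. by move=> fg [c cJ]; exists c; rewrite -(subrK g f) -addrA; apply: ideal_genD. Qed.

Lemma straight_uniq s : uniq s -> straight (Yprod s).
Proof.
move=> /splist_surj[l ls]; have [c cE] := lincomb1 (polyZ qindex) l; exists c.
rewrite cE /Ystrict /Yprod (perm_big _ ls) subrr; exact: ideal_gen0.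
Qed.

Lemma not_uniq_perm (T : eqType) (s : seq T) : ~~ uniq s ->
  exists x r, perm_eq s (x :: x :: r).
Proof.
elim: s => //= x s IH; rewrite negb_and negbK => /orP[xs|/IH[y [r pr]]].
  by exists x, (rem x s); rewrite perm_cons perm_to_rem.
exists y, (x :: r); apply: (@perm_trans _ (x :: y :: y :: r)); first by rewrite perm_cons.
by rewrite (perm_catCA [:: x] [:: y; y] r).
Qed.

Definition part_sum (s : seq qindex) : nat := (\sum_(x <- s) val x.2)%N.
Definition part_sqr (s : seq qindex) : nat := (\sum_(x <- s) val x.2 * val x.2)%N.

Lemma part_sqr_le s : (part_sqr s <= part_sum s * part_sum s)%N.
Proof.
rewrite /part_sqr /part_sum; elim: s => [|x s IH]; first by rewrite !big_nil.
by rewrite !big_cons; nia.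
Qed.

Lemma part_sum_Ylist a n r : part_sum (Ylist a n ++ r) = (n + part_sum r)%N.
Proof.
rewrite /Ylist /part_sum big_cat /=; case: insubP => [k _ <-|]; first by rewrite big_seq1.
by rewrite lt0n negbK big_nil => /eqP ->.
Qed.

Lemma part_sqr_Ylist a n r : part_sqr (Ylist a n ++ r) = (n * n + part_sqr r)%N.
Proof.
rewrite /Ylist /part_sqr big_cat /=; case: insubP => [k _ <-|]; first by rewrite big_seq1.
by rewrite lt0n negbK big_nil => /eqP ->.
Qed.

Lemma sum_center (A : zmodType) (h : nat -> nat -> A) m :
  \sum_(i < (2 * m).+1) h i (2 * m - i)%N =
  h m m + \sum_(i < (2 * m).+1 | nat_of_ord i != m) h i (2 * m - i)%N.
Proof.
have mm : (m < (2 * m).+1)%N by rewrite ltnS leq_pmull.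
rewrite (bigD1 (Ordinal mm)) //=; congr (h m _ + _).
by rewrite mul2n -addnn addnK.
Qed.

Lemma qrel_even a m : qrel a (2 * m) = (-1) ^+ m * Y a m * Y a m +
  \sum_(i < (2 * m).+1 | nat_of_ord i != m) (-1) ^+ i * Y a i * Y a (2 * m - i).
Proof. exact: (sum_center (fun i j => (-1) ^+ i * Y a i * Y a j)). Qed.

Lemma sign_center (A : comNzRingType) (x y r : A) m :
  x * y * r = (-1) ^+ m * r * ((-1) ^+ m * x * y).
Proof.
rewrite [RHS](_ : _ = (-1) ^+ m * (-1) ^+ m * (x * y * r)); last by ring.
by rewrite -exprD -signr_odd oddD addbb mul1r.
Qed.

Lemma sign_off_center (A : comNzRingType) (x y r : A) m i :
  - ((x * (y * r)) *~ (- (-1) ^+ (m + i))) = (-1) ^+ m * r * ((-1) ^+ i * x * y).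
Proof. by rewrite -mulrNz opprK exprD -mulrzl intrM !rmorphXn /= rmorphN1; ring. Qed.

(* Modulo the relation of weight [2m], the square [Y_m^2] is a combination of
   the products [Y_i Y_(2m-i)], [i != m], and passing to these increases the
   sum of the squares of the parts. *)
Lemma straight_Yprod s : straight (Yprod s).
Proof.
(* The sum of the parts is the same in all terms of a relation, and its square bounds the sum of
   their squares; so the difference decreases as the latter grows. *)
have [N] := ubnP (part_sum s * part_sum s - part_sqr s).
elim: N s => // N IH s sN.
case: (boolP (uniq s)) => [/straight_uniq //|/not_uniq_perm[[a k] [r pr]]].
pose m := val k; have m0 : (0 < m)%N by apply: (valP k).
have Yl : Ylist a m = [:: (a, k)] by rewrite /Ylist /m valK.
have sE : Yprod s = Y a m * Y a m * Yprod r.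
  by rewrite /Yprod (perm_big _ pr) /= !big_cons YE Yl /Yprod big_seq1 mulrA.
have sumE : part_sum s = (m + (m + part_sum r))%N.
  by rewrite /part_sum (perm_big _ pr) /= !big_cons.
have sqrE : part_sqr s = (m * m + (m * m + part_sqr r))%N.
  by rewrite /part_sqr (perm_big _ pr) /= !big_cons.
pose t (i : 'I_(2 * m).+1) := Ylist a i ++ Ylist a (2 * m - i) ++ r.
pose g := \sum_(i | nat_of_ord i != m) Yprod (t i) *~ - (-1) ^+ (m + i).
apply: (@straight_congr _ g).
  rewrite (_ : _ - _ = (-1) ^+ m * Yprod r * qrel a (2 * m)).
    by apply: ideal_genM; exists a, (2 * m)%N; rewrite muln_gt0.
  rewrite qrel_even mulrDr sE; apply: (f_equal2 (fun x y => x + y)); first exact: sign_center.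
  rewrite /g -sumrN mulr_sumr; apply: eq_bigr => i _.
  rewrite /t !Yprod_cat -!YE; exact: sign_off_center.
apply: (big_ind straight) => [|f h sf sh|i im].
- exact: straight0.
- by have := straightD 1 sf sh; rewrite mulr1z.
rewrite -[X in straight X]add0r; apply: straightD; first exact: straight0.
apply: IH; rewrite /t part_sum_Ylist part_sqr_Ylist part_sum_Ylist part_sqr_Ylist.
move: sN; rewrite sumE sqrE; have il := ltn_ord i.
have QW := part_sqr_le r; move: QW; move: (part_sum r) (part_sqr r) => W Q QW.
pose u := (2 * m - i)%N.
have iu : (i + u = 2 * m)%N by rewrite /u; lia.
have lt : (2 * (m * m) < i * i + u * u)%N by move/eqP: im; clear -iu; nia.
rewrite -/u (_ : i + (u + W) = 2 * m + W)%N; last by lia.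
rewrite (_ : m + (m + W) = 2 * m + W)%N; last by lia.
have : (2 * (m * m) + Q <= (2 * m + W) * (2 * m + W))%N by nia.
have : (i * i + u * u + Q <= (2 * m + W) * (2 * m + W))%N by nia.
by move: (i * i)%N (u * u)%N (m * m)%N lt ((2 * m + W) * (2 * m + W))%N => *; lia.
Qed.

Lemma malgUM (I : choiceType) (m m' : {cmonom I}) :
  << m >> * << m' >> = << mmul m m' >> :> polyZ I.
Proof.
rewrite (@malgMEw _ _ [fset m]%fset [fset m']%fset) ?msuppU_le // !big_seq_fset1.
by rewrite 2!mcoeffUU mulr1.
Qed.

Lemma Yprod_monom (s : seq qindex) : Yprod s = << \big[mmul/mone]_(x <- s) ucm x >>.
Proof.
rewrite /Yprod; elim: s => [|x s IH]; first by rewrite !big_nil.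
by rewrite !big_cons IH; exact: malgUM.
Qed.

Lemma straight_all f : straight f.
Proof.
rewrite [f]monalgE; apply: (big_ind straight) => [|g h sg sh|m _].
- exact: straight0.
- by have := straightD 1 sg sh; rewrite mulr1z.
have -> : << f@_m *g m >> = 0 + Yprod (cmlist m) *~ f@_m.
  rewrite add0r Yprod_monom -raddfMz /=.
  rewrite (_ : \big[_/_]_(_ <- _) _ = m) ?intz //.
  apply/eqP/cmP => x; rewrite cm_big -[RHS]count_cmlist -sum1_count [RHS]big_mkcond.
  by apply: eq_bigr => y _; rewrite ucmE /=; case: (y == x).
by apply: straightD; [exact: straight0|exact: straight_Yprod].
Qed.

Lemma evalZ_Yprod s : evalZ qgen (Yprod s) = \prod_(x <- s) qgen x.
Proof.
by rewrite /Yprod rmorph_prod; apply: eq_bigr => x _; rewrite /= evalZU mulr1z meval_ucm.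
Qed.

Lemma evalZ_Y a n : evalZ qgen (Y a n) = q n (val a).
Proof.
rewrite YE evalZ_Yprod /Ylist; case: insubP => [k _ <-|]; first by rewrite big_seq1.
by rewrite lt0n negbK big_nil => /eqP ->; rewrite q0.
Qed.

Lemma evalZ_ideal f : ideal_gen qrels f -> evalZ qgen f = 0.
Proof.
move=> [s [sJ ->]]; rewrite rmorph_sum big_seq big1 //= => p /sJ[a [n [n0 ->]]].
rewrite rmorphM /= [evalZ _ (qrel _ _)](_ : _ = 0) ?mulr0 //.
have [_ _ oa a0] := eLYNoP a.
rewrite -[RHS](q_relation oa a0 n0) /qrel rmorph_sum; apply: eq_bigr => i _ /=.
by rewrite !rmorphM rmorphXn rmorphN1 /= !evalZ_Y.
Qed.

Lemma evalZ_lincomb c : evalZ qgen (lincomb Ystrict c) = lincomb qfam c.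
Proof.
rewrite rmorph_sum; apply: eq_bigr => l _ /=.
by rewrite rmorphMz /= /Ystrict evalZ_Yprod qfamE.
Qed.

Lemma evalZ_straight f : exists2 c, ideal_gen qrels (f - lincomb Ystrict c) &
  evalZ qgen f = lincomb qfam c.
Proof.
have [c cJ] := straight_all f; exists c => //.
by apply/eqP; rewrite -evalZ_lincomb -subr_eq0 -rmorphB; apply/eqP/evalZ_ideal.
Qed.

(** [weight_free] is applied to a composite of three injections: a strict family is a set of
    generators, Glaisher turns it into a monomial in the generators of odd index, and [gconcat] into
    an odd word. That the [qfam] span comes from straightening. *)
Lemma qfam_free c : lincomb qfam c = 0 -> forall l, c l = 0.
Proof.
move=> c0 l; case: (boolP (l \in finsupp c)) => [lc|/fsfun_dflt //].
have H : \sum_(l <- finsupp c) (c l)%:~R *: qfam l = 0 :> QX.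
  by rewrite -[RHS]c0; apply: eq_bigr => k _; rewrite scale_intr.
apply/eqP; rewrite -(intr_eq0 rat); apply/eqP; move: l lc.
apply: (@weight_free _ qfam (fun l => gconcat (glaisher (splist l)))) H; last exact: fset_uniq.
- by move=> l; apply: pqsymZ_Q; apply: qfam_pqsymZ.
- by move=> l; rewrite sumn_gconcat; apply: splist_homog.
- by move=> l; apply: gconcat_odd.
- by move=> l l' /gconcat_inj/(glaisher_inj (splist_uniq l) (splist_uniq l'))/splist_inj.
move=> w /L_imageZ/asboolP[f <-]; have [d _ ->] := evalZ_straight f.
exists [seq ((d l)%:~R, l) | l <- finsupp d]; rewrite big_map.
by apply: eq_bigr => l _; rewrite scale_intr.
Qed.

Lemma zbasis_qfam : zbasis PQSym qfam.
Proof.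
split; first exact: qfam_free.
rewrite -range_evalZ_qgen; apply/seteqP; split=> [_ [c _ <-]|_ [f _ <-]].
  by exists (lincomb Ystrict c); rewrite // evalZ_lincomb.
by have [c _ ->] := evalZ_straight f; exists c.
Qed.

(** An element of the kernel is congruent to a combination of strict monomials with value 0, and
    independence of the [qfam] makes all its coefficients vanish. *)
Lemma evalZ_qgen_kernel : [set p | evalZ qgen p = 0] = ideal_gen qrels.
Proof.
apply/seteqP; split=> [f /= f0|f /evalZ_ideal //].
have [c cJ cE] := evalZ_straight f; move: cE; rewrite f0 => /esym/qfam_free c0.
move: cJ; rewrite /lincomb big1 ?subr0 // => l _; by rewrite c0 mulr0z.
Qed.
End Straightening.

(** * The symmetric functions inside PQSym *)

Lemma eLYNo_one : is_eLYNo [:: 1%N].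
Proof. by rewrite /is_eLYNo /elementary big_seq1. Qed.

Definition lyndon_one : eLYNo := exist _ [:: 1%N] eLYNo_one.

Notation qsym_odd := (fun n : oddnat => qsym (val n)).

Definition cm_one (m : {cmonom oddnat}) : {cmonom gidx} :=
  \big[mmul/mone]_(n <- cmlist m) ucm (lyndon_one, n).

Lemma cm_oneE m n : cm_one m (lyndon_one, n) = m n.
Proof.
rewrite cm_big -[RHS]count_cmlist -sum1_count [RHS]big_mkcond; apply: eq_bigr => k _.
by rewrite ucmE xpair_eqE eqxx /=; case: (k == n).
Qed.

Lemma meval_list (I : choiceType) (A : comNzRingType) (b : I -> A) m :
  meval b m = \prod_(x <- cmlist m) b x.
Proof.
rewrite /cmlist big_flatten big_map; apply: eq_bigr => x _.
by rewrite big_nseq; elim: (m x) => //= n IH; rewrite exprS IH.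
Qed.

Lemma meval_cm_one m : meval qodd (cm_one m) = meval qsym_odd m.
Proof.
rewrite [RHS]meval_list /cm_one; elim: (cmlist m) => [|n s IH]; first by rewrite !big_nil mmorph1.
by rewrite !big_cons mmorphM /= IH meval_ucm /qodd /= qsymE.
Qed.

Lemma cm_one_inj : injective cm_one.
Proof. by move=> m m' e; apply/eqP/cmP => n; rewrite -!cm_oneE e. Qed.

Lemma mcoeff_sum_inj (I : eqType) (J : choiceType) (f : I -> {cmonom J}) (c : I -> rat)
  (r : seq I) i : injective f -> uniq r -> i \in r ->
  (\sum_(k <- r) << c k *g f k >>)@_(f i) = c i.
Proof.
move=> f_inj ur ir; rewrite raddf_sum (bigD1_seq i) // big1 => [|k ki].
  by rewrite /= addr0; exact: mcoeffUU.
by rewrite /= mcoeffU (inj_eq f_inj) (negbTE ki).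
Qed.

(** The monomials [cm_one m] embed this polynomial ring into the one on all generators of odd index,
    compatibly with evaluation, so injectivity is inherited from [evalQ_qodd_inj]. *)
Lemma evalQ_qsym_inj : injective (evalQ qsym_odd).
Proof.
move=> p r pr; apply/eqP; rewrite -subr_eq0; set d := p - r.
have d0 : evalQ qsym_odd d = 0 by rewrite rmorphB /= pr subrr.
have e0 : \sum_(m <- msupp d) << d@_m *g cm_one m >> = 0 :> polyQ gidx.
  apply: evalQ_qodd_inj; rewrite rmorph0 rmorph_sum -[RHS]d0 evalQE /=.
  by apply: eq_bigr => m _; rewrite evalQU meval_cm_one.
apply/eqP/malgP => m; rewrite mcoeff0.
case: (boolP (m \in msupp d)) => [md|/mcoeff_outdom //].
rewrite -(mcoeff_sum_inj (fun m => d@_m) cm_one_inj (fset_uniq _) md).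
by rewrite e0 mcoeff0.
Qed.

Lemma qsym_imageQ n : qsym n \in imageQ qsym_odd.
Proof.
rewrite qsymE; apply: q_even_image => // k ok; rewrite -qsymE.
exact: (imageQ_gen qsym_odd (exist _ k ok : oddnat)).
Qed.

Lemma qsym_Gamma (n : oddnat) : Gamma (qsym (val n)).
Proof.
move=> S [_]; apply; exists (val n) => //.
by case: n => -[].
Qed.

Lemma meval_Gamma m : Gamma (meval qsym_odd m).
Proof.
rewrite meval_list => S [[S1 SB SM] SG].
elim: (cmlist m) => [|n s IH].
  by rewrite big_nil; have := S1; rewrite inE.
rewrite big_cons; apply/set_mem/SM; last exact: mem_set.
by apply: mem_set; apply: qsym_Gamma.
Qed.

Lemma poly_basis_qsym : poly_basis GammaQ qsym_odd.
Proof.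
split; first exact: evalQ_qsym_inj.
rewrite range_evalQ; apply/seteqP; split=> f /=.
  move=> /asboolP[p <-]; rewrite evalQE; exists [seq (p@_m, meval qsym_odd m) | m <- msupp p].
  split; last by rewrite big_map.
  by move=> _ /mapP[m _ ->]; apply: meval_Gamma.
move=> [s [sG ->]]; rewrite big_seq rpred_sum // => x /sG xG; rewrite rpredZ //.
apply: (xG [set` imageQ qsym_odd]); split=> [|_ [n _ ->]]; last exact: qsym_imageQ.
have [i1 iB iM] := imageQ_subalg qsym_odd.
split=> [|g h|g h]; rewrite !inE /= ?rpred1 //.
  by move=> gi hi; rewrite -[g - h]addrC -scaleN1r rpredD // rpredZ.
by move=> gi hi; rewrite rpredM.
Qed.

Theorem theorem3p8 :
  [/\ (* surjectivity onto PQSym, kernel, Z-basis *)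
      range (evalZ qgen) = PQSym,
      [set p | evalZ qgen p = 0] =
        ideal_gen [set p | exists a n, (0 < n)%N /\ p = qrel a n]
    & zbasis PQSym qfam]
  /\
  [/\ poly_basis PQSymQ qodd,
      (* the index (1) is in eLYN_o, and q_n((1)) = q_n *)
      is_eLYNo [:: 1%N],
      forall n : nat, odd n -> q n [:: 1%N] = qsym n
    & poly_basis GammaQ (fun n : oddnat => qsym (val n))].
Proof.
split; split.
- exact: range_evalZ_qgen.
- exact: evalZ_qgen_kernel.
- exact: zbasis_qfam.
- exact: poly_basis_qodd.
- exact: eLYNo_one.
- by move=> n _; rewrite qsymE.
- exact: poly_basis_qsym.
Qed.
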